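(* Let $(\mathbb R^3\setminus B_1(0),g)$ be an asymptotically flat end with mass $m>0$. For every $\Lambda<\infty$ and every vector $b\in\mathbb R^3$ there exist constants $\sigma_0$ and $C>0$ such that, for every surface $N$ of constant mean curvature $H$ in this end with $\int_N H^2\,d\mu\le\Lambda$ and $r_0(N)\ge\sigma_0$, $$\frac1{8\pi}\int_N\frac{H}{|x|}\,\nu\cdot b\,d\sigma+\frac1{4\pi}\int_N\frac{(\nu\cdot x)(\nu\cdot b)}{|x|^3}\,d\sigma\le C\,m^{-1}r_0(N)^{-1}.$$
   Context: An asymptotically flat end with mass $m$ is $(\mathbb R^3\setminus B_1(0),g)$ with $g_{ij}(x)=\left(1+\frac{m}{2|x|}\right)^4\delta_{ij}+T_{ij}(x)$, where for some constant $C$, $|\partial^l T_{ij}|(x)\le C|x|^{-2-l}$ for $0\le l\le 4$ ($\partial$: Euclidean partial derivatives). Surfaces are closed and embedded in $\mathbb R^3\setminus B_1(0)$. $H$ is the (constant) mean curvature of $N$ with respect to $g$ and the outward normal (round Euclidean spheres having positive mean curvature). $d\mu$ is the area element induced by $g$, $d\sigma$ the one induced by the Euclidean metric, $\nu$ the outward Euclidean unit normal of $N\subset\mathbb R^3$, $\cdot$ the Euclidean inner product, and $r_0(N)=\min\{|x|:x\in N\}$. *)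

(* Defs.v *)
From HB Require Import structures.
From mathcomp Require Import all_boot all_order all_algebra.
From mathcomp Require Import all_classical all_reals all_analysis.

Set Implicit Arguments.
Unset Strict Implicit.
Unset Printing Implicit Defensive.

Import Order.TTheory GRing.Theory Num.Theory.
Import numFieldNormedType.Exports.

Local Open Scope classical_set_scope.
Local Open Scope ring_scope.

(* The library norm `|x| on 'rV[R]_3 is the maximum norm; the Euclidean norm
   is [enorm]. *)
Definition dot (R : realType) (x y : 'rV[R]_3) : R := (x *m y^T) 0 0.
Definition enorm (R : realType) (x : 'rV[R]_3) : R := Num.sqrt (dot x x).

(* Asking for the derivatives in all directions, and not only along a basis,
   yields the usual class C^k on an open set of a finite-dimensional space. *)
Fixpoint Ck (R : realType) (V W : normedModType R) (k : nat) (U : set V)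
    (f : V -> W) : Prop :=
  (forall x, U x -> {for x, continuous f}) /\
  (if k is k'.+1 then
     forall v : V, (forall x, U x -> derivable f x v) /\
                   Ck k' U (fun x => 'D_v f x)
   else True).

Definition partial (R : realType) (i : 'I_3) (f : 'rV[R]_3 -> R)
    (x : 'rV[R]_3) : R := 'D_(delta_mx 0 i : 'rV[R]_3) f x.
Definition partials (R : realType) (s : seq 'I_3) (f : 'rV[R]_3 -> R) :
  'rV[R]_3 -> R := foldr (@partial R) f s.

(* The end is the part |x| > 1 of R^3; the values elsewhere of a metric
   'rV[R]_3 -> 'M[R]_3 are irrelevant. *)
Definition exterior (R : realType) : set 'rV[R]_3 := [set x | 1 < enorm x].

Definition schwarzschild (R : realType) (m : R) (x : 'rV[R]_3) : 'M[R]_3 :=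
  ((1 + m / (2 * enorm x)) ^+ 4)%:M.

Record asymptotically_flat_end (R : realType) (m : R)
    (g : 'rV[R]_3 -> 'M[R]_3) : Prop := AsymptoticallyFlatEnd {
  af_sym : forall x, exterior x -> (g x)^T = g x ;
  af_pos : forall x, exterior x ->
    forall v : 'rV[R]_3, v != 0 -> 0 < (v *m g x *m v^T) 0 0 ;
  af_C4 : forall i j : 'I_3,
    Ck 4 (@exterior R) (fun x => (g x - schwarzschild m x) i j : R) ;
  af_decay : exists C : R, forall (i j : 'I_3) (s : seq 'I_3),
    (size s <= 4)%N -> forall x, exterior x ->
    `|partials s (fun y => (g y - schwarzschild m y) i j) x|
      <= C * enorm x ^- (2 + size s)
}.

Definition euclidean (R : realType) (x : 'rV[R]_3) : 'M[R]_3 := 1%:M.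

Definition christoffel (R : realType) (g : 'rV[R]_3 -> 'M[R]_3)
    (x : 'rV[R]_3) (k i j : 'I_3) : R :=
  2^-1 * \sum_l invmx (g x) k l *
    (partial i (fun y => g y j l) x + partial j (fun y => g y i l) x
     - partial l (fun y => g y i j) x).

Definition axis (R : realType) (i : 'I_2) : (R * R)%type :=
  if i == 0 then (1, 0) else (0, 1).

(* Row i is the coordinate tangent vector d_i phi. *)
Definition frame (R : realType) (phi : R * R -> 'rV[R]_3) (u : R * R) :
  'M[R]_(2, 3) := \matrix_(i < 2, k < 3) ('D_(axis R i) phi u) 0 k.

(* Being relatively open on every open U' makes phi a homeomorphism onto a
   relatively open part of N, so that N is embedded near phi(U). *)
Record local_param (R : realType) (N : set 'rV[R]_3) (U : set (R * R))
    (phi : R * R -> 'rV[R]_3) : Prop := LocalParam {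
  lp_open : open U ;
  lp_C2 : Ck 2 U phi ;
  lp_immersion : forall u, U u -> row_free (frame phi u) ;
  lp_inj : forall u v, U u -> U v -> phi u = phi v -> u = v ;
  lp_homeo : forall U' : set (R * R), open U' -> U' `<=` U ->
    exists2 W : set 'rV[R]_3, open W & phi @` U' = N `&` W
}.

Record closed_surface (R : realType) (N : set 'rV[R]_3) : Prop :=
  ClosedSurface {
  cs_nonempty : N !=set0 ;
  cs_compact : compact N ;
  cs_param : forall p, N p ->
    exists (U : set (R * R)) (phi : R * R -> 'rV[R]_3),
      local_param N U phi /\ (phi @` U) p
}.

Definition induced_metric (R : realType) (g : 'rV[R]_3 -> 'M[R]_3)
    (phi : R * R -> 'rV[R]_3) (u : R * R) : 'M[R]_2 :=
  frame phi u *m g (phi u) *m (frame phi u)^T.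

(* R^3 with its Borel sigma-algebra. *)
Notation borel3 R := (g_sigma_algebraType (@open 'rV[R]_3)).

(* The area element sqrt(det(phi^* g)) du1 du2 of N for g; these two clauses
   determine mu. *)
Definition is_area_measure (R : realType) (g : 'rV[R]_3 -> 'M[R]_3)
    (N : set 'rV[R]_3) (mu : {measure set (borel3 R) -> \bar R}) : Prop :=
  mu (~` N) = 0%E /\
  forall (U : set (R * R)) (phi : R * R -> 'rV[R]_3), local_param N U phi ->
  forall A : set (measurableTypeR R * measurableTypeR R),
    measurable A -> A `<=` U ->
    mu (phi @` A) =
    (\int[(@lebesgue_measure R \x @lebesgue_measure R)]_(u in A)
       (Num.sqrt (\det (induced_metric g phi u)))%:E)%E.

Definition enclosed (R : realType) (S : set 'rV[R]_3) : set 'rV[R]_3 :=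
  [set x | ~ S x /\ bounded_set (connected_component (~` S) x)].

(* "Outward" at p refers to the component of N through p, which is N itself
   when N is connected. *)
Record outward_unit_normal (R : realType) (N : set 'rV[R]_3)
    (nu : 'rV[R]_3 -> 'rV[R]_3) : Prop := OutwardUnitNormal {
  un_continuous : {within N, continuous nu} ;
  un_unit : forall p, N p -> enorm (nu p) = 1 ;
  un_normal : forall U phi, local_param N U phi ->
    forall u, U u -> frame phi u *m (nu (phi u))^T = 0 ;
  un_outward : forall p, N p -> \forall t \near (0 : R)^'+,
    enclosed (connected_component N p) (p - t *: nu p) /\
    ~ enclosed (connected_component N p) (p + t *: nu p)
}.

(* The unit normal for the metric g, obtained from the Euclidean normal n by
   raising the index of the covector n and normalizing. *)
Definition metric_normal (R : realType) (g : 'rV[R]_3 -> 'M[R]_3)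
    (x n : 'rV[R]_3) : 'rV[R]_3 :=
  (Num.sqrt ((n *m invmx (g x) *m n^T) 0 0))^-1 *: (n *m invmx (g x)).

(* The ambient covariant derivative of d_j phi along d_i phi. *)
Definition cov_frame (R : realType) (g : 'rV[R]_3 -> 'M[R]_3)
    (phi : R * R -> 'rV[R]_3) (u : R * R) (i j : 'I_2) : 'rV[R]_3 :=
  'D_(axis R i) (fun v => 'D_(axis R j) phi v) u +
  \row_k \sum_a \sum_b
    christoffel g (phi u) k a b * frame phi u i a * frame phi u j b.

(* The minus sign gives round spheres positive mean curvature with respect to
   their outward normal. *)
Definition second_fundamental_form (R : realType)
    (g : 'rV[R]_3 -> 'M[R]_3) (nu : 'rV[R]_3 -> 'rV[R]_3)
    (phi : R * R -> 'rV[R]_3) (u : R * R) : 'M[R]_2 :=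
  \matrix_(i, j) - (cov_frame g phi u i j *m g (phi u) *m
                    (metric_normal g (phi u) (nu (phi u)))^T) 0 0.

(* The sum, not the average, of the principal curvatures. *)
Definition mean_curvature (R : realType) (g : 'rV[R]_3 -> 'M[R]_3)
    (nu : 'rV[R]_3 -> 'rV[R]_3) (phi : R * R -> 'rV[R]_3) (u : R * R) : R :=
  \tr (invmx (induced_metric g phi u) *m second_fundamental_form g nu phi u).

Definition has_constant_mean_curvature (R : realType)
    (g : 'rV[R]_3 -> 'M[R]_3) (N : set 'rV[R]_3)
    (nu : 'rV[R]_3 -> 'rV[R]_3) (H : R) : Prop :=
  forall U phi, local_param N U phi ->
  forall u, U u -> mean_curvature g nu phi u = H.

Definition inner_radius (R : realType) (N : set 'rV[R]_3) : R :=
  inf [set enorm x | x in N].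

(* Main.v *)
Require Import Defs.
From HB Require Import structures.
From mathcomp Require Import all_boot all_order all_algebra.
From mathcomp Require Import all_classical all_reals all_analysis.
From mathcomp Require Import measurable_realfun.
From mathcomp Require Import ring lra.

Set Implicit Arguments.
Unset Strict Implicit.
Unset Printing Implicit Defensive.

Import Order.TTheory GRing.Theory Num.Theory.
Import numFieldNormedType.Exports.

Local Open Scope classical_set_scope.
Local Open Scope ring_scope.

(** The inequality is the force balance of a constant mean curvature surface in
    the direction b, read off from the first variation of area.

    Write r = |x|, n for the Euclidean unit normal, sigma for the Euclidean
    area and r0 for the inner radius. For every C^1 vector field X the first
    variation of area and of enclosed volume in the metric g reads
      int_N rho tr (P (DX g + 1/2 D_X g)) dsigma = H int_N sqrt (det g) n.X dsigma,
    where P is the inverse of the metric induced on the tangent plane and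
    rho = sqrt (det g * n g^-1 n) is the ratio of the area elements
    ([first_variation]). Only first derivatives of g and X enter, so that no
    bound on the second fundamental form is needed. The metric gives
    rho P g = I - n^T n + O(1/r), 1/2 rho tr (P D_X g) = - 2 m (x.X) / r^3 +
    O(r^-3) |X| and sqrt (det g) = 1 + 3 m / r + O(r^-2), uniformly in n
    ([principal_approx], [drift_approx], [sqrt_det_approx]).

    The field X = (1 - 2 m / r) b turns the formula into
      - 2 m int (x.n)(b.n) / r^3 = H int (1 + m / r) b.n
        + O(int r^-3) + |H| O(int r^-2).
    The flux int b.n vanishes because b is a curl ([flux_zero]); what is left is
    8 pi m times the left-hand side of the theorem. The errors have to be bounded
    by a multiple of 1 / r0. The fields x / r^q have Euclidean divergence
    (2 - q) r^-q + q (x.n)^2 r^-(q+2) along N: for q = 3 the term - r^-3 has the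
    sign that controls int r^-3, at the price of (x.n)^2 r^-5, which is at most
    (x.n)^2 r^-4 / r0 and is controlled by the case q = 2. With weights -1 and
    4 / r0, and with Young's inequality for the terms linear in H, all errors are
    absorbed pointwise, up to a multiple of H^2 / r0 ([variation_inequality]).
    Finally H^2 times the Euclidean area is at most 2 Lambda, since the two area
    elements are comparable ([total_curvature_bound]).

    The first variation formula is proved by Stokes' theorem. The integrand is
    linear in the 1-jet of X, so a partition of unity reduces the claim to fields
    supported in one chart ([exact_integral]). There the integrand is the
    divergence of the plane field with components s h^(ij) (d_j phi g).X, where h
    is the Gram matrix and s the area density of g ([variation_exact]): the
    tangential part of the divergence of s h^(ij) d_j phi cancels against the
    Christoffel symbols, and its normal part is the mean curvature
    ([tangential_cancellation], [Z_mean_curvature]). *)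

(** * Mixed derivatives commute *)

Lemma derive_along_line (R : realType) (V W : normedModType R) (f : V -> W)
    (y v : V) (t : R) :
  derivable f (y + t *: v) v ->
  is_derive t 1 (fun s : R => f (y + s *: v)) ('D_v f (y + t *: v)).
Proof.
have E : (fun h : R => h^-1 *: (f (h *: v + (y + t *: v)) - f (y + t *: v))) =
   (fun h : R => h^-1 *: (f (y + (h *: (1 : R) + t) *: v) - f (y + t *: v))).
  apply/funext => h; congr (_ *: (f _ - _)).
  by rewrite [h *: 1]mulr1 scalerDl addrCA.
by move=> df; apply: DeriveDef; rewrite /derivable /derive -E.
Qed.

(** The increment h may have either sign, as it does when the increment of a
    function is split along the coordinate axes. *)
Lemma MVT_along_line (R : realType) (V : normedModType R) (f df : V -> R)
    (y v : V) (h : R) :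
  (forall t, `|t| <= `|h| -> is_derive (y + t *: v) v f (df (y + t *: v))) ->
  exists2 t, `|t| <= `|h| & f (y + h *: v) - f y = h * df (y + t *: v).
Proof.
move=> fdf.
have dl t : `|t| <= `|h| ->
    is_derive t (1 : R) (fun s : R => f (y + s *: v)) (df (y + t *: v)).
  by move=> /fdf[d <-]; exact: derive_along_line.
have cont (a b : R) : (forall t, t \in `[a, b] -> `|t| <= `|h|) ->
    {within `[a, b], continuous (fun s : R => f (y + s *: v))}.
  move=> ab; apply: continuous_in_subspaceT => t; rewrite inE => tab.
  apply: differentiable_continuous; apply/derivable1_diffP.
  by have [] := dl t (ab t tab).
have [h0|h0] := leP 0 h.
  have sub t : t \in `[0, h] -> `|t| <= `|h|.
    by rewrite in_itv/= => /andP[t0 th]; rewrite !ger0_norm.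
  have [t|t t0h] := @MVT_segment R _ (fun t => df (y + t *: v)) 0 h h0 _ (cont _ _ sub).
    by move=> /subset_itv_oo_cc /sub /dl.
  by rewrite scale0r addr0 subr0 => ->; exists t; [exact: sub|rewrite mulrC].
have sub t : t \in `[h, 0] -> `|t| <= `|h|.
  by rewrite in_itv/= => /andP[ht t0]; rewrite !ler0_norm ?lerN2// ltW.
have [t|t t0h] := @MVT_segment R _ (fun t => df (y + t *: v)) h 0 (ltW h0) _ (cont _ _ sub).
  by move=> /subset_itv_oo_cc /sub /dl.
rewrite scale0r addr0 sub0r => E; exists t; first exact: sub.
by rewrite -[LHS]opprB E mulrN opprK mulrC.
Qed.

(** Clairaut's theorem: the two mean value expansions of the second difference
    f(x + hv + hw) - f(x + hv) - f(x + hw) + f(x) are h^2 times the two mixed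
    derivatives at points tending to x. *)
Lemma mixed_derivatives_commute (R : realType) (V : normedModType R)
    (f fv fw fvw fwv : V -> R) (v w x : V) (U : set V) :
  open U -> U x ->
  (forall y, U y -> is_derive y v f (fv y)) ->
  (forall y, U y -> is_derive y w f (fw y)) ->
  (forall y, U y -> is_derive y w fv (fvw y)) ->
  (forall y, U y -> is_derive y v fw (fwv y)) ->
  {for x, continuous fvw} -> {for x, continuous fwv} ->
  fvw x = fwv x.
Proof.
move=> oU Ux dv dw dvw dwv cvw cwv.
apply/eqP; rewrite -subr_eq0 -normr_le0; apply/ler_addgt0Pr => e e0; rewrite add0r.
have e2 : 0 < e / 2 by rewrite divr_gt0.
have near_x : \forall z \near x, U z /\
    `|fvw x - fvw z| < e / 2 /\ `|fwv x - fwv z| < e / 2.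
  apply: filterI; first exact: open_nbhs_nbhs (conj oU Ux).
  apply: filterI; [exact: ((cvgrPdist_lt _ _).1 cvw _ e2)|exact: ((cvgrPdist_lt _ _).1 cwv _ e2)].
have [d dP] := nbhs_ex near_x.
pose M := `|v| + `|w| + 1.
have M0 : 0 < M by rewrite ltr_wpDl// addr_ge0.
pose h := d%:num / (2 * M).
have h0 : 0 < h by rewrite divr_gt0// mulr_gt0.
have inU s t : `|s| <= `|h| -> `|t| <= `|h| -> ball x d%:num (x + s *: v + t *: w).
  rewrite (gtr0_norm h0) => sh th; rewrite -ball_normE /ball_/=.
  rewrite -addrA opprD addrA subrr sub0r normrN (le_lt_trans (ler_normD _ _))//.
  rewrite !normrZ (@le_lt_trans _ _ (h * `|v| + h * `|w|))//.
    by apply: lerD; apply: ler_wpM2r.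
  rewrite -mulrDr (@lt_le_trans _ _ (h * M))//.
    by rewrite ltr_pM2l// /M ltrDl.
  by rewrite /h invfM mulrA -mulrA mulVf ?gt_eqF// mulr1 ler_pdivrMr// ler_peMr// ler1n.
have h00 : `|0 : R| <= `|h| by rewrite normr0.
have hh : `|h| <= `|h| by [].
have shift (a b : V) (fa : V -> R) (y : V) : is_derive (y + b) a f (fa (y + b)) ->
    is_derive y a (fun z => f (z + b)) (fa (y + b)).
  have E : (fun k : R => k^-1 *: (f (k *: a + y + b) - f (y + b))) =
      (fun k : R => k^-1 *: (f (k *: a + (y + b)) - f (y + b))).
    by apply/funext => k; rewrite addrA.
  by move=> [da <-]; apply: DeriveDef; rewrite /derivable /derive E.
pose Delta := f (x + h *: v + h *: w) - f (x + h *: v) - (f (x + h *: w) - f x).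
have [s1 s1h E1] : exists2 s, `|s| <= `|h| &
    Delta = h * (fv (x + s *: v + h *: w) - fv (x + s *: v)).
  have [s sh|s sh E] := @MVT_along_line R V (fun z => f (z + h *: w) - f z)
      (fun z => fv (z + h *: w) - fv z) x v h.
    apply: is_deriveB; first by apply: shift; apply: dv; exact: (dP _ (inU s h sh hh)).1.
    apply: dv; have := (dP _ (inU s 0 sh h00)).1; by rewrite scale0r addr0.
  exists s => //; rewrite -E /Delta; ring.
have [t1 t1h E2] := @MVT_along_line R V fv fvw (x + s1 *: v) w h
  (fun t th => dvw _ (dP _ (inU s1 t s1h th)).1).
have [t2 t2h E3] : exists2 t, `|t| <= `|h| &
    Delta = h * (fw (x + h *: v + t *: w) - fw (x + t *: w)).
  have [t th|t th E] := @MVT_along_line R V (fun z => f (z + h *: v) - f z)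
      (fun z => fw (z + h *: v) - fw z) x w h.
    apply: is_deriveB; first by apply: shift; apply: dw; rewrite addrAC; exact: (dP _ (inU h t hh th)).1.
    apply: dw; have := (dP _ (inU 0 t h00 th)).1; by rewrite scale0r addr0.
  exists t => //; rewrite [x + h *: v + _]addrAC -E /Delta [x + h *: w + _]addrAC; ring.
have [s2 s2h E4] : exists2 s, `|s| <= `|h| &
    fw (x + h *: v + t2 *: w) - fw (x + t2 *: w) = h * fwv (x + s *: v + t2 *: w).
  have [s sh|s sh E] := @MVT_along_line R V fw fwv (x + t2 *: w) v h.
    by rewrite addrAC; apply: dwv; exact: (dP _ (inU s t2 sh t2h)).1.
  by exists s => //; rewrite addrAC E addrAC.
have [_ [A _]] := dP _ (inU s1 t1 s1h t1h).
have [_ [_ B]] := dP _ (inU s2 t2 s2h t2h).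
have EE : fvw (x + s1 *: v + t1 *: w) = fwv (x + s2 *: v + t2 *: w).
  by apply: (mulfI (lt0r_neq0 h0)); apply: (mulfI (lt0r_neq0 h0)); rewrite -E2 -E4 -E1 -E3.
rewrite -EE distrC in B.
rewrite (le_trans (ler_distD (fvw (x + s1 *: v + t1 *: w)) _ _))//.
by rewrite [e]splitr; apply: lerD; exact: ltW.
Qed.

(** * Vectors, matrices and gradients on R^3 *)

Section vectors.
Variable R : realType.
Implicit Types x y z : 'rV[R]_3.

Lemma dotE x y : dot x y = \sum_i x 0 i * y 0 i.
Proof. by rewrite /dot mxE; apply: eq_bigr => i _; rewrite mxE. Qed.

Lemma dot3 x y : dot x y = x 0 0 * y 0 0 + x 0 1 * y 0 1 + x 0 2%:R * y 0 2%:R.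
Proof.
rewrite dotE !big_ord_recl big_ord0 addr0 addrA.
by congr (x 0 _ * y 0 _ + x 0 _ * y 0 _ + x 0 _ * y 0 _); apply/val_inj.
Qed.

Lemma dotC x y : dot x y = dot y x.
Proof. by rewrite !dotE; apply: eq_bigr => i _; rewrite mulrC. Qed.

Lemma dotDl x y z : dot (x + y) z = dot x z + dot y z.
Proof. by rewrite /dot mulmxDl mxE. Qed.

Lemma dotZl a x y : dot (a *: x) y = a * dot x y.
Proof. by rewrite /dot -scalemxAl mxE. Qed.

Lemma dotDr x y z : dot z (x + y) = dot z x + dot z y.
Proof. by rewrite dotC dotDl !(dotC z). Qed.

Lemma dotZr a x y : dot x (a *: y) = a * dot x y.
Proof. by rewrite dotC dotZl dotC. Qed.

Lemma dot0l x : dot 0 x = 0. Proof. by rewrite /dot mul0mx mxE. Qed.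
Lemma dot0r x : dot x 0 = 0. Proof. by rewrite dotC dot0l. Qed.
Lemma dotNl x y : dot (- x) y = - dot x y.
Proof. by rewrite -scaleN1r dotZl mulN1r. Qed.
Lemma dotBl x y z : dot (x - y) z = dot x z - dot y z.
Proof. by rewrite dotDl dotNl. Qed.

Lemma dot_delta i x : dot (delta_mx 0 i) x = x 0 i.
Proof.
rewrite dotE (bigD1 i)//= big1 ?addr0 ?mxE ?eqxx ?mul1r// => j ji.
by rewrite mxE (negPf ji) andbF mul0r.
Qed.

Lemma dot_ge0 x : 0 <= dot x x.
Proof. by rewrite dotE sumr_ge0// => i _; rewrite -expr2 sqr_ge0. Qed.

Lemma enorm_ge0 x : 0 <= enorm x. Proof. exact: sqrtr_ge0. Qed.

Lemma enorm_sq x : enorm x ^+ 2 = dot x x.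
Proof. by rewrite sqr_sqrtr// dot_ge0. Qed.

Lemma coord_le_enorm x i : `|x 0 i| <= enorm x.
Proof.
rewrite -[leLHS]sqrtr_sqr ler_wsqrtr// dotE (bigD1 i)//= -expr2 lerDl.
by rewrite sumr_ge0// => j _; rewrite -expr2 sqr_ge0.
Qed.

Lemma coord_le_norm x i : `|x 0 i| <= `|x|.
Proof.
rewrite [leRHS]/Num.Def.normr/= mx_normrE.
exact: (le_bigmax _ (fun ij : 'I_1 * 'I_3 => `|x ij.1 ij.2|) (0, i)).
Qed.

Lemma norm_le_coord x e : 0 <= e -> (forall i, `|x 0 i| <= e) -> `|x| <= e.
Proof.
move=> e0 xe; rewrite [leLHS]/Num.Def.normr/= mx_normrE.
by apply: bigmax_le => // -[i j] _ /=; rewrite ord1.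
Qed.

End vectors.

Lemma cvg_mx (R : realType) (T : Type) (F : set_system T) {FF : Filter F} (m n : nat)
    (f : T -> 'M[R]_(m, n)) (l : 'M[R]_(m, n)) :
  (forall i j, (fun t => f t i j) @ F --> l i j) -> f @ F --> l.
Proof.
move=> fl A [P Pl PA]; apply: (filterS (P := fun t => forall ij : 'I_m * 'I_n, P ij.1 ij.2 (f t ij.1 ij.2))).
  by move=> t Pt; apply: PA => i j; exact: (Pt (i, j)).
by apply: filter_forall => -[i j]; exact: fl (Pl i j).
Qed.

Lemma cvg_coord (R : realType) (T : Type) (F : set_system T) {FF : Filter F} (m n : nat)
    (f : T -> 'M[R]_(m, n)) (l : 'M[R]_(m, n)) i j :
  f @ F --> l -> (fun t => f t i j) @ F --> l i j.
Proof.
move=> fl A Al; apply: (fl [set M : 'M[R]_(m, n) | A (M i j)]).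
exists (fun i' j' => if (i', j') == (i, j) then A else setT) => [i' j'|M].
  by case: eqP => [[-> ->]//|_]; exact: filterT.
by move=> /(_ i j); rewrite eqxx.
Qed.

Lemma cvg_sumr (R : realType) (T : Type) (F : set_system T) {FF : Filter F} (I : Type) (s : seq I)
    (f : I -> T -> R) (l : I -> R) :
  (forall i, f i @ F --> l i) -> (fun t => \sum_(i <- s) f i t) @ F --> \sum_(i <- s) l i.
Proof.
move=> fl; elim: s => [|i s IH].
  by rewrite big_nil; under eq_fun do rewrite big_nil; exact: cvg_cst.
by rewrite big_cons; under eq_fun do rewrite big_cons; exact: cvgD.
Qed.

Lemma cvg_mulmx (R : realType) (T : Type) (F : set_system T) {FF : Filter F} (m n p : nat)
    (f : T -> 'M[R]_(m, n)) (g : T -> 'M[R]_(n, p)) (a : 'M[R]_(m, n)) (b : 'M[R]_(n, p)) :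
  f @ F --> a -> g @ F --> b -> (fun t => f t *m g t) @ F --> a *m b.
Proof.
move=> fa gb; apply: cvg_mx => i j; rewrite mxE.
rewrite (_ : (fun t => _) = (fun t => \sum_k f t i k * g t k j)); last first.
  by apply/funext => t; rewrite mxE.
by apply: cvg_sumr => k; apply: cvgM; exact: cvg_coord.
Qed.

Lemma cvg_trmx (R : realType) (T : Type) (F : set_system T) {FF : Filter F} (m n : nat)
    (f : T -> 'M[R]_(m, n)) (a : 'M[R]_(m, n)) : f @ F --> a -> (fun t => (f t)^T) @ F --> a^T.
Proof.
move=> fa; apply: cvg_mx => i j; rewrite mxE.
rewrite (_ : (fun t => _) = (fun t => f t j i)); first exact: cvg_coord.
by apply/funext => t; rewrite mxE.
Qed.

Lemma cvg_dot (R : realType) (T : Type) (F : set_system T) {FF : Filter F}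
    (f g : T -> 'rV[R]_3) (a b : 'rV[R]_3) :
  f @ F --> a -> g @ F --> b -> (fun t => dot (f t) (g t)) @ F --> dot a b.
Proof. by move=> fa gb; apply: cvg_coord; apply: cvg_mulmx => //; exact: cvg_trmx. Qed.

Section derivatives_of_matrices.
Context {R : realType} {V : normedModType R}.

Lemma is_derive_mx (m n : nat) (f : V -> 'M[R]_(m, n)) t v (df : 'M[R]_(m, n)) :
  (forall i j, is_derive t v (fun s => f s i j) (df i j)) -> is_derive t v f df.
Proof.
move=> h; have d : derivable f t v by apply/derivable_mxP => i j; have [] := h i j.
apply: DeriveDef => //; rewrite derive_mx//; apply/matrixP => i j; rewrite mxE.
by have [_] := h i j.
Qed.

Lemma is_derive_coord (m n : nat) (f : V -> 'M[R]_(m, n)) t v df i j :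
  is_derive t v f df -> is_derive t v (fun s => f s i j) (df i j).
Proof.
case=> d E; apply: DeriveDef; first exact: (derivable_mxP _ _ _).1.
by rewrite -E derive_mx// mxE.
Qed.

Lemma is_derive_mulmx (m n p : nat) (f : V -> 'M[R]_(m, n)) (g : V -> 'M[R]_(n, p)) t v df dg :
  is_derive t v f df -> is_derive t v g dg ->
  is_derive t v (fun s => f s *m g s) (df *m g t + f t *m dg).
Proof.
move=> hf hg; apply: is_derive_mx => i j.
rewrite (_ : (fun s => _) = (\sum_k (fun s => f s i k * g s k j))); last first.
  by apply/funext => s; rewrite mxE fct_sumE.
have := is_derive_sum (fun k =>
  is_deriveM (is_derive_coord i k hf) (is_derive_coord k j hg)).
move=> /is_derive_eq; apply.
rewrite !mxE -big_split/=; apply: eq_bigr => k _; rewrite addrC; congr (_ + _).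
by rewrite mulrC.
Qed.

Lemma is_derive_trmx (m n : nat) (f : V -> 'M[R]_(m, n)) t v df :
  is_derive t v f df -> is_derive t v (fun s => (f s)^T) df^T.
Proof.
move=> hf; apply: is_derive_mx => i j; rewrite mxE.
rewrite (_ : (fun s => _) = (fun s => f s j i)); first exact: is_derive_coord.
by apply/funext => s; rewrite mxE.
Qed.

Lemma is_derive_dot (f g : V -> 'rV[R]_3) t v df dg :
  is_derive t v f df -> is_derive t v g dg ->
  is_derive t v (fun s => dot (f s) (g s)) (dot df (g t) + dot (f t) dg).
Proof.
move=> hf hg.
have := is_derive_coord 0 0 (is_derive_mulmx hf (is_derive_trmx hg)).
by rewrite mxE.
Qed.

End derivatives_of_matrices.

Lemma is_diff_real (R : realType) (k : R -> R) (x dk : R) :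
  is_derive x (1 : R) k dk -> is_diff x k ( *:%R^~ dk : R -> R).
Proof.
move=> [dk1 dkE]; apply: DiffDef; first exact/derivable1_diffP.
by rewrite deriv1E// derive1E dkE.
Qed.

Section gradients.
Variable R : realType.
Local Notation V := 'rV[R]_3.

Definition dotl (G v : V) : R := dot v G.

Lemma dotl_linear (G : V) : linear (dotl G).
Proof. by move=> a u v; rewrite /dotl dotDl dotZl. Qed.
HB.instance Definition _ (G : V) := GRing.isLinear.Build R V R _ (dotl G) (dotl_linear G).

Lemma dotl_continuous (G : V) : continuous (dotl G).
Proof. by move=> x; exact: (@cvg_dot R V (nbhs x) _ id (cst G) x G cvg_id (cvg_cst _)). Qed.

(** Frechet differentiability, and not just existence of the partial
    derivatives, is what the chain rule along a surface needs. *)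
Definition has_grad (f : V -> R) (x G : V) : Prop := is_diff x f (dotl G).

(** The increment from x to x + h is split along the three coordinate axes and
    each part is evaluated by the mean value theorem. *)
Lemma has_grad_partials (f : V -> R) (U : set V) (x : V) :
  open U -> U x -> (forall y, U y -> forall i, derivable f y (delta_mx 0 i)) ->
  (forall i, {for x, continuous (partial i f)}) ->
  has_grad f x (\row_i partial i f x).
Proof.
move=> oU Ux df cf; set G := \row_i _.
suff H : (f \o shift x : V -> R^o) = (cst (f x) + dotl G : V -> R^o) +o_ (0 : V) id.
  have dE : 'd f x = dotl G :> (V -> R).
    by apply: diff_unique H; exact: dotl_continuous.
  by apply: DiffDef => //; apply/diff_locallyP; rewrite dE; split => //; exact: dotl_continuous.
apply/eqaddoP => e e0.
have e3 : 0 < e / 3 by rewrite divr_gt0.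
have near_x : \forall z \near x, U z /\ forall i, `|partial i f x - partial i f z| < e / 3.
  apply: filterI; first exact: open_nbhs_nbhs (conj oU Ux).
  exact: (filter_forall (nbhs_filter x) (fun i => (cvgrPdist_lt _ _).1 (cf i) _ e3)).
have [d dP] := nbhs_ex near_x.
have step (h y : V) (i : 'I_3) (t : R) : `|h| < d%:num ->
    (forall j, y 0 j = x 0 j \/ y 0 j = x 0 j + h 0 j) -> y 0 i = x 0 i -> `|t| <= `|h 0 i| ->
    ball x d%:num (y + t *: delta_mx 0 i).
  move=> hd yx yi th; rewrite -ball_normE /ball_/=.
  apply: le_lt_trans hd; apply: norm_le_coord => // j; rewrite !mxE eqxx/=.
  have [ij|ij] := eqVneq j i.
    subst j; rewrite yi mulr1 opprD addrA subrr sub0r normrN.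
    exact: le_trans th (coord_le_norm _ _).
  rewrite mulr0 addr0; have [->|->] := yx j; first by rewrite subrr normr0.
  by rewrite opprD addrA subrr sub0r normrN coord_le_norm.
have incr (h y : V) (i : 'I_3) : `|h| < d%:num ->
    (forall j, y 0 j = x 0 j \/ y 0 j = x 0 j + h 0 j) -> y 0 i = x 0 i ->
    `|f (y + h 0 i *: delta_mx 0 i) - f y - h 0 i * G 0 i| <= e / 3 * `|h|.
  move=> hd yx yi.
  have [t th E] := @MVT_along_line R V f (partial i f) y (delta_mx 0 i) (h 0 i)
    (fun t th => derivableP (df _ (dP _ (step h y i t hd yx yi th)).1 i)).
  rewrite E mxE -mulrBr normrM mulrC.
  apply: ler_pM => //; last exact: coord_le_norm.
  rewrite distrC; apply: ltW; exact: (dP _ (step h y i t hd yx yi th)).2.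
have : \forall h \near (0 : V), `|h| < d%:num.
  by apply/nbhs_normP; exists d%:num => //= h /=; rewrite sub0r normrN.
apply: filterS => h hd /=.
pose y1 := x + h 0 0 *: delta_mx 0 0.
pose y2 := y1 + h 0 1 *: delta_mx 0 1.
have hE : h + x = y2 + h 0 2%:R *: delta_mx 0 2%:R.
  by apply/rowP => -[[|[|[|//]]] lt_i3]; rewrite !mxE/= !(mulr1, mulr0, addr0) addrC;
    congr (_ + _); congr (h 0 _); apply/val_inj.
have E : (f \o shift x - (cst (f x) + dotl G)) h =
   (f (x + h 0 0 *: delta_mx 0 0) - f x - h 0 0 * G 0 0) +
   (f (y1 + h 0 1 *: delta_mx 0 1) - f y1 - h 0 1 * G 0 1) +
   (f (y2 + h 0 2%:R *: delta_mx 0 2%:R) - f y2 - h 0 2%:R * G 0 2%:R).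
  transitivity (f (h + x) - (f x + dotl G h)) => //.
  rewrite hE /dotl dot3 -/y1 -/y2; ring.
have -> : e * `|h| = e / 3 * `|h| + e / 3 * `|h| + e / 3 * `|h| by field.
change (`|(f \o shift x - (cst (f x) + dotl G)) h| <= e / 3 * `|h| + e / 3 * `|h| + e / 3 * `|h|).
rewrite E (le_trans (ler_normD _ _))// lerD//; first (rewrite (le_trans (ler_normD _ _))// lerD//).
- by apply: incr => // j; left.
- apply: incr => // [j|]; last by rewrite !mxE/= mulr0 addr0.
  rewrite /y1 !mxE/=; have [->|j0] := eqVneq j 0; first by right; rewrite mulr1.
  by left; rewrite mulr0 addr0.
- apply: incr => // [j|]; last by rewrite !mxE/= !mulr0 !addr0.
  rewrite /y2 /y1 !mxE/=; have [->|j0] := eqVneq j 0; first by right; rewrite mulr1 mulr0 addr0.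
  have [->|j1] := eqVneq j 1; first by right; rewrite mulr1 mulr0 addr0.
  by left; rewrite !mulr0 !addr0.
Qed.

Lemma has_grad_partial f x G i : has_grad f x G -> partial i f x = G 0 i.
Proof. by case=> df E; rewrite /partial deriveE// E /dotl dot_delta. Qed.

Lemma has_grad_eq f x G G' : has_grad f x G -> G = G' -> has_grad f x G'.
Proof. by move=> ? <-. Qed.

Lemma has_grad_cst c x : has_grad (cst c) x 0.
Proof.
rewrite /has_grad (_ : dotl 0 = 0); first exact: is_diff_cst.
by apply/funext => v; rewrite /dotl dot0r.
Qed.

Lemma has_gradD f g x F G : has_grad f x F -> has_grad g x G -> has_grad (fun y => f y + g y) x (F + G).
Proof.
move=> hf hg; rewrite /has_grad (_ : dotl _ = dotl F + dotl G); first exact: is_diffD.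
by apply/funext => v; rewrite /dotl dotDr.
Qed.

Lemma has_gradM f g x F G : has_grad f x F -> has_grad g x G ->
  has_grad (fun y => f y * g y) x (f x *: G + g x *: F).
Proof.
move=> hf hg; rewrite /has_grad (_ : dotl _ = f x *: dotl G + g x *: dotl F).
  exact: is_diffM.
by apply/funext => v; rewrite /dotl dotDr !dotZr.
Qed.

Lemma has_grad_comp (k : R -> R) (dk : R) f x F : has_grad f x F ->
  is_derive (f x) (1 : R) k dk -> has_grad (fun y => k (f y)) x (dk *: F).
Proof.
move=> hf /is_diff_real kd.
rewrite /has_grad (_ : dotl _ = ( *:%R^~ dk : R -> R) \o dotl F); first exact: is_diff_comp.
by apply/funext => v; rewrite /dotl/= dotZr mulrC.
Qed.

Lemma has_grad_coord x i : has_grad (fun y : V => y 0 i) x (delta_mx 0 i).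
Proof.
have E : (fun y : V => y 0 i) = dotl (delta_mx 0 i).
  by apply/funext => v; rewrite /dotl dotC dot_delta.
have d : differentiable (fun y : V => y 0 i) x by exact: differentiable_coord.
apply: DiffDef => //; apply/funext => v; rewrite -E -deriveE//.
by have [_] := is_derive_coord 0 i (is_derive_id x v).
Qed.

End gradients.

Lemma is_derive_comp_diff (R : realType) (W V : normedModType R) (f df : V -> R)
    (phi : W -> V) (u v : W) (dphi : V) :
  is_diff (phi u) f df -> is_derive u v phi dphi -> is_derive u v (f \o phi) (df dphi).
Proof.
move=> [fd dfE] [dp dpE].
have p1 : is_derive 0 (1 : R) (fun t : R => phi (u + t *: v)) dphi.
  have := @derive_along_line R W _ phi u v 0.
  by rewrite scale0r addr0 dpE; apply.
have p2 : differentiable (fun t : R => phi (u + t *: v)) (0 : R).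
  by apply/derivable1_diffP; case: p1.
have f2 : differentiable f (phi (u + (0 : R) *: v)) by rewrite scale0r addr0.
have E : (fun h : R => h^-1 *: ((f \o phi) (h *: v + u) - (f \o phi) u)) =
   (fun h : R => h^-1 *: ((f \o (fun t : R => phi (u + t *: v))) (h *: (1 : R) + 0) -
       (f \o (fun t : R => phi (u + t *: v))) 0)).
  by apply/funext => h /=; rewrite scale0r !addr0 [h%:A]mulr1 (addrC u).
have dc : differentiable (f \o (fun t : R => phi (u + t *: v))) (0 : R).
  exact: differentiable_comp.
have [a b] : is_derive 0 (1 : R) (f \o (fun t : R => phi (u + t *: v))) (df dphi).
  apply: DeriveDef; first exact/derivable1_diffP.
  rewrite deriveE// diff_comp//= scale0r addr0 dfE; congr df.
  by have [_] := p1; rewrite deriveE.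
by apply: DeriveDef; rewrite /derivable /derive E.
Qed.

Lemma is_derive_comp_grad (R : realType) (W : normedModType R) (f : 'rV[R]_3 -> R)
    (G : 'rV[R]_3) (phi : W -> 'rV[R]_3) (u v : W) (dphi : 'rV[R]_3) :
  has_grad f (phi u) G -> is_derive u v phi dphi ->
  is_derive u v (f \o phi) (dot dphi G).
Proof. exact: is_derive_comp_diff. Qed.

(** * Change of variables for measures *)

Section change_of_variables.
Context d1 d2 (X : measurableType d1) (Y : measurableType d2) (R : realType).
Variables (mu : {measure set X -> \bar R}) (nu : {measure set Y -> \bar R}).
Variables (phi : X -> Y) (K : set X) (D : set Y) (J : X -> R).
Hypotheses (mK : measurable K) (mD : measurable D).
Hypotheses (mphi : measurable_fun K phi) (phiK : forall x, K x -> D (phi x)).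
Hypotheses (mJ : measurable_fun K J) (J0 : forall x, K x -> 0 <= J x).
Hypothesis nuE : forall B, measurable B -> B `<=` D ->
  nu B = (\int[mu]_(x in K `&` phi @^-1` B) (J x)%:E)%E.

Import HBNNSimple.

(** The hypothesis nuE says that nu is the image under phi of the measure with
    density J; simple functions and monotone convergence carry this from sets to
    functions. *)
Lemma ge0_change_of_variables (f : Y -> \bar R) : measurable_fun D f ->
  (forall y, D y -> (0 <= f y)%E) ->
  (\int[nu]_(y in D) f y = \int[mu]_(x in K) (f (phi x) * (J x)%:E))%E.
Proof.
move=> mf f0; pose f_ := nnsfun_approx mD mf.
have mJE : measurable_fun K (EFin \o J) by exact/measurable_EFinP.
have mpre B : measurable B -> measurable (K `&` phi @^-1` B) by exact: mphi.
have mfphi n : measurable_fun K (fun x => f_ n (phi x)).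
  have -> : (fun x => f_ n (phi x)) = (f_ n : Y -> R) \o phi by [].
  apply: (measurable_comp measurableT) => //; exact: subsetT.
transitivity (limn (fun n => \int[nu]_(y in D) (f_ n y)%:E)%E).
  rewrite -monotone_convergence//.
  - apply: eq_integral => y /[!inE] yD; apply/esym/cvg_lim => //.
    exact: cvg_nnsfun_approx.
  - by move=> n; apply/measurable_EFinP; exact: measurable_funTS.
  - by move=> n y _; rewrite lee_fin.
  - by move=> y _ m n mn; rewrite lee_fin; exact/lefP/nd_nnsfun_approx.
rewrite [X in limn X](_ : _ =
    (fun n => \int[mu]_(x in K) ((f_ n (phi x))%:E * (J x)%:E))%E).
  rewrite -monotone_convergence//.
  - apply: eq_integral => x /[!inE] xK; apply/cvg_lim => //.
    have [J0x|J0x] := eqVneq (J x) 0.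
      rewrite J0x mule0; under eq_fun do rewrite mule0; exact: cvg_cst.
    by apply: cvgeZr => //; apply: cvg_nnsfun_approx => //; exact: phiK.
  - by move=> n; apply: emeasurable_funM => //; exact/measurable_EFinP.
  - by move=> n x xK; rewrite -EFinM lee_fin mulr_ge0// J0.
  - move=> x xK m n mn; rewrite -!EFinM lee_fin ler_wpM2r ?J0//.
    exact/lefP/nd_nnsfun_approx.
apply/funext => n.
have mpren r : measurable (f_ n @^-1` [set r]) by [].
transitivity (\sum_(k \in range (f_ n))
    (k%:E * \int[mu]_(x in K `&` phi @^-1` (D `&` f_ n @^-1` [set k])) (J x)%:E))%E.
  under eq_integral do rewrite fimfunE -fsumEFin//.
  rewrite ge0_integral_fsum//; last 2 first.
  - move=> y; apply/measurable_EFinP; apply: measurable_funM => //.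
  - by move=> y x _; rewrite nnfun_muleindic_ge0.
  apply: eq_fsbigr => r _; rewrite integralZl_indic_nnsfun// integral_indic//=.
  by rewrite setIC nuE//; exact: measurableI.
have mind k : measurable_fun K (fun x => \1_(f_ n @^-1` [set k]) (phi x) : R).
  have -> : (fun x => \1_(f_ n @^-1` [set k]) (phi x)) = (\1_(f_ n @^-1` [set k]) : Y -> R) \o phi by [].
  by apply: (measurable_comp measurableT) => //; exact: subsetT.
have indJ k (x : X) : (\1_(f_ n @^-1` [set k]) (phi x) * J x)%:E =
     ((EFin \o J) \_ (phi @^-1` (f_ n @^-1` [set k]))) x.
  rewrite patchE indicE; case: (boolP (phi x \in _)) => h.
    by rewrite mem_set ?mul1r//; move: h; rewrite inE.
  by rewrite memNset ?mul0r//= => h'; move/negP: h; apply; rewrite inE.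
have setE k : K `&` phi @^-1` (D `&` f_ n @^-1` [set k]) = K `&` phi @^-1` (f_ n @^-1` [set k]).
  by apply/seteqP; split => x [Kx]; [case=> _ h|move=> h]; split => //; split => //; exact: phiK.
have k_lt0 k : k < 0 -> f_ n @^-1` [set k] = set0 by exact: preimage_nnfun0.
transitivity (\sum_(k \in range (f_ n))
    \int[mu]_(x in K) (k * \1_(f_ n @^-1` [set k]) (phi x) * J x)%:E)%E.
  apply: eq_fsbigr => k _; rewrite setE integral_mkcondr.
  have [k0|k0] := leP 0 k; last first.
    rewrite k_lt0// preimage_set0.
    by rewrite !integral0_eq ?mule0// => x _; rewrite ?patch_set0// indicE in_set0 mulr0 mul0r.
  rewrite -(eq_integral _ _ (fun x _ => indJ k x)) -ge0_integralZl_EFin//.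
  - by apply: eq_integral => x _; rewrite -EFinM mulrA.
  - by move=> x Kx; rewrite lee_fin mulr_ge0 ?J0.
  - by apply/measurable_EFinP; exact: measurable_funM.
rewrite -ge0_integral_fsum//.
- apply: eq_integral => x _; rewrite -EFinM fimfunE fsumEFin//; congr EFin.
  by rewrite !fsbig_finite//= mulr_suml.
- move=> k; apply/measurable_EFinP; apply: measurable_funM => //; exact: measurable_funM.
- move=> k x Kx; rewrite lee_fin mulr_ge0 ?J0//.
  by have := nnfun_muleindic_ge0 (f_ n) k (phi x); rewrite lee_fin.
Qed.

(** The positive and the negative part of f are treated separately. *)
Lemma change_of_variables (f : Y -> R) : measurable_fun D f ->
  (\int[nu]_(y in D) (f y)%:E = \int[mu]_(x in K) (f (phi x) * J x)%:E)%E.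
Proof.
move=> mf; have mfE : measurable_fun D (EFin \o f) by exact/measurable_EFinP.
rewrite integralE [RHS]integralE; congr (_ - _)%E.
  rewrite ge0_change_of_variables//; last exact: measurable_funepos.
  apply: eq_integral => x /[!inE] xK; rewrite !funeposE -!EFin_max -!EFinM.
  by rewrite -[in RHS](mul0r (J x)) maxr_pMl ?J0.
rewrite ge0_change_of_variables//; last exact: measurable_funeneg.
apply: eq_integral => x /[!inE] xK; rewrite !funenegE -!EFinN -!EFin_max -!EFinM.
by rewrite -mulNr -[in RHS](mul0r (J x)) maxr_pMl ?J0.
Qed.

End change_of_variables.

(** * Integration over rectangles of the plane *)

Lemma within_continuous_preimage (S T : topologicalType) (K : set S) (f : S -> T) (O : set T) :
  {within K, continuous f} -> open O ->
  exists2 W : set S, open W & K `&` f @^-1` O = K `&` W.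
Proof.
move=> /continuousP cf oO; have [W oW E] := (open_subspaceP _ _).1 (cf O oO).
by exists W => //; rewrite setIC -E setIC.
Qed.

Section plane.
Variable R : realType.
Local Notation R2 := (measurableTypeR R * measurableTypeR R)%type.
Local Notation leb2 := (@lebesgue_measure R \x @lebesgue_measure R)%E.

(** An open subset of the plane is a countable union of rational squares, which
    are measurable for the product sigma-algebra. *)
Lemma open_measurable_plane (O : set (R * R)) : open O -> measurable (O : set R2).
Proof.
move=> oO.
pose B (q : rat * rat * rat) : set (R * R) := ball (ratr q.1.1 : R, ratr q.1.2 : R) (ratr q.2 : R).
pose F q : set R2 := if asbool (B q `<=` O) then B q else set0.
have -> : O = \bigcup_q F q.
  apply/seteqP; split => [u Ou|u [q _]]; last first.
    by rewrite /F; case: asboolP => // BO /BO.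
  have /nbhs_ballP[e /= e0 eO] : nbhs u O by exact: open_nbhs_nbhs.
  have [r] := rat_in_itvoo (divr_gt0 e0 (ltr0n R 2) : 0 < e / 2).
  rewrite in_itv/= => /andP[r0 re].
  have near_rat (x : R) : exists q : rat, `|x - ratr q| < ratr r.
    have [|q] := @rat_in_itvoo R (x - ratr r) (x + ratr r); first lra.
    by rewrite in_itv/= => /andP[q1 q2]; exists q; rewrite ltr_norml; apply/andP; split; lra.
  have [q1 q1P] := near_rat u.1; have [q2 q2P] := near_rat u.2.
  have uB : B (q1, q2, r) u.
    by split => /=; rewrite -ball_normE/= distrC.
  exists (q1, q2, r) => //; rewrite /F; case: asboolP => // BO; exfalso; apply: BO => v [].
  rewrite -!ball_normE/= => v1 v2; apply: eO; split; rewrite -ball_normE/=.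
    by rewrite (le_lt_trans (ler_distD (ratr q1) _ _))//; lra.
  by rewrite (le_lt_trans (ler_distD (ratr q2) _ _))//; lra.
apply: countable_bigcupT_measurable => [|q].
  exact: countableP.
rewrite /F; case: asboolP => // _.
have -> : B q = ball (ratr q.1.1 : R) (ratr q.2 : R) `*` ball (ratr q.1.2 : R) (ratr q.2 : R) by [].
by apply: measurableX; exact: measurable_ball.
Qed.

Lemma continuous_measurable_plane (K : set (R * R)) (f : R * R -> R) :
  measurable (K : set R2) -> {within K, continuous f} ->
  measurable_fun (K : set R2) (f : R2 -> R).
Proof.
move=> mK cf; apply: (measurability _ (measurable_realfun.RGenOpens.measurableE R)).
move=> _ [_ [a [b ->] <-]].
have [W oW ->] := within_continuous_preimage cf (interval_open (a := BRight a) (b := BLeft b) isT isT).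
by apply: measurableI => //; exact: open_measurable_plane.
Qed.

Definition rect (a b c d : R) : set (R * R) := `[a, b] `*` `[c, d].

Lemma rect_measurable a b c d : measurable (rect a b c d : set R2).
Proof. by apply: measurableX; exact: measurable_itv. Qed.

Lemma rect_compact a b c d : compact (rect a b c d).
Proof. by apply: compact_setX; exact: segment_compact. Qed.

Lemma rect_lty a b c d : (leb2 (rect a b c d) < +oo)%E.
Proof.
rewrite product_measure1E; [|exact: measurable_itv..].
suff : (lebesgue_measure `[a, b]%classic * lebesgue_measure `[c, d]%classic < +oo)%E by [].
by rewrite !lebesgue_measure_itv; do 2!case: ifP => _; rewrite ?mule0 ?mul0e// -!EFinD -EFinM ltry.
Qed.

Lemma rect_integrable a b c d (f : R * R -> R) :
  {within rect a b c d, continuous f} ->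
  leb2.-integrable (rect a b c d : set R2) (EFin \o (f : R2 -> R)).
Proof.
move=> cf; apply: measurable_bounded_integrable.
- exact: rect_measurable.
- exact: rect_lty.
- by apply: continuous_measurable_plane => //; exact: rect_measurable.
- have := compact_bounded (continuous_compact cf (@rect_compact a b c d)).
  move=> [M [Mr MP]]; exists M; split => // x Mx y Ky; exact: MP.
Qed.

Lemma integral_derivative_segment (F f : R -> R) (a b : R) : a < b ->
  (forall x, x \in `[a, b] -> is_derive x (1 : R) F (f x)) ->
  {within `[a, b], continuous f} ->
  (\int[@lebesgue_measure R]_(x in `[a, b]) (f x)%:E = (F b - F a)%:E)%E.
Proof.
move=> ab dF cf; rewrite (@continuous_FTC2 _ f F a b ab cf) ?EFinB//.
  have cF x : x \in `[a, b] -> {for x, continuous F}.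
    by move=> /dF[d _]; apply: differentiable_continuous; exact/derivable1_diffP.
  split.
  - by move=> x /subset_itv_oo_cc /dF[].
  - by apply: cvg_at_right_filter; apply: cF; rewrite in_itv/= lexx ltW.
  - by apply: cvg_at_left_filter; apply: cF; rewrite in_itv/= lexx ltW.
by move=> x /subset_itv_oo_cc /dF[_ <-]; rewrite derive1E.
Qed.

Lemma continuous_slice_l (f : R * R -> R) (x y : R) :
  {for (x, y), continuous f} -> {for x, continuous (fun t : R => f (t, y))}.
Proof.
move=> cf A /cf[[P Q] /= [Px Qy] PQ].
by apply: filterS Px => t Pt; apply: PQ; split => //; exact: nbhs_singleton Qy.
Qed.

Lemma continuous_slice_r (f : R * R -> R) (x y : R) :
  {for (x, y), continuous f} -> {for y, continuous (fun t : R => f (x, t))}.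
Proof.
move=> cf A /cf[[P Q] /= [Px Qy] PQ].
by apply: filterS Qy => t Qt; apply: PQ; split => //; exact: nbhs_singleton Px.
Qed.

(** Half of the divergence theorem on a rectangle, for a field vanishing on the
    boundary: Fubini's theorem and the fundamental theorem of calculus. *)
Lemma integral_dx_rect a b c d (w dw : R * R -> R) : a < b -> c < d ->
  (forall u, rect a b c d u -> is_derive u (axis R 0) w (dw u)) ->
  (forall u, rect a b c d u -> {for u, continuous dw}) ->
  (forall y, y \in `[c, d] -> w (a, y) = 0 /\ w (b, y) = 0) ->
  (\int[leb2]_(u in rect a b c d) (dw u)%:E = 0)%E.
Proof.
move=> ab cd dwE cdw w0.
have mK := @rect_measurable a b c d.
have cK : {within rect a b c d, continuous dw}.
  by apply: continuous_in_subspaceT => u; rewrite inE; exact: cdw.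
have /(integrable_mkcond _ mK) imf := rect_integrable cK.
rewrite integral_mkcond -(integral21_prod_meas1 imf) integral0_eq// => y _.
rewrite /fubini_G; have [ycd|ycd] := boolP (y \in `[c, d]); last first.
  rewrite integral0_eq// => x _; rewrite patchE memNset//= => -[_ /=].
  exact/negP.
rewrite (_ : (fun x => _) = ((fun x => (dw (x, y))%:E) \_ `[a, b])); last first.
  apply/funext => x; rewrite !patchE; case: (boolP (x \in `[a, b]%classic)) => xab.
    by rewrite mem_set//; split => //; rewrite inE in xab.
  by rewrite memNset// => -[h _]; move/negP: xab; apply; rewrite inE.
rewrite -integral_mkcond.
have [wa wb] := w0 _ ycd.
have := @integral_derivative_segment (fun x => w (x, y)) (fun x => dw (x, y)) a b ab.
rewrite wa wb subrr; apply.
- move=> x xab.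
  have E t : (0, y) + t *: axis R 0 = (t, y) by rewrite /axis/=; congr (_, _); rewrite /= ?add0r ?[_ *: 1]mulr1// [_ *: 0]mulr0 addr0.
  have [dx <-] := dwE (x, y) (conj xab ycd).
  rewrite -E in dx *; have := derive_along_line dx.
  by under eq_fun do rewrite E.
- apply: continuous_in_subspaceT => x; rewrite inE => xab.
  exact: continuous_slice_l (cdw (x, y) (conj xab ycd)).
Qed.

Lemma integral_dy_rect a b c d (w dw : R * R -> R) : a < b -> c < d ->
  (forall u, rect a b c d u -> is_derive u (axis R 1) w (dw u)) ->
  (forall u, rect a b c d u -> {for u, continuous dw}) ->
  (forall x, x \in `[a, b] -> w (x, c) = 0 /\ w (x, d) = 0) ->
  (\int[leb2]_(u in rect a b c d) (dw u)%:E = 0)%E.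
Proof.
move=> ab cd dwE cdw w0.
have mK := @rect_measurable a b c d.
have cK : {within rect a b c d, continuous dw}.
  by apply: continuous_in_subspaceT => u; rewrite inE; exact: cdw.
have /(integrable_mkcond _ mK) imf := rect_integrable cK.
rewrite integral_mkcond -(integral12_prod_meas1 imf) integral0_eq// => x _.
rewrite /fubini_F; have [xab|xab] := boolP (x \in `[a, b]); last first.
  rewrite integral0_eq// => y _; rewrite patchE memNset//= => -[/=].
  by move=> h; move/negP: xab.
rewrite (_ : (fun y => _) = ((fun y => (dw (x, y))%:E) \_ `[c, d])); last first.
  apply/funext => y; rewrite !patchE; case: (boolP (y \in `[c, d]%classic)) => ycd.
    by rewrite mem_set//; split => //; rewrite inE in ycd.
  by rewrite memNset// => -[_ h]; move/negP: ycd; apply; rewrite inE.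
rewrite -integral_mkcond.
have [wc wd] := w0 _ xab.
have := @integral_derivative_segment (fun y => w (x, y)) (fun y => dw (x, y)) c d cd.
rewrite wc wd subrr; apply.
- move=> y ycd.
  have E t : (x, 0) + t *: axis R 1 = (x, t) by rewrite /axis/=; congr (_, _); rewrite /= ?add0r ?[_ *: 1]mulr1// [_ *: 0]mulr0 addr0.
  have [dx <-] := dwE (x, y) (conj xab ycd).
  rewrite -E in dx *; have := derive_along_line dx.
  by under eq_fun do rewrite E.
- apply: continuous_in_subspaceT => y; rewrite inE => ycd.
  exact: continuous_slice_r (cdw (x, y) (conj xab ycd)).
Qed.

End plane.

(** * Functions and vector fields of class C^1 *)

Lemma cvg_continuous_for (S T : topologicalType) (f : S -> T) (x : S) :
  f @ nbhs x --> f x -> {for x, continuous f}.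
Proof. by []. Qed.

Section C1_functions.
Variable R : realType.
Local Notation V := 'rV[R]_3.
Implicit Types (O : set V) (f g : V -> R) (F G : V -> V).

(** The gradient is an explicit function, so that the Jacobians of the test fields
    come with formulas. *)
Definition C1_on O f G : Prop :=
  (forall x, O x -> has_grad f x (G x)) /\ (forall x, O x -> {for x, continuous G}).

Lemma has_grad_continuous f x (G : V) : has_grad f x G -> {for x, continuous f}.
Proof. by case=> df _; exact: differentiable_continuous. Qed.

Lemma C1_sub O O' f G : O' `<=` O -> C1_on O f G -> C1_on O' f G.
Proof. by move=> OO [fG cG]; split=> x /OO; [exact: fG|exact: cG]. Qed.

Lemma C1_eq O f G G' : C1_on O f G -> (forall x, G x = G' x) -> C1_on O f G'.
Proof. by move=> h /funext <-. Qed.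

Lemma C1_cst O c : C1_on O (cst c) (cst 0).
Proof. by split=> x _; [exact: has_grad_cst|exact: cst_continuous]. Qed.

Lemma C1_coord O i : C1_on O (fun x => x 0 i) (cst (delta_mx 0 i)).
Proof. by split=> x _; [exact: has_grad_coord|exact: cst_continuous]. Qed.

Lemma C1D O f g F G : C1_on O f F -> C1_on O g G -> C1_on O (fun x => f x + g x) (fun x => F x + G x).
Proof.
move=> [fF cF] [gG cG]; split=> x Ox; first exact: has_gradD (fF _ Ox) (gG _ Ox).
exact: cvgD (cF _ Ox) (cG _ Ox).
Qed.

Lemma C1M O f g F G : C1_on O f F -> C1_on O g G ->
  C1_on O (fun x => f x * g x) (fun x => f x *: G x + g x *: F x).
Proof.
move=> [fF cF] [gG cG]; split=> x Ox; first exact: has_gradM (fF _ Ox) (gG _ Ox).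
apply: cvg_continuous_for; apply: cvgD.
  exact: cvgZ (has_grad_continuous (fF _ Ox)) (cG _ Ox).
exact: cvgZ (has_grad_continuous (gG _ Ox)) (cF _ Ox).
Qed.

Lemma C1_comp O (k dk : R -> R) f F : C1_on O f F ->
  (forall x, O x -> is_derive (f x) (1 : R) k (dk (f x))) ->
  (forall x, O x -> {for f x, continuous dk}) ->
  C1_on O (fun x => k (f x)) (fun x => dk (f x) *: F x).
Proof.
move=> [fF cF] dkE cdk; split=> x Ox; first exact: has_grad_comp (fF _ Ox) (dkE _ Ox).
apply: cvgZ (cF _ Ox).
exact: (continuous_comp (has_grad_continuous (fF _ Ox)) (cdk _ Ox)).
Qed.

Lemma C1_sum O (I : Type) (s : seq I) (f : I -> V -> R) (F : I -> V -> V) :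
  (forall i, C1_on O (f i) (F i)) ->
  C1_on O (fun x => \sum_(i <- s) f i x) (fun x => \sum_(i <- s) F i x).
Proof.
move=> fF; elim: s => [|i s IH].
  under eq_fun do rewrite big_nil; under [X in C1_on _ _ X]eq_fun do rewrite big_nil.
  exact: C1_cst.
under eq_fun do rewrite big_cons; under [X in C1_on _ _ X]eq_fun do rewrite big_cons.
exact: C1D (fF i) IH.
Qed.

Lemma C1_inv O f F : C1_on O f F -> (forall x, O x -> f x != 0) ->
  C1_on O (fun x => (f x)^-1) (fun x => - (f x ^- 2) *: F x).
Proof.
move=> fF f0; apply: (@C1_comp _ (fun t => t^-1) (fun t => - (t ^- 2))) => // x Ox.
  have := @is_deriveV R id (f x) 1 1 (f0 _ Ox) (is_derive_id _ _).
  by rewrite [_ *: 1]mulr1.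
by apply: cvg_continuous_for; apply: cvgN; apply: cvgV; rewrite ?expf_neq0 ?f0//; exact: exprn_continuous.
Qed.

Definition sqdist (p x : V) : R := dot (x - p) (x - p).

Lemma C1_sqdist O p : C1_on O (sqdist p) (fun x => 2 *: (x - p)).
Proof.
have h i : C1_on O (fun x : V => x 0 i + cst (- p 0 i) x) (fun x => delta_mx 0 i + cst 0 x).
  by apply: C1D; [exact: C1_coord|exact: C1_cst].
have := C1_sum (index_enum 'I_3) (fun i => C1M (h i) (h i)).
have -> : (fun x : V => \sum_i (x 0 i + cst (- p 0 i) x) * (x 0 i + cst (- p 0 i) x)) = sqdist p.
  by apply/funext => x; rewrite /sqdist dotE; apply: eq_bigr => i _; rewrite !mxE.
move=> /C1_eq; apply => x /=.
rewrite [RHS]row_sum_delta; apply: eq_bigr => i _.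
by rewrite addr0 -scalerDl !mxE -mulr2n mulr_natl.
Qed.

(** A C^1 replacement for a smooth cutoff: bump (rho^2 - |x - p|^2) is positive
    exactly in the ball of radius rho about p. *)
Definition bump (t : R) : R := Num.max 0 t ^+ 2.

Lemma bump_ge0 t : 0 <= bump t. Proof. exact: sqr_ge0. Qed.

Lemma bump_gt0 t : 0 < t -> 0 < bump t.
Proof. by move=> t0; rewrite /bump exprn_gt0// lt_max t0 orbT. Qed.

Lemma bump_le0 t : t <= 0 -> bump t = 0.
Proof. by move=> t0; rewrite /bump max_l// expr0n. Qed.

(** At 0 both one-sided difference quotients tend to 0. *)
Lemma is_derive_bump t : is_derive t (1 : R) bump (2 * Num.max 0 t).
Proof.
have [t0|t0|<-] := ltgtP 0 t; last first.
- rewrite mulr0.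
  have L : (fun h : R => h^-1 *: (bump (h *: (1 : R) + 0) - bump 0)) @ 0^' --> (0 : R).
    apply/cvgrPdist_le => e e0.
    have H : \forall h \near (0 : R)^', `|h| <= e.
      by apply: nbhs_dnbhs; apply/nbhs_normP; exists e => //= h /=; rewrite sub0r normrN => /ltW.
    apply: filterS H => h he.
    rewrite sub0r normrN (bump_le0 (lexx 0)) subr0 addr0 [h *: 1]mulr1 [_ *: bump h](_ : _ = (h^-1 : R) * bump h)//.
    have [->|h0] := eqVneq h 0; first by rewrite invr0 mul0r normr0 ltW.
    have [h0'|h0'] := leP h 0; first by rewrite bump_le0// mulr0 normr0 ltW.
    by rewrite /bump (max_r (ltW h0')) expr2 mulrA mulVf// mul1r.
  by apply: DeriveDef; [apply/cvg_ex; exists 0|apply/cvg_lim].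
- rewrite mulr0.
  have N : \forall s \near t, cst 0 s = bump s.
    by near=> s; rewrite /= bump_le0//; apply: ltW; near: s; exact: lt_nbhsl.
  apply: (near_eq_is_derive N); exact: is_derive_cst.
- have N : \forall s \near t, (s ^+ 2) = bump s.
    by near=> s; rewrite /bump max_r//; apply: ltW; near: s; exact: lt_nbhsr.
  apply: (near_eq_is_derive N).
  have -> : (fun s : R => s ^+ 2) = (fun s : R => id s * id s) by [].
  have := is_deriveM (is_derive_id t (1 : R)) (is_derive_id t (1 : R)).
  by move=> /is_derive_eq; apply; rewrite [_ *: 1]mulr1; ring.
Unshelve. all: by end_near. Qed.

Definition cutoff (p : V) (rho : R) (x : V) : R := bump (rho ^+ 2 - sqdist p x).
Definition grad_cutoff (p : V) (rho : R) (x : V) : V :=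
  (2 * Num.max 0 (rho ^+ 2 - sqdist p x)) *: (- (2 *: (x - p))).

Lemma C1_cutoff O p rho : C1_on O (cutoff p rho) (grad_cutoff p rho).
Proof.
have h : C1_on O (fun x => rho ^+ 2 - sqdist p x) (fun x => - (2 *: (x - p))).
  have := C1D (C1_cst O (rho ^+ 2)) (C1M (C1_cst O (-1)) (C1_sqdist O p)).
  have -> : (fun x : V => cst (rho ^+ 2) x + cst (-1) x * sqdist p x) = (fun x => rho ^+ 2 - sqdist p x).
    by apply/funext => x /=; rewrite mulN1r.
  by move=> /C1_eq; apply => x /=; rewrite scaler0 addr0 add0r scaleN1r.
apply: (C1_comp (k := bump) (dk := fun t => 2 * Num.max 0 t) h) => x _; first exact: is_derive_bump.
apply: cvg_continuous_for; apply: cvgM; first exact: cvg_cst.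
by apply: (@continuous_max _ _ (cst 0) id); [exact: cvg_cst|exact: cvg_id].
Qed.

Lemma cutoff_ge0 p rho x : 0 <= cutoff p rho x. Proof. exact: bump_ge0. Qed.

Lemma cutoff_gt0 p rho x : sqdist p x < rho ^+ 2 -> 0 < cutoff p rho x.
Proof. by move=> h; rewrite bump_gt0// subr_gt0. Qed.

Lemma cutoff_out p rho x : rho ^+ 2 <= sqdist p x ->
  cutoff p rho x = 0 /\ grad_cutoff p rho x = 0.
Proof.
move=> h; split; first by rewrite /cutoff bump_le0// subr_le0.
by rewrite /grad_cutoff max_l ?subr_le0// mulr0 scale0r.
Qed.

(** A vector field X together with its Jacobian matrix DX, whose entry (a, k) is
    the a-th partial derivative of the k-th component. *)
Definition C1_field O (X : V -> V) (DX : V -> 'M[R]_3) : Prop :=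
  (forall x, O x -> forall k, has_grad (fun y => X y 0 k) x (\row_a DX x a k)) /\
  (forall x, O x -> {for x, continuous DX}).

Lemma C1_field_continuous O X DX x : C1_field O X DX -> O x -> {for x, continuous X}.
Proof.
move=> [hX _] Ox; apply: cvg_continuous_for; apply: cvg_mx => i k; rewrite ord1.
exact: has_grad_continuous (hX x Ox k).
Qed.

Lemma C1_field_sub O O' X DX : O' `<=` O -> C1_field O X DX -> C1_field O' X DX.
Proof. by move=> OO [fG cG]; split=> x /OO; [exact: fG|exact: cG]. Qed.

Lemma C1_field_scale O f F X DX : C1_on O f F -> C1_field O X DX ->
  C1_field O (fun x => f x *: X x) (fun x => f x *: DX x + (F x)^T *m X x).
Proof.
move=> fF hX; split=> x Ox.
  move=> k; have := has_gradM (fF.1 x Ox) (hX.1 x Ox k).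
  have -> : (fun y => f y * X y 0 k) = (fun y => (f y *: X y) 0 k).
    by apply/funext => y; rewrite mxE.
  move=> /has_grad_eq; apply; apply/rowP => a.
  by rewrite !mxE big_ord_recl big_ord0 addr0 !mxE [X in _ + X]mulrC.
apply: cvg_continuous_for; apply: cvgD.
  exact: cvgZ (has_grad_continuous (fF.1 _ Ox)) (hX.2 _ Ox).
apply: cvg_mulmx; last exact: C1_field_continuous hX Ox.
by apply: cvg_trmx; exact: fF.2.
Qed.

Lemma C1_field_cst O (b : V) : C1_field O (cst b) (cst 0).
Proof.
split=> x _; last exact: cst_continuous.
move=> k; have := @has_grad_cst R (b 0 k) x.
by move=> /has_grad_eq; apply; apply/rowP => a; rewrite !mxE.
Qed.

(** Vectors are rows, so that the Jacobian is the matrix itself, not its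
    transpose. *)
Lemma C1_field_linear O (M : 'M[R]_3) : C1_field O (fun x => x *m M) (cst M).
Proof.
split=> x _; last exact: cst_continuous.
move=> k; have h i : C1_on setT (fun x : V => x 0 i * cst (M i k) x) (fun x => x 0 i *: cst 0 x + cst (M i k) x *: cst (delta_mx 0 i) x).
  by apply: C1M; [exact: C1_coord|exact: C1_cst].
have := (C1_sum (index_enum 'I_3) h).1 x I.
rewrite (_ : (fun x => _) = (fun y : V => (y *m M) 0 k)); last by apply/funext => y; rewrite mxE.
move=> /has_grad_eq; apply; rewrite [RHS]row_sum_delta; apply: eq_bigr => i _.
by rewrite scaler0 add0r mxE.
Qed.

Lemma is_derive_field (W : normedModType R) O X DX (phi : W -> V) (u v : W) (dphi : V) :
  C1_field O X DX -> O (phi u) -> is_derive u v phi dphi ->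
  is_derive u v (X \o phi) (dphi *m DX (phi u)).
Proof.
move=> hX Ou dp; apply: is_derive_mx => i k; rewrite ord1 mxE.
have := is_derive_comp_grad (hX.1 _ Ou k) dp.
by move=> /is_derive_eq; apply; rewrite dotE; apply: eq_bigr => a _; rewrite mxE.
Qed.

End C1_functions.

(** * Charts of a surface *)

Lemma cvg_prodr (R : realType) (T : Type) (F : set_system T) {FF : Filter F} (I : Type) (s : seq I)
    (f : I -> T -> R) (l : I -> R) :
  (forall i, f i @ F --> l i) -> (fun t => \prod_(i <- s) f i t) @ F --> \prod_(i <- s) l i.
Proof.
move=> fl; elim: s => [|i s IH].
  by rewrite big_nil; under eq_fun do rewrite big_nil; exact: cvg_cst.
by rewrite big_cons; under eq_fun do rewrite big_cons; exact: cvgM.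
Qed.

Lemma cvg_det (R : realType) (T : Type) (F : set_system T) {FF : Filter F} (n : nat)
    (f : T -> 'M[R]_n) (a : 'M[R]_n) : f @ F --> a -> (fun t => \det (f t)) @ F --> \det a.
Proof.
move=> fa; rewrite /determinant; apply: cvg_sumr => s.
apply: cvgM; first exact: cvg_cst.
by apply: cvg_prodr => i; exact: cvg_coord.
Qed.

Lemma Ck_sub (R : realType) (V W : normedModType R) k (U U' : set V) (f : V -> W) :
  U' `<=` U -> Ck k U f -> Ck k U' f.
Proof.
move=> UU; elim: k f => [|k IH] f [cf hf]; split => //; [by move=> x /UU; exact: cf..|].
by move=> v; have [df hD] := hf v; split => [x /UU|]; [exact: df|exact: IH].
Qed.

Lemma local_param_sub (R : realType) (N : set 'rV[R]_3) U U' phi :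
  open U' -> U' `<=` U -> local_param N U phi -> local_param N U' phi.
Proof.
move=> oU' UU [oU C2 imm inj homeo]; split.
- exact: oU'.
- exact: Ck_sub C2.
- by move=> u /UU; exact: imm.
- by move=> u v /UU Uu /UU Uv; exact: inj.
- by move=> U0 oU0 U0U'; apply: homeo => // u /U0U' /UU.
Qed.

Lemma closed_measurable_borel3 (R : realType) (N : set 'rV[R]_3) :
  closed N -> measurable (N : set (borel3 R)).
Proof.
move=> cN; rewrite -[N]setCK; apply: measurableC; apply: sub_sigma_algebra.
exact: closed_openC.
Qed.

Lemma open_measurable_borel3 (R : realType) (W : set 'rV[R]_3) :
  open W -> measurable (W : set (borel3 R)).
Proof. by move=> oW; exact: sub_sigma_algebra. Qed.

Lemma within_continuous_measurable_borel3 (R : realType) (N : set 'rV[R]_3) (f : 'rV[R]_3 -> R) :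
  closed N -> {within N, continuous f} -> measurable_fun (N : set (borel3 R)) (f : borel3 R -> R).
Proof.
move=> cN cf; apply: (measurability _ (measurable_realfun.RGenOpens.measurableE R)).
move=> _ [_ [a [b ->] <-]].
have [W oW ->] := within_continuous_preimage cf (interval_open (a := BRight a) (b := BLeft b) isT isT).
by apply: measurableI; [exact: closed_measurable_borel3|exact: open_measurable_borel3].
Qed.

Section charts.
Variables (R : realType) (N : set 'rV[R]_3) (U : set (R * R)) (phi : R * R -> 'rV[R]_3).
Hypotheses (cN : closed N) (lp : local_param N U phi).
Local Notation R2 := (measurableTypeR R * measurableTypeR R)%type.
Local Notation leb2 := (@lebesgue_measure R \x @lebesgue_measure R)%E.

Lemma chart_sub u : U u -> N (phi u).
Proof.
move=> Uu; have [W _ E] := lp_homeo lp (lp_open lp) (@subset_refl _ U).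
have : (phi @` U) (phi u) by exists u.
by rewrite E => -[].
Qed.

Lemma chart_continuous u : U u -> {for u, continuous phi}.
Proof. by have [h _] := lp_C2 lp; exact: h. Qed.

Lemma chart_open_image_measurable U' : open U' -> U' `<=` U ->
  measurable (phi @` U' : set (borel3 R)).
Proof.
move=> oU' UU; have [W oW ->] := lp_homeo lp oU' UU.
by apply: measurableI; [exact: closed_measurable_borel3|exact: open_measurable_borel3].
Qed.

(** The inverse of phi is Borel because phi maps open sets to relatively open
    subsets of N. *)
Lemma chart_image_measurable (A : set R2) : measurable A -> A `<=` U ->
  measurable (phi @` A : set (borel3 R)).
Proof.
move=> mA AU; pose D : set (borel3 R) := phi @` U.
have mD : measurable D by apply: chart_open_image_measurable => //; exact: lp_open lp.
pose psi (y : borel3 R) : R2 := xget (0, 0) [set u | U u /\ phi u = y].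
have psiK u : U u -> psi (phi u) = u.
  move=> Uu; rewrite /psi; case: xgetP => [v _ [Uv vu]|/(_ u)/= h].
    exact: (lp_inj lp Uv Uu vu).
  by exfalso; apply: h.
have coord (pr : R2 -> measurableTypeR R) : (forall a b : R, open ((pr : R * R -> R) @^-1` `]a, b[)) ->
    measurable_fun D (pr \o psi).
  move=> opr; apply: (measurability _ (measurable_realfun.RGenOpens.measurableE R)).
  move=> _ [_ [a [b ->] <-]].
  have -> : D `&` (pr \o psi) @^-1` `]a, b[%classic = phi @` (U `&` (pr : R * R -> R) @^-1` `]a, b[).
    apply/seteqP; split => [_ [[u Uu <-]]|_ [u [Uu pu] <-]] /=.
      by rewrite psiK// => h; exists u.
    by split; [exists u|rewrite /= psiK].
  apply: chart_open_image_measurable; last by move=> u [].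
  by apply: openI; [exact: lp_open lp|exact: opr].
have ofst (a b : R) : open ((fst : R * R -> R) @^-1` `]a, b[).
  by apply: open_comp; [move=> x _; exact: cvg_fst|exact: interval_open].
have osnd (a b : R) : open ((snd : R * R -> R) @^-1` `]a, b[).
  by apply: open_comp; [move=> x _; exact: cvg_snd|exact: interval_open].
pose h (y : borel3 R) : R2 := (((fst \o psi : borel3 R -> measurableTypeR R) \_ D) y, ((snd \o psi : borel3 R -> measurableTypeR R) \_ D) y).
have mh : measurable_fun setT h.
  apply: measurable_fun_pair;
    [apply/(measurable_restrictT _ mD); exact: coord ofst|apply/(measurable_restrictT _ mD); exact: coord osnd].
have hE y : D y -> h y = psi y.
  by move=> Dy; rewrite /h !patchE mem_set//=; case: (psi y).
have -> : phi @` A = D `&` h @^-1` A.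
  apply/seteqP; split => [_ [u Au <-]|_ [[u Uu <-]]] /=.
    have Du : D (phi u) by exists u => //; exact: AU.
    by split => //; rewrite /= hE// psiK//; exact: AU.
  have Du : D (phi u) by exists u.
  by rewrite /= (hE _ Du) psiK// => Au; exists u.
by apply: measurableI => //; rewrite -[X in measurable X]setTI; exact: mh.
Qed.

Lemma chart_measurable (K : set R2) : measurable K -> K `<=` U ->
  measurable_fun K (phi : R2 -> borel3 R).
Proof.
move=> mK KU; apply: (@measurability _ _ _ (borel3 R) _ _ (@open 'rV[R]_3)) => //.
have cK : {within K, continuous phi}.
  by apply: continuous_in_subspaceT => u; rewrite inE => /KU; exact: chart_continuous.
move=> _ [B oB <-]; have [W oW ->] := within_continuous_preimage cK oB.
by apply: measurableI => //; exact: open_measurable_plane.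
Qed.

Definition area_density (g : 'rV[R]_3 -> 'M[R]_3) (phi : R * R -> 'rV[R]_3) (u : R * R) : R :=
  Num.sqrt (\det (induced_metric g phi u)).

Lemma chart_derivable u v : U u -> derivable phi u v.
Proof. by move=> Uu; have [_ h] := lp_C2 lp; have [d _] := h v; exact: d. Qed.

Lemma chart_D_continuous u v : U u -> {for u, continuous ('D_v phi)}.
Proof. by move=> Uu; have [_ h] := lp_C2 lp; have [_ [c _]] := h v; exact: c. Qed.

Lemma chart_D_derivable u v w : U u -> derivable ('D_v phi) u w.
Proof. by move=> Uu; have [_ h] := lp_C2 lp; have [_ [_ h']] := h v; have [d _] := h' w; exact: d. Qed.

Lemma chart_DD_continuous u v w : U u -> {for u, continuous ('D_w ('D_v phi))}.
Proof. by move=> Uu; have [_ h] := lp_C2 lp; have [_ [_ h']] := h v; have [_ [c _]] := h' w; exact: c. Qed.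

Lemma frame_continuous u : U u -> {for u, continuous (frame phi)}.
Proof.
move=> Uu; apply: cvg_continuous_for; apply: cvg_mx => i k; rewrite mxE.
under eq_fun do rewrite mxE.
by apply: cvg_coord; exact: chart_D_continuous.
Qed.

Lemma area_density_continuous (g : 'rV[R]_3 -> 'M[R]_3) u : U u -> {for phi u, continuous g} ->
  {for u, continuous (area_density g phi)}.
Proof.
move=> Uu cg; apply: cvg_continuous_for.
have cf : frame phi @ nbhs u --> frame phi u by exact: frame_continuous.
apply: continuous_comp; last exact: sqrt_continuous.
apply: cvg_continuous_for; apply: cvg_det; apply: cvg_mulmx; last exact: cvg_trmx.
apply: cvg_mulmx => //.
exact: (@continuous_comp _ _ _ phi g u (chart_continuous Uu) cg).
Qed.

(** The area measure of the image of a set is an integral over the set, which is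
    what the change of variables formula asks for. *)
Lemma chart_integral (g : 'rV[R]_3 -> 'M[R]_3) (mu : {measure set (borel3 R) -> \bar R})
    (K : set R2) (f : 'rV[R]_3 -> R) :
  is_area_measure g N mu -> measurable K -> K `<=` U ->
  (forall x, N x -> {for x, continuous g}) ->
  measurable_fun (phi @` K : set (borel3 R)) (f : borel3 R -> R) ->
  (\int[mu]_(x in phi @` K) (f x)%:E = \int[leb2]_(u in K) (f (phi u) * area_density g phi u)%:E)%E.
Proof.
move=> [_ hmu] mK KU cg mf.
apply: (@change_of_variables _ _ _ _ _ leb2 mu phi K (phi @` K) (area_density g phi)) => //.
- exact: chart_image_measurable.
- exact: chart_measurable.
- apply: continuous_measurable_plane => //; apply: continuous_in_subspaceT => u; rewrite inE => /KU Uu.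
  by apply: area_density_continuous => //; apply: cg; exact: chart_sub.
- by move=> u _; exact: sqrtr_ge0.
- move=> B mB BK; have mK' : measurable (K `&` (phi : R2 -> borel3 R) @^-1` B).
    exact: chart_measurable.
  have -> : B = phi @` (K `&` phi @^-1` B).
    apply/seteqP; split => [y By|_ [u [_ Bu] <-]//].
    by have [u Ku uy] := BK _ By; exists u => //; split => //; rewrite /= uy.
  rewrite (hmu U phi lp)//; last by move=> u [/KU].
  congr integral; apply/seteqP; split => [u [Ku Bu]|u [Ku [v [Kv Bv] vu]]]; split => //.
  + by exists u.
  + by rewrite /= -vu.
Qed.

Lemma chart_area_lty (g : 'rV[R]_3 -> 'M[R]_3) (mu : {measure set (borel3 R) -> \bar R}) a b c d :
  is_area_measure g N mu -> rect a b c d `<=` U ->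
  (forall x, N x -> {for x, continuous g}) ->
  (mu (phi @` rect a b c d) < +oo)%E.
Proof.
move=> [_ hmu] KU cg; rewrite (hmu U phi lp)//; last exact: rect_measurable.
have cJ : {within rect a b c d, continuous (area_density g phi)}.
  apply: continuous_in_subspaceT => u; rewrite inE => /KU Uu.
  by apply: area_density_continuous => //; apply: cg; exact: chart_sub.
by apply: integrable_lty; [exact: rect_measurable|exact: rect_integrable].
Qed.

End charts.

(** * Partitions of unity and areas of closed surfaces *)

Section patches.
Variable R : realType.
Local Notation V := 'rV[R]_3.
Local Notation R2 := (measurableTypeR R * measurableTypeR R)%type.
Local Notation leb2 := (@lebesgue_measure R \x @lebesgue_measure R)%E.

Record patch := Patch {
  pU : set (R * R) ; pphi : R * R -> V ;
  pa : R ; pb : R ; pc : R ; pd : R ; prho : R }.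

Definition prect (P : patch) := rect (pa P) (pb P) (pc P) (pd P).

(** The ball of radius rho about p meets N only in the image of the open
    rectangle, so a function on N supported in that ball pulls back to one that
    vanishes on the boundary of the rectangle. *)
Record good_patch (N : set V) (p : V) (P : patch) : Prop := GoodPatch {
  gp_param : local_param N (pU P) (pphi P) ;
  gp_ab : pa P < pb P ;
  gp_cd : pc P < pd P ;
  gp_sub : prect P `<=` pU P ;
  gp_inside : forall u, pU P u -> sqdist p (pphi P u) < prho P ^+ 2 ->
    pa P < u.1 < pb P /\ pc P < u.2 < pd P ;
  gp_cover : forall x, N x -> sqdist p x < prho P ^+ 2 -> (pphi P @` prect P) x
}.

(** Since phi is a homeomorphism onto its image, a small square of parameters has
    an image that is relatively open in N. *)
Lemma good_patch_exists (N : set V) p U phi :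
  local_param N U phi -> (phi @` U) p ->
  exists P, [/\ good_patch N p P, 0 < prho P, pU P = U & pphi P = phi].
Proof.
move=> lp [u0 Uu0 u0p].
have /nbhs_ballP[e /= e0 eU] : nbhs u0 U by apply: open_nbhs_nbhs; split => //; exact: lp_open lp.
pose h := e / 2; have h0 : 0 < h by rewrite divr_gt0.
pose U' : set (R * R) := `]u0.1 - h, u0.1 + h[ `*` `]u0.2 - h, u0.2 + h[.
have he : h < e by rewrite /h; lra.
have rU : rect (u0.1 - h) (u0.1 + h) (u0.2 - h) (u0.2 + h) `<=` U.
  move=> u [/=]; rewrite !in_itv/= => /andP[a1 a2] /andP[b1 b2].
  by apply: eU; split; rewrite -ball_normE/= ltr_norml; apply/andP; split; lra.
have U'r : U' `<=` rect (u0.1 - h) (u0.1 + h) (u0.2 - h) (u0.2 + h).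
  by move=> u [u1 u2]; split; apply: subset_itv_oo_cc.
have oU' : open U'.
  have -> : U' = (fst @^-1` `]u0.1 - h, u0.1 + h[) `&` (snd @^-1` `]u0.2 - h, u0.2 + h[) by [].
  apply: openI; apply: open_comp; try exact: interval_open.
    by move=> x _; exact: cvg_fst.
  by move=> x _; exact: cvg_snd.
have [W oW WE] := lp_homeo lp oU' (subset_trans U'r rU).
have : (phi @` U') p.
  by exists u0 => //; split; rewrite /= in_itv/=; apply/andP; split; lra.
rewrite WE => -[Np Wp].
have /nbhs_ballP[rho /= rho0 rhoW] : nbhs p W by exact: open_nbhs_nbhs.
have ballW x : sqdist p x < rho ^+ 2 -> W x.
  move=> xp; apply: rhoW; rewrite -ball_normE/= distrC.
  have : enorm (x - p) < rho.
    rewrite -(@ltr_pXn2r _ 2)// ?nnegrE ?enorm_ge0 ?ltW//.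
    by rewrite enorm_sq.
  apply: le_lt_trans; apply: norm_le_coord; first exact: enorm_ge0.
  by move=> i; exact: coord_le_enorm.
exists (Patch U phi (u0.1 - h) (u0.1 + h) (u0.2 - h) (u0.2 + h) rho); split => //.
split; [exact: lp|rewrite /=; lra|rewrite /=; lra|exact: rU|..].
- move=> u Uu /ballW Wu.
  have : (N `&` W) (phi u).
    split => //; have [W1 _ E1] := lp_homeo lp (lp_open lp) (@subset_refl _ U).
    by have : (phi @` U) (phi u) by [exists u]; rewrite E1 => -[].
  rewrite -WE => -[v U'v vu].
  have <- : v = u by apply: (lp_inj lp) => //; apply: rU; exact: U'r.
  by case: U'v => /=; rewrite !in_itv/=.
- move=> x Nx /ballW Wx; have : (N `&` W) x by [].
  by rewrite -WE => -[v U'v vx]; exists v => //; exact: U'r.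
Qed.

Lemma sqdist_continuous (p : V) : continuous (sqdist p).
Proof.
move=> x; have [h _] := @C1_sqdist R setT p.
exact: has_grad_continuous (h x I).
Qed.

(** The cutoffs of finitely many patches are divided by their sum, which is
    positive near N. The gradients add up to 0, so that cutting a vector field
    into pieces leaves the sum of the Jacobians unchanged. *)
Lemma partition_of_unity (N : set V) (Q : set (R * R) -> (R * R -> V) -> Prop) :
  compact N ->
  (forall p, N p -> exists U phi, [/\ local_param N U phi, (phi @` U) p & Q U phi]) ->
  exists (s : seq V) (P : V -> patch) (Om : set V) (chi : V -> V -> R) (dchi : V -> V -> V),
    [/\ N `<=` Om,
        forall p, p \in s -> good_patch N p (P p) /\ Q (pU (P p)) (pphi (P p)),
        forall p, C1_on Om (chi p) (dchi p) &
        [/\ forall p x, Om x -> 0 <= chi p x,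
            forall p x, prho (P p) ^+ 2 <= sqdist p x -> chi p x = 0 /\ dchi p x = 0,
            forall x, Om x -> \sum_(p <- s) chi p x = 1 &
            forall x, Om x -> \sum_(p <- s) dchi p x = 0]].
Proof.
move=> cN hN.
have /choice[P hP] : forall p, exists P, N p ->
    [/\ good_patch N p P, 0 < prho P & Q (pU P) (pphi P)].
  move=> p; have [Np|nNp] := pselect (N p); last by exists (Patch set0 (cst 0) 0 0 0 0 0).
  have [U [phi [lp Up QU]]] := hN p Np.
  have [P [gP r0 eU ep]] := good_patch_exists lp Up.
  by exists P => _; split => //; rewrite eU ep.
pose B p : set V := [set x | sqdist p x < prho (P p) ^+ 2].
have oB p : open (B p).
  rewrite (_ : B p = sqdist p @^-1` `]-oo, prho (P p) ^+ 2[); last first.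
    by apply/seteqP; split => x; rewrite /B/= in_itv.
  by apply: open_comp; [move=> x _; exact: sqdist_continuous|exact: interval_open].
have Bp p : N p -> B p p.
  move=> /hP[_ r0 _]; rewrite /B/= /sqdist subrr dot0l exprn_gt0//.
have NB : N `<=` cover N B by move=> p Np; exists p => //; exact: Bp.
move: (cN); rewrite compact_cover => /(_ _ N B (fun p _ => oB p) NB)[D DN ND].
pose D' : seq V := finmap.enum_fset D.
pose zeta p := cutoff p (prho (P p)).
pose dzeta p := grad_cutoff p (prho (P p)).
pose S x := \sum_(p <- D') zeta p x.
pose dS x := \sum_(p <- D') dzeta p x.
pose Om : set V := [set x | 0 < S x].
have S0 x : Om x -> S x != 0 by move=> h; rewrite gt_eqF.
have C1S : C1_on Om S dS by apply: C1_sum => p; exact: C1_cutoff.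
have C1Si := C1_inv C1S S0.
exists D', P, Om, (fun p x => zeta p x * (S x)^-1).
exists (fun p x => zeta p x *: (- (S x ^- 2) *: dS x) + (S x)^-1 *: dzeta p x).
split; [|by move=> p /DN; rewrite inE => /hP[]| |split].
- move=> x Nx; have [p pD Bpx] := ND _ Nx.
  rewrite /Om/= /S (big_rem p)//= ltr_pwDl//; first exact: cutoff_gt0.
  by apply: sumr_ge0 => q _; exact: cutoff_ge0.
- move=> p; exact: (C1M (C1_cutoff Om p (prho (P p))) C1Si).
- by move=> p x Ox; rewrite mulr_ge0 ?cutoff_ge0// invr_ge0 ltW.
- by move=> p x /cutoff_out[z0 dz0]; rewrite /zeta /dzeta z0 dz0 mul0r scale0r scaler0 addr0.
- by move=> x Ox; rewrite -mulr_suml mulfV ?S0.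
- move=> x Ox; rewrite big_split/= -scaler_suml -scaler_sumr -/(S x) -/(dS x).
  by rewrite scalerA mulrN -exprVn expr2 mulrA mulfV ?S0// mul1r scaleNr addNr.
Qed.

Lemma pullback_continuous (N : set V) U phi (f : V -> R) (k : V -> 'M[R]_3) (u : R * R) :
  local_param N U phi -> U u -> {for phi u, continuous f} -> {for phi u, continuous k} ->
  {for u, continuous (fun u : R * R => f (phi u) * area_density k phi u)}.
Proof.
move=> lp Uu cf ck; apply: cvg_continuous_for; apply: cvgM.
  exact: (@continuous_comp _ _ _ phi f u (chart_continuous lp Uu) cf).
exact: (area_density_continuous lp Uu ck).
Qed.

Section one_patch.
Variables (N : set V) (p : V) (P : patch).
Hypotheses (cN : compact N) (gP : good_patch N p P).

Let clN : closed N. Proof. by apply: compact_closed cN; exact: norm_hausdorff. Qed.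

Lemma patch_image_sub : pphi P @` prect P `<=` N.
Proof. by move=> _ [u /(gp_sub gP) Uu <-]; exact: (chart_sub (gp_param gP)). Qed.

Lemma patch_image_measurable : measurable (pphi P @` prect P : set (borel3 R)).
Proof.
apply: (chart_image_measurable clN (gp_param gP)); first exact: rect_measurable.
exact: gp_sub gP.
Qed.

(** A function supported in the ball of the patch does not see the rest of N. *)
Lemma patch_integral (g : V -> 'M[R]_3) (mu : {measure set (borel3 R) -> \bar R}) (f : V -> R) :
  is_area_measure g N mu -> (forall x, N x -> {for x, continuous g}) ->
  {within N, continuous f} ->
  (forall x, N x -> prho P ^+ 2 <= sqdist p x -> f x = 0) ->
  (\int[mu]_(x in N) (f x)%:E =
   \int[leb2]_(u in prect P) (f (pphi P u) * area_density g (pphi P) u)%:E)%E.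
Proof.
move=> hmu cg cf f0.
rewrite -(chart_integral clN (gp_param gP) hmu)//; first last.
- apply: measurable_funS (within_continuous_measurable_borel3 clN cf).
    exact: closed_measurable_borel3.
  exact: patch_image_sub.
- exact: gp_sub gP.
- exact: rect_measurable.
rewrite -[in RHS](setIidr patch_image_sub) integral_mkcondr.
apply: eq_integral => x /[!inE] Nx; rewrite patchE; case: ifPn => // /negP h.
rewrite f0// leNgt; apply/negP => xp; apply: h; rewrite inE.
exact: gp_cover gP _ Nx xp.
Qed.

End one_patch.

Lemma within_continuous_sub (N Om : set V) (T : topologicalType) (f : V -> T) :
  N `<=` Om -> (forall x, Om x -> {for x, continuous f}) -> {within N, continuous f}.
Proof. by move=> NO cf; apply: continuous_in_subspaceT => x; rewrite inE => /NO; exact: cf. Qed.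

(** Finitely many coordinate rectangles, each of finite area, cover N. *)
Lemma area_lty (N : set V) (g : V -> 'M[R]_3) (mu : {measure set (borel3 R) -> \bar R}) :
  closed_surface N -> is_area_measure g N mu -> (forall x, N x -> {for x, continuous g}) ->
  (mu N < +oo)%E.
Proof.
move=> [_ cN hN] hmu cg.
have clN : closed N by apply: compact_closed cN; exact: norm_hausdorff.
have [|s [P [Om [chi [dchi [NO gP _ [_ chi0 chi1 _]]]]]]] := @partition_of_unity N (fun _ _ => True) cN.
  by move=> p /hN[U [phi [lp Up]]]; exists U, phi.
pose E p : set (borel3 R) := pphi (P p) @` prect (P p).
have mE p : p \in s -> measurable (E p) by move=> /gP[gp _]; rewrite /E; exact: patch_image_measurable cN gp.
have Elty p : p \in s -> (mu (E p) < +oo)%E.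
  by move=> /gP[gp _]; exact: (chart_area_lty (gp_param gp) hmu (gp_sub gp) cg).
have sub : N `<=` \big[setU/set0]_(p <- s) E p.
  move=> x Nx; rewrite -bigcup_seq.
  have : \sum_(p <- s) chi p x != 0 by rewrite chi1 ?oner_eq0//; exact: NO.
  move=> /eqP; apply: contra_notP => h; apply: big1_seq => p /andP[_ ps].
  have [gp _] := gP p ps.
  have [xp|xp] := leP (prho (P p) ^+ 2) (sqdist p x); first by have [] := chi0 p x xp.
  by exfalso; apply: h; exists p => //; exact: gp_cover gp _ Nx xp.
have mU (t : seq V) : {subset t <= s} -> measurable (\big[setU/set0]_(p <- t) E p) /\
    (mu (\big[setU/set0]_(p <- t) E p) < +oo)%E.
  elim: t => [|q t IH] ts; first by rewrite big_nil measure0.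
  rewrite big_cons; have [|m1 l1] := IH; first by move=> z zt; apply: ts; rewrite inE zt orbT.
  have qs : q \in s by apply: ts; rewrite inE eqxx.
  split; first by apply: measurableU => //; exact: mE.
  by apply: le_lt_trans (measureU2 _ (mE _ qs) m1) _; apply: lte_add_pinfty => //; exact: Elty.
have [m1 l1] := mU s (fun _ => id).
by apply: le_lt_trans l1; apply: le_measure; rewrite ?inE//; exact: closed_measurable_borel3.
Qed.

Lemma within_continuous_integrable (N : set V) (mu : {measure set (borel3 R) -> \bar R}) (f : V -> R) :
  compact N -> (mu N < +oo)%E -> {within N, continuous f} ->
  mu.-integrable (N : set (borel3 R)) (EFin \o (f : borel3 R -> R)).
Proof.
move=> cN muN cf.
have clN : closed N by apply: compact_closed cN; exact: norm_hausdorff.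
apply: measurable_bounded_integrable.
- exact: closed_measurable_borel3.
- exact: muN.
- exact: within_continuous_measurable_borel3.
- have := compact_bounded (continuous_compact cf cN).
  by move=> [M [Mr MP]]; exists M; split => // x Mx y Ky; exact: MP.
Qed.

(** The densities are compared in each patch after multiplication by the functions
    of a partition of unity. *)
Lemma area_le (N : set V) (g h : V -> 'M[R]_3) (mu nu : {measure set (borel3 R) -> \bar R}) (c : R) :
  closed_surface N -> is_area_measure g N mu -> is_area_measure h N nu ->
  (forall x, N x -> {for x, continuous g}) -> (forall x, N x -> {for x, continuous h}) ->
  0 <= c ->
  (forall U phi u, local_param N U phi -> U u -> area_density g phi u <= c * area_density h phi u) ->
  (mu N <= c%:E * nu N)%E.
Proof.
move=> csN hmu hnu cg ch c0 gh.
have muN := area_lty csN hmu cg; have nuN := area_lty csN hnu ch.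
have [_ cN hN] := csN.
have clN : closed N by apply: compact_closed cN; exact: norm_hausdorff.
have mN := closed_measurable_borel3 clN.
have [|s [P [Om [chi [dchi [NO gP C1chi [chi_ge0 chi0 chi1 _]]]]]]] := @partition_of_unity N (fun _ _ => True) cN.
  by move=> p /hN[U [phi [lp Up]]]; exists U, phi.
have cchi p : {within N, continuous (chi p)}.
  apply: within_continuous_sub NO _ => x Ox.
  exact: has_grad_continuous ((C1chi p).1 x Ox).
have mchi p := within_continuous_measurable_borel3 clN (cchi p).
have dec (m : {measure set (borel3 R) -> \bar R}) :
    (m N = \sum_(p <- s) \int[m]_(x in N) (chi p x)%:E)%E.
  rewrite -ge0_integral_sum//; first last.
  - by move=> p x Nx; rewrite lee_fin chi_ge0//; exact: NO.
  - by move=> p; apply/measurable_EFinP; exact: mchi.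
  rewrite -[LHS]mul1e -integral_cst//; apply: eq_integral => x /[!inE] Nx.
  by rewrite sumEFin chi1//; exact: NO.
rewrite (dec mu) (dec nu) ge0_sume_distrr; last first.
  by move=> p _; apply: integral_ge0 => x Nx; rewrite lee_fin chi_ge0//; exact: NO.
rewrite big_seq [leRHS]big_seq; apply: lee_sum => p ps.
have [gp _] := gP p ps.
have chip0 x : N x -> prho (P p) ^+ 2 <= sqdist p x -> chi p x = 0.
  by move=> _ /chi0[].
rewrite (patch_integral cN gp hmu)// (patch_integral cN gp hnu)//.
have mint (k : V -> 'M[R]_3) : (forall x, N x -> {for x, continuous k}) ->
    measurable_fun (prect (P p) : set R2)
      (fun u => (chi p (pphi (P p) u) * area_density k (pphi (P p)) u)%:E).
  move=> ck; apply/measurable_EFinP; apply: continuous_measurable_plane; first exact: rect_measurable.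
  apply: continuous_in_subspaceT => u; rewrite inE => /(gp_sub gp) Uu.
  have Nu := chart_sub (gp_param gp) Uu.
  apply: (pullback_continuous (gp_param gp) Uu _ (ck _ Nu)).
  exact: has_grad_continuous ((C1chi p).1 _ (NO _ Nu)).
have ge0 (k : V -> 'M[R]_3) u : prect (P p) u ->
    (0 <= (chi p (pphi (P p) u) * area_density k (pphi (P p)) u)%:E)%E.
  move=> Ku; have Uu : pU (P p) u by exact: (gp_sub gp).
  have Nu := chart_sub (gp_param gp) Uu.
  by rewrite lee_fin mulr_ge0 ?sqrtr_ge0//; exact: chi_ge0 (NO _ Nu).
have mK : measurable (prect (P p) : set R2) by exact: rect_measurable.
rewrite -ge0_integralZl_EFin//; [|by move=> u; exact: ge0|exact: mint].
apply: ge0_le_integral => //.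
- by move=> u; exact: ge0.
- exact: mint.
- by apply: emeasurable_funM => //; exact: mint.
- move=> u Ku; have Uu : pU (P p) u by exact: (gp_sub gp).
  have Nu := chart_sub (gp_param gp) Uu.
  rewrite -EFinM lee_fin mulrCA ler_wpM2l//; first exact: chi_ge0 (NO _ Nu).
  exact: gh (gp_param gp) Uu.
Qed.

End patches.

(** * Stokes' theorem for locally exact integrands *)

Section exactness.
Variable R : realType.
Local Notation V := 'rV[R]_3.
Local Notation R2 := (measurableTypeR R * measurableTypeR R)%type.
Local Notation leb2 := (@lebesgue_measure R \x @lebesgue_measure R)%E.
Implicit Types (A : V -> 'M[R]_3) (B X : V -> V).

(** A function on a surface that is linear in the 1-jet of a vector field X. *)
Definition jet A B X (DX : V -> 'M[R]_3) (x : V) : R :=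
  \tr (A x *m DX x) + dot (B x) (X x).

(** In the chart phi the 2-form jet A B X times the area element is the
    divergence of the plane field with components c_i . X, for every X. *)
Definition exact_in_chart A B (U : set (R * R)) (phi : R * R -> V) : Prop :=
  exists c dc : 'I_2 -> R * R -> V,
    [/\ forall i u, U u -> is_derive u (axis R i) (c i) (dc i u),
        forall i u, U u -> {for u, continuous (c i)},
        forall i u, U u -> {for u, continuous (dc i)} &
        forall u, U u -> forall (D : 'M[R]_3) (X : V),
          area_density (@euclidean R) phi u * (\tr (A (phi u) *m D) + dot (B (phi u)) X) =
          \sum_i (dot (c i u) ('D_(axis R i) phi u *m D) + dot (dc i u) X)].

Lemma jet_continuous (N Om : set V) A B X DX :
  N `<=` Om -> {within N, continuous A} -> {within N, continuous B} ->
  C1_field Om X DX -> {within N, continuous (jet A B X DX)}.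
Proof.
move=> NO cA cB hX.
have cX : {within N, continuous X}.
  by apply: within_continuous_sub NO _ => x Ox; exact: C1_field_continuous hX Ox.
have cDX : {within N, continuous DX} by exact: within_continuous_sub NO hX.2.
move=> x; apply: cvg_continuous_for; apply: cvgD; last by apply: cvg_dot; [exact: cB|exact: cX].
apply: cvg_sumr => i; apply: cvg_coord; apply: cvg_mulmx; [exact: cA|exact: cDX].
Qed.

Lemma euclidean_continuous (N : set V) x : N x -> {for x, continuous (@euclidean R)}.
Proof. by move=> _; exact: cst_continuous. Qed.

(** The components of the plane field vanish on the boundary of the rectangle
    because X vanishes outside the ball of the patch. *)
Lemma patch_exact_integral (N Om : set V) (sigma : {measure set (borel3 R) -> \bar R})
    A B X DX p P :
  compact N -> is_area_measure (@euclidean R) N sigma ->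
  {within N, continuous A} -> {within N, continuous B} ->
  N `<=` Om -> C1_field Om X DX ->
  good_patch N p P -> exact_in_chart A B (pU P) (pphi P) ->
  (forall x, N x -> prho P ^+ 2 <= sqdist p x -> X x = 0 /\ DX x = 0) ->
  (\int[sigma]_(x in N) (jet A B X DX x)%:E = 0)%E.
Proof.
move=> cN hs cA cB NO hX gP [c [dc [dcE cc cdc eqs]]] X0.
have lp := gp_param gP; set phi := pphi P in lp eqs *.
rewrite (patch_integral cN gP hs (@euclidean_continuous N)); last 2 first.
- exact: jet_continuous NO cA cB hX.
- by move=> x Nx /(X0 _ Nx)[x0 dx0]; rewrite /jet x0 dx0 mulmx0 mxtrace0 dot0r addr0.
have rU u : prect P u -> pU P u by exact: (gp_sub gP).
have rO u : prect P u -> Om (phi u) by move=> /rU Uu; apply: NO; exact: (chart_sub lp).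
pose w i u := dot (c i u) (X (phi u)).
pose dw i u := dot (dc i u) (X (phi u)) + dot (c i u) ('D_(axis R i) phi u *m DX (phi u)).
have dwE i u : prect P u -> is_derive u (axis R i) (w i) (dw i u).
  move=> Ku; apply: is_derive_dot; first exact: dcE (rU _ Ku).
  apply: (is_derive_field hX (rO _ Ku)); apply: derivableP.
  by apply: (chart_derivable lp); exact: rU.
have cdw i u : prect P u -> {for u, continuous (dw i)}.
  move=> Ku; have Uu := rU _ Ku.
  have cphi := chart_continuous lp Uu.
  have cXp : {for u, continuous (X \o phi)}.
    exact: (@continuous_comp _ _ _ phi X u cphi (C1_field_continuous hX (rO _ Ku))).
  have cDXp : {for u, continuous (DX \o phi)}.
    exact: (@continuous_comp _ _ _ phi DX u cphi (hX.2 _ (rO _ Ku))).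
  apply: cvg_continuous_for; apply: cvgD; apply: cvg_dot.
  - exact: cdc.
  - exact: cXp.
  - exact: cc.
  - apply: cvg_mulmx; last exact: cDXp.
    by apply: (chart_D_continuous lp).
have w0 u i : prect P u -> ~ (pa P < u.1 < pb P /\ pc P < u.2 < pd P) -> w i u = 0.
  move=> Ku h; have Uu := rU _ Ku.
  have [xp|xp] := leP (prho P ^+ 2) (sqdist p (phi u)).
    by have [x0 _] := X0 _ (chart_sub lp Uu) xp; rewrite /w x0 dot0r.
  by exfalso; apply: h; exact: (gp_inside gP Uu xp).
have E u : prect P u -> jet A B X DX (phi u) * area_density (@euclidean R) phi u = dw 0 u + dw 1 u.
  move=> Ku; rewrite mulrC (eqs u (rU _ Ku)) !big_ord_recl big_ord0 addr0.
  have -> : lift ord0 ord0 = 1 :> 'I_2 by apply/val_inj.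
  by congr (_ + _); rewrite addrC.
transitivity (\int[leb2]_(u in prect P) ((dw 0 u)%:E + (dw 1 u)%:E))%E.
  by apply: eq_integral => u /[!inE] Ku; rewrite E.
have cK i : {within prect P, continuous (dw i)}.
  by apply: continuous_in_subspaceT => u; rewrite inE; exact: cdw.
rewrite (integralD_EFin (rect_measurable _ _ _ _) (rect_integrable (cK 0)) (rect_integrable (cK 1))).
have [ab cd] := (gp_ab gP, gp_cd gP).
transitivity (0 + 0 : \bar R)%E; last by rewrite adde0.
congr (_ + _)%E.
  apply: (integral_dx_rect ab cd (dwE 0) (cdw 0)) => y ycd.
  split; apply: w0; rewrite /prect/rect/= ?in_itv/= ?lexx ?(ltW ab)//=.
  - by move=> [/andP[]]; rewrite ltxx.
  - by move=> [/andP[_]]; rewrite ltxx.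
apply: (integral_dy_rect ab cd (dwE 1) (cdw 1)) => x xab.
split; apply: w0; rewrite /prect/rect/= ?in_itv/= ?lexx ?(ltW cd)//=.
- by move=> [_ /andP[]]; rewrite ltxx.
- by move=> [_ /andP[_]]; rewrite ltxx.
Qed.

(** Stokes' theorem on the closed surface N: local exactness suffices because
    jet is linear in X, and X is a finite sum of fields supported in patches. *)
Theorem exact_integral (N Om : set V) (sigma : {measure set (borel3 R) -> \bar R})
    A B X DX :
  closed_surface N -> is_area_measure (@euclidean R) N sigma ->
  {within N, continuous A} -> {within N, continuous B} ->
  N `<=` Om -> C1_field Om X DX ->
  (forall p, N p -> exists U phi,
     [/\ local_param N U phi, (phi @` U) p & exact_in_chart A B U phi]) ->
  \int[sigma]_(x in N) jet A B X DX x = 0.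
Proof.
move=> csN hs cA cB NO hX hN.
have [_ cN _] := csN.
have slty := area_lty csN hs (@euclidean_continuous N).
have clN : closed N by apply: compact_closed cN; exact: norm_hausdorff.
have [s [P [Om2 [chi [dchi [NOm2 gP C1chi [_ chi0 chi1 dchi1]]]]]]] := partition_of_unity cN hN.
pose Y p x := chi p x *: X x.
pose DY p x := chi p x *: DX x + (dchi p x)^T *m X x.
have hY p : C1_field (Om `&` Om2) (Y p) (DY p).
  apply: C1_field_scale; first by apply: C1_sub (C1chi p) => x [].
  by apply: C1_field_sub hX => x [].
have NOO : N `<=` Om `&` Om2 by move=> x Nx; split; [exact: NO|exact: NOm2].
have dec x : N x -> jet A B X DX x = \sum_(p <- s) jet A B (Y p) (DY p) x.
  move=> /NOm2 Nx; rewrite /jet big_split/=; congr (_ + _).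
    rewrite -raddf_sum -mulmx_sumr/=; congr (\tr (_ *m _)).
    rewrite big_split/= -scaler_suml chi1// scale1r -mulmx_suml -raddf_sum/=.
    by rewrite dchi1// trmx0 mul0mx addr0.
  under eq_bigr do rewrite dotZr.
  by rewrite -mulr_suml chi1// mul1r.
rewrite /Rintegral (_ : (\int[sigma]_(x in N) _ = 0)%E)//.
transitivity (\int[sigma]_(x in N) (\sum_(p <- s) (jet A B (Y p) (DY p) x)%:E))%E.
  by apply: eq_integral => x /[!inE] Nx; rewrite sumEFin dec.
rewrite integral_sum; first last.
- by move=> p; apply: within_continuous_integrable => //; exact: jet_continuous NOO cA cB (hY p).
- exact: closed_measurable_borel3.
rewrite big_seq big1// => p ps; have [gp ex] := gP p ps.
apply: (patch_exact_integral cN hs cA cB NOO (hY p) gp ex) => x Nx xp.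
have [c0 d0] := chi0 p x xp.
by rewrite /Y /DY c0 d0 !scale0r trmx0 mul0mx addr0.
Qed.

End exactness.

(** * A metric along a tangent plane *)

Lemma ord2P (i : 'I_2) : i = 0 \/ i = 1.
Proof.
by case: i => [[|[|//]]] h; [left|right]; apply/val_inj.
Qed.

Lemma ord3P (P : 'I_3 -> Prop) : P 0 -> P 1 -> P 2%:R -> forall i, P i.
Proof.
move=> p0 p1 p2 [[|[|[|//]]] h].
- by have -> : Ordinal h = 0 by apply/val_inj.
- by have -> : Ordinal h = 1 by apply/val_inj.
- by have -> : Ordinal h = 2%:R by apply/val_inj.
Qed.

Section small_matrices.
Variable R : realType.
Implicit Types (x y z : 'rV[R]_3).

Lemma sum2 (V : nmodType) (f : 'I_2 -> V) : \sum_i f i = f 0 + f 1.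
Proof. by rewrite !big_ord_recl big_ord0 addr0; congr (f _ + f _); apply/val_inj. Qed.

Lemma sum3 (V : nmodType) (f : 'I_3 -> V) : \sum_i f i = f 0 + f 1 + f 2%:R.
Proof. by rewrite !big_ord_recl big_ord0 addr0 addrA; congr (f _ + f _ + f _); apply/val_inj. Qed.

Lemma det2 (A : 'M[R]_2) : \det A = A 0 0 * A 1 1 - A 0 1 * A 1 0.
Proof.
rewrite (expand_det_row _ 0) sum2 /cofactor !det_mx11 !mxE /=.
rewrite expr0 expr1 mul1r mulN1r mulrN.
by congr (_ * A _ _ - _ * A _ _); apply/val_inj.
Qed.

Lemma gramE (F : 'M[R]_(2, 3)) (M : 'M[R]_3) i j :
  (F *m M *m F^T) i j = dot (row i F *m M) (row j F).
Proof.
rewrite /dot -row_mul mxE [RHS]mxE; apply: eq_bigr => a _; rewrite !mxE.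
by congr (_ * _); apply: eq_bigr => c _; rewrite !mxE.
Qed.

Lemma mxtrace_gram (F : 'M[R]_(2, 3)) (q : 'M[R]_2) (M : 'M[R]_3) :
  \tr (F^T *m q *m F *m M) = \sum_i \sum_j q i j * dot (row j F *m M) (row i F).
Proof.
rewrite -!mulmxA mxtrace_mulC -!mulmxA /mxtrace; apply: eq_bigr => i _.
by rewrite mxE; apply: eq_bigr => j _; rewrite -gramE !mulmxA.
Qed.

Lemma mxtrace_mul2 (M M' : 'M[R]_2) :
  \tr (M *m M') = M 0 0 * M' 0 0 + M 0 1 * M' 1 0 + (M 1 0 * M' 0 1 + M 1 1 * M' 1 1).
Proof. by rewrite /mxtrace sum2 !mxE !sum2. Qed.

Lemma trmx_dot (M : 'M[R]_3) x y : dot (x *m M) y = dot x (y *m M^T).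
Proof. by rewrite /dot trmx_mul trmxK mulmxA. Qed.

Lemma dot_sym (M : 'M[R]_3) x y : M^T = M -> dot (x *m M) y = dot (y *m M) x.
Proof. by move=> sM; rewrite trmx_dot sM dotC. Qed.

Definition adj2 (M : 'M[R]_2) : 'M[R]_2 :=
  \matrix_(i, j) (if i == j then M (rev_ord i) (rev_ord j) else - M i j).

Lemma adj2E (M : 'M[R]_2) :
  [/\ adj2 M 0 0 = M 1 1, adj2 M 0 1 = - M 0 1, adj2 M 1 0 = - M 1 0 & adj2 M 1 1 = M 0 0].
Proof. by split; rewrite mxE/=; congr (M _ _) || congr (- M _ _); apply/val_inj. Qed.

Lemma matrix2P (M M' : 'M[R]_2) : M 0 0 = M' 0 0 -> M 0 1 = M' 0 1 -> M 1 0 = M' 1 0 ->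
  M 1 1 = M' 1 1 -> M = M'.
Proof.
move=> h1 h2 h3 h4; apply/matrixP => i j; by case: (ord2P i) => ->; case: (ord2P j) => ->.
Qed.

Lemma mul_adj2 (M : 'M[R]_2) : M *m adj2 M = (\det M)%:M.
Proof.
have [e1 e2 e3 e4] := adj2E M.
by apply: matrix2P; rewrite !mxE sum2 ?e1 ?e2 ?e3 ?e4 ?det2/= ?mulr1n ?mulr0n; ring.
Qed.

Lemma invmx2 (M : 'M[R]_2) : \det M != 0 -> invmx M = (\det M)^-1 *: adj2 M.
Proof.
move=> d0; have uM : M \in unitmx by rewrite unitmxE unitfE.
rewrite -[RHS]mul1mx -(mulVmx uM) -mulmxA -scalemxAr mul_adj2.
by rewrite -mul_scalar_mx -scalar_mxM mulVf// mulmx1.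
Qed.

End small_matrices.

(** Linear algebra of a metric g on R^3 along a plane, spanned by the rows of F,
    with Euclidean unit normal n. *)
Section tangent_plane.
Variable R : realType.
Variables (g : 'M[R]_3) (F : 'M[R]_(2, 3)) (n : 'rV[R]_3).
Hypotheses (gsym : g^T = g) (gpos : forall v : 'rV[R]_3, v != 0 -> 0 < (v *m g *m v^T) 0 0).
Hypotheses (Ffree : row_free F) (nF : F *m n^T = 0) (n1 : enorm n = 1).

(** The square of the length of the covector n. *)
Definition conormal_sq (g : 'M[R]_3) (n : 'rV[R]_3) : R := (n *m invmx g *m n^T) 0 0.

(** The ratio of the area elements of g and of the Euclidean metric on a surface
    with Euclidean normal n. *)
Definition area_ratio (g : 'M[R]_3) (n : 'rV[R]_3) : R := Num.sqrt (\det g * conormal_sq g n).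

(** The inverse of the metric induced by g on the plane orthogonal to n, as a
    bilinear form on covectors of R^3. *)
Definition tangent_inverse (g : 'M[R]_3) (n : 'rV[R]_3) : 'M[R]_3 :=
  invmx g - (conormal_sq g n)^-1 *: ((invmx g *m n^T) *m (n *m invmx g)).

Local Notation k := (conormal_sq g n).
Local Notation h := (F *m g *m F^T).
Local Notation e2 := (\det (F *m F^T)).

Lemma metric_unit : g \in unitmx.
Proof.
rewrite -row_free_unit -kermx_eq0; apply/eqP/row_matrixP => i; rewrite row0.
apply/eqP/negPn/negP => v0; have := gpos v0.
by rewrite -row_mul mulmx_ker row0 mul0mx mxE ltxx.
Qed.

Lemma invmx_sym : (invmx g)^T = invmx g. Proof. by rewrite trmx_inv gsym. Qed.

Lemma n_neq0 : n != 0.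
Proof. by apply/eqP => n0; move: n1; rewrite n0 /enorm dot0l sqrtr0 => /esym/eqP; rewrite oner_eq0. Qed.

Lemma n_sq : n *m n^T = 1.
Proof.
apply/matrixP => i j; rewrite !ord1 [RHS]mxE eqxx.
by have := enorm_sq n; rewrite n1 expr1n => ->.
Qed.

Lemma conormal_gt0 : 0 < k.
Proof.
have v0 : n *m invmx g != 0.
  apply/eqP => h; move: n_neq0; rewrite -(mulmx1 n) -(mulVmx metric_unit) mulmxA h mul0mx.
  by rewrite eqxx.
have := gpos v0.
by rewrite mulmxKV ?metric_unit// trmx_mul invmx_sym mulmxA.
Qed.

Lemma gram_det_gt0 (M : 'M[R]_3) : M^T = M -> (forall v : 'rV[R]_3, v != 0 -> 0 < (v *m M *m v^T) 0 0) ->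
  0 < \det (F *m M *m F^T).
Proof.
move=> sM pM.
pose f i := row i F.
have hE i j : (F *m M *m F^T) i j = dot (f i *m M) (f j) by exact: gramE.
have indep (a b : R) : a *: f 0 + b *: f 1 = 0 -> a = 0 /\ b = 0.
  move=> ab; pose w : 'rV[R]_2 := \row_i (if i == 0 then a else b).
  have : w *m F = 0 *m F.
    rewrite mul0mx -[RHS]ab; apply/rowP => c; rewrite !mxE sum2 !mxE/=.
    by [].
  move/(row_free_inj Ffree) => w0; split.
    by have := congr1 (fun v : 'rV[R]_2 => v 0 0) w0; rewrite !mxE.
  by have := congr1 (fun v : 'rV[R]_2 => v 0 1) w0; rewrite !mxE.
rewrite det2 !hE.
(* The determinant a c - b^2 times a is the M-square of a f_1 - b f_0. *)
set a := dot (f 0 *m M) (f 0); set b := dot (f 0 *m M) (f 1); set c := dot (f 1 *m M) (f 1).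
have -> : dot (f 1 *m M) (f 0) = b by rewrite dot_sym.
have f00 : f 0 != 0.
  apply/eqP => f0; have [] := indep 1 0; first by rewrite f0 scaler0 scale0r addr0.
  by move=> /eqP; rewrite oner_eq0.
have a0 : 0 < a by exact: pM f00.
have v0 : (- b) *: f 0 + a *: f 1 != 0.
  by apply/eqP => /indep[_ a00]; move: a0; rewrite a00 ltxx.
have : 0 < dot (((- b) *: f 0 + a *: f 1) *m M) ((- b) *: f 0 + a *: f 1) by exact: pM v0.
rewrite mulmxDl -!scalemxAl dotDl !dotDr !dotZl !dotZr.
rewrite -/a -/b -/c (dot_sym (f 1) (f 0) sM) -/b.
have -> : - b * (- b * a) + - b * (a * b) + (a * (- b * b) + a * (a * c)) = a * (a * c - b * b) by ring.
by rewrite pmulr_rgt0.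
Qed.

Lemma euclid_gram_det_gt0 : 0 < e2.
Proof.
rewrite -[X in X *m F^T]mulmx1; apply: gram_det_gt0; first exact: trmx1.
move=> v v0; rewrite mulmx1 -/(dot v v); have : 0 <= dot v v by exact: dot_ge0.
rewrite le_eqVlt => /orP[/eqP dv|//]; exfalso; move/negP: v0; apply; apply/eqP/rowP => i.
have := coord_le_enorm v i; rewrite /enorm -dv sqrtr0 normr_le0 => /eqP ->.
by rewrite mxE.
Qed.

Lemma metric_gram_det_gt0 : 0 < \det h. Proof. exact: gram_det_gt0. Qed.

Local Notation M1 := (col_mx (F : 'M[R]_(2, 2 + 1)) (n : 'rV[R]_(2 + 1))).
Local Notation M2 := (col_mx (F : 'M[R]_(2, 2 + 1)) (n *m invmx g : 'rV[R]_(2 + 1))).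

Lemma nF' : n *m F^T = 0. Proof. by rewrite -[LHS]trmxK trmx_mul trmxK nF trmx0. Qed.

Lemma detM1 : \det M1 ^+ 2 = e2.
Proof.
have E : M1 *m M1^T = block_mx (F *m F^T) 0 0 1.
  by rewrite tr_col_mx mul_col_row nF nF' n_sq.
by rewrite expr2 -[in X in _ * X]det_tr -det_mulmx E det_ublock det1 mulr1.
Qed.

Lemma detM2 : \det M2 ^+ 2 * \det g = \det h * k.
Proof.
have E : M2 *m (g : 'M[R]_(2 + 1)) *m M2^T = block_mx h 0 0 (n *m invmx g *m n^T).
  rewrite tr_col_mx mul_col_mx mul_col_row.
  rewrite (mulmxKV metric_unit) nF' trmx_mul invmx_sym !mulmxA.
  by rewrite (mulmxK metric_unit) nF.
have := congr1 determinant E; rewrite !det_mulmx det_tr det_ublock det_mx11 => <-.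
by rewrite expr2 mulrAC.
Qed.

Lemma detM12 : \det M2 * \det M1 = e2 * k.
Proof.
have E : M2 *m M1^T = block_mx (F *m F^T) 0 (n *m invmx g *m F^T) (n *m invmx g *m n^T).
  by rewrite tr_col_mx mul_col_row nF.
by rewrite -[in X in _ * X]det_tr -det_mulmx E det_lblock det_mx11.
Qed.

(** The rows of F are completed to a square matrix by n, or by its image under the
    inverse metric; the determinants of the two completions are then eliminated. *)
Lemma gram_det_ratio : \det h = e2 * k * \det g.
Proof.
have e0 := euclid_gram_det_gt0; have k0 := conormal_gt0.
apply: (mulIf (lt0r_neq0 k0)); rewrite -detM2.
have -> : \det M2 ^+ 2 = e2 * k ^+ 2.
  apply: (mulIf (lt0r_neq0 e0)); rewrite -[in LHS]detM1 -exprMn detM12; ring.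
ring.
Qed.

Lemma metric_det_gt0 : 0 < \det g.
Proof.
have := metric_gram_det_gt0; rewrite gram_det_ratio pmulr_rgt0//.
by rewrite mulr_gt0 ?euclid_gram_det_gt0 ?conormal_gt0.
Qed.

Lemma area_ratioE : Num.sqrt (\det h) = Num.sqrt e2 * area_ratio g n.
Proof.
rewrite gram_det_ratio -mulrA sqrtrM ?ltW ?euclid_gram_det_gt0//.
by rewrite /area_ratio (mulrC k).
Qed.

(** Both sides agree after multiplication by the invertible matrix with rows F g
    and n. *)
Lemma tangent_inverseE : tangent_inverse g n = F^T *m invmx h *m F.
Proof.
have uh : h \in unitmx by rewrite unitmxE unitfE lt0r_neq0 ?metric_gram_det_gt0.
have ug := metric_unit; have k0 := conormal_gt0.
pose M := col_mx (F *m g : 'M[R]_(2, 2 + 1)) (n : 'rV[R]_(2 + 1)).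
have uM : M \in unitmx.
  have -> : M = M2 *m (g : 'M[R]_(2 + 1)) by rewrite mul_col_mx (mulmxKV ug).
  rewrite unitmxE unitfE det_mulmx mulf_neq0//; last first.
    by rewrite (lt0r_neq0 metric_det_gt0).
  rewrite -sqrf_eq0; apply/eqP => d0; have := detM2; rewrite d0 mul0r => /esym/eqP.
  by rewrite gt_eqF// mulr_gt0 ?metric_gram_det_gt0.
apply: (can_inj (mulKmx uM)).
transitivity (col_mx (F : 'M[R]_(2, 2 + 1)) (0 : 'M[R]_(1, 2 + 1))).
  rewrite /M mul_col_mx /tangent_inverse !mulmxBr -!scalemxAr !mulmxA.
  rewrite (mulmxK ug) nF !mul0mx scaler0 subr0; congr col_mx.
  have -> : n *m invmx g *m n^T = k%:M by rewrite [LHS]mx11_scalar.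
  by rewrite -mulmxA mul_scalar_mx scalerA mulVf ?lt0r_neq0// scale1r subrr.
by rewrite /M mul_col_mx !mulmxA mulmxV// mul1mx nF' !mul0mx.
Qed.

Lemma normal_decomposition (Z : 'rV[R]_3) : F *m Z^T = 0 -> Z = dot Z n *: n.
Proof.
move=> FZ; have u1 : M1 \in unitmx.
  by rewrite unitmxE unitfE -sqrf_eq0 detM1 lt0r_neq0 ?euclid_gram_det_gt0.
apply/trmx_inj; apply: (can_inj (mulKmx u1)).
rewrite !mul_col_mx FZ linearZ/= -!scalemxAr nF scaler0 n_sq; congr col_mx.
rewrite [LHS]mx11_scalar -scalemx1; congr (_ *: _); by rewrite dotC.
Qed.

End tangent_plane.

(** * Metrics of class C^1 *)

Section metrics.
Variable R : realType.
Local Notation V := 'rV[R]_3.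

(** A Riemannian metric of class C^1 on Om; Dg a is its a-th partial derivative. *)
Record C1_metric (Om : set V) (g : V -> 'M[R]_3) (Dg : 'I_3 -> V -> 'M[R]_3) : Prop := C1Metric {
  cm_sym : forall x, Om x -> (g x)^T = g x ;
  cm_pos : forall x, Om x -> forall v : V, v != 0 -> 0 < (v *m g x *m v^T) 0 0 ;
  cm_grad : forall x, Om x -> forall i j, has_grad (fun y => g y i j) x (\row_a Dg a x i j) ;
  cm_Dsym : forall x, Om x -> forall a, (Dg a x)^T = Dg a x ;
  cm_Dcont : forall x, Om x -> forall a, {for x, continuous (Dg a)}
}.

Variables (Om : set V) (g : V -> 'M[R]_3) (Dg : 'I_3 -> V -> 'M[R]_3).
Hypothesis hg : C1_metric Om g Dg.

Lemma metric_continuous x : Om x -> {for x, continuous g}.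
Proof.
move=> Ox; apply: cvg_continuous_for; apply: cvg_mx => i j.
exact: has_grad_continuous (cm_grad hg Ox i j).
Qed.

Definition Dmetric (x v : V) : 'M[R]_3 := \sum_a v 0 a *: Dg a x.

Lemma Dmetric_sym x v : Om x -> (Dmetric x v)^T = Dmetric x v.
Proof.
move=> Ox; rewrite /Dmetric raddf_sum/=; apply: eq_bigr => a _.
by rewrite linearZ/= (cm_Dsym hg).
Qed.

Lemma DmetricE x v w z : dot (w *m Dmetric x v) z =
  \sum_a \sum_b \sum_l v 0 a * w 0 b * z 0 l * Dg a x b l.
Proof.
rewrite /Dmetric mulmx_sumr /dot mulmx_suml summxE; apply: eq_bigr => a _.
rewrite -scalemxAr -scalemxAl mxE [RHS]exchange_big/= mxE mulr_sumr; apply: eq_bigr => l _.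
rewrite !mxE mulr_suml mulr_sumr; apply: eq_bigr => b _; ring.
Qed.

(** The Koszul formula: contracted with g, the Christoffel symbols involve only
    derivatives of the metric. *)
Lemma christoffelE x (v w z : V) : Om x ->
  dot ((\row_k \sum_a \sum_b christoffel g x k a b * v 0 a * w 0 b) *m g x) z =
  2^-1 * (dot (w *m Dmetric x v) z + dot (v *m Dmetric x w) z - dot (v *m Dmetric x z) w).
Proof.
move=> Ox; have gs := cm_sym hg Ox; have gp := cm_pos hg Ox.
have ug := metric_unit gp.
pose c l a b := Dg a x b l + Dg b x a l - Dg l x a b.
have gE i j a : partial a (fun y => g y i j) x = Dg a x i j.
  by rewrite (has_grad_partial _ (cm_grad hg Ox i j)) mxE.
pose C : V := \row_l \sum_a \sum_b c l a b * v 0 a * w 0 b.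
have -> : (\row_k \sum_a \sum_b christoffel g x k a b * v 0 a * w 0 b) = 2^-1 *: (C *m invmx (g x)).
  apply/rowP => k; rewrite !mxE mulr_sumr.
  transitivity (\sum_a \sum_b \sum_l 2^-1 * (c l a b * v 0 a * w 0 b * invmx (g x) l k)).
    apply: eq_bigr => a _; apply: eq_bigr => b _; rewrite /christoffel.
    rewrite mulr_sumr !mulr_suml; apply: eq_bigr => l _.
    rewrite !gE -/(c l a b) -[in invmx _ k l](invmx_sym gs) mxE; ring.
  under eq_bigr do rewrite exchange_big/=.
  rewrite exchange_big/=; apply: eq_bigr => l _.
  rewrite mxE mulr_suml mulr_sumr; apply: eq_bigr => a _.
  by rewrite mulr_suml mulr_sumr.
rewrite -scalemxAl (mulmxKV ug) dotZl; congr (_ * _).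
rewrite !DmetricE dotE.
have -> : \sum_a \sum_b \sum_l w 0 a * v 0 b * z 0 l * Dg a x b l =
   \sum_a \sum_b \sum_l v 0 a * w 0 b * z 0 l * Dg b x a l.
  rewrite exchange_big/=; apply: eq_bigr => a _; apply: eq_bigr => b _; apply: eq_bigr => l _; ring.
have -> : \sum_a \sum_b \sum_l z 0 a * v 0 b * w 0 l * Dg a x b l =
   \sum_a \sum_b \sum_l v 0 a * w 0 b * z 0 l * Dg l x a b.
  rewrite exchange_big/=; apply: eq_bigr => a _; rewrite exchange_big/=; apply: eq_bigr => b _; apply: eq_bigr => l _; ring.
rewrite -big_split/= -sumrB.
transitivity (\sum_l \sum_a \sum_b c l a b * v 0 a * w 0 b * z 0 l).
  apply: eq_bigr => l _; rewrite mxE mulr_suml; apply: eq_bigr => a _; by rewrite mulr_suml.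
rewrite exchange_big/=; apply: eq_bigr => a _.
rewrite exchange_big/= -big_split/= -sumrB; apply: eq_bigr => b _.
rewrite -big_split/= -sumrB; apply: eq_bigr => l _; rewrite /c; ring.
Qed.

End metrics.

Lemma is_derive_scale (R : realType) (W : normedModType R) (k : W -> R) (y : W -> 'rV[R]_3) (u v : W) dk dy :
  is_derive u v k dk -> is_derive u v y dy ->
  is_derive u v (fun t => k t *: y t) (dk *: y u + k u *: dy).
Proof.
move=> hk hy; apply: is_derive_mx => i j; rewrite ord1.
have := is_deriveM hk (is_derive_coord 0 j hy).
rewrite (_ : (fun s => (k s *: y s) 0 j) = k * (fun s => y s 0 j)); last first.
  by apply/funext => t; rewrite mxE.
by move=> /is_derive_eq; apply; rewrite !mxE addrC; congr (_ + _); exact: mulrC.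
Qed.

Lemma is_derive_quotient (R : realType) (W : normedModType R) (k s : W -> R) (u v : W) dk ds :
  s u != 0 -> is_derive u v k dk -> is_derive u v s ds ->
  is_derive u v (fun t => k t / s t) (dk / s u - k u * ds / s u ^+ 2).
Proof.
move=> s0 hk [dss <-].
have hi : is_derive u v (fun t => (s t)^-1) (- s u ^- 2 *: 'D_v s u).
  by apply: DeriveDef; [exact: derivableV|exact: deriveV].
have := is_deriveM hk hi.
move=> /is_derive_eq; apply; rewrite [in LHS]/GRing.scale/=; by field.
Qed.

Lemma is_derive_comp_real (R : realType) (W : normedModType R) (f : W -> R) (k : R -> R) (u v : W) df dk :
  is_derive u v f df -> is_derive (f u) (1 : R) k dk ->
  is_derive u v (fun t => k (f t)) (dk * df).
Proof.
move=> hf /is_diff_real hk.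
by have := is_derive_comp_diff hk hf; rewrite mulrC.
Qed.

(** * The first variation of area at a point *)

(** The Laplacian of a chart is normal to the surface. This is its tangential part
    in terms of the Gram matrix (a, b; b, c), the square root s of its determinant
    and the inner products Gijk of the second covariant derivatives with the
    tangent vectors; the derivatives of the Gram matrix are sums Gijk + Gikj. *)
Lemma tangential_cancellation (F : fieldType) (a b c s G000 G001 G010 G011 G110 G111 : F) :
  s != 0 -> 2 != 0 :> F -> s ^+ 2 = a * c - b * b ->
  let s0 := (2 * G000 * c + a * (2 * G011) - 2 * b * (G001 + G010)) / (2 * s) in
  let s1 := (2 * G010 * c + a * (2 * G111) - 2 * b * (G011 + G110)) / (2 * s) in
  let q011 := 2 * G011 / s - c * s0 / s ^+ 2 in
  let q001 := (G001 + G010) / s - b * s0 / s ^+ 2 in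
  let q100 := 2 * G010 / s - a * s1 / s ^+ 2 in
  let q101 := (G011 + G110) / s - b * s1 / s ^+ 2 in
  (q011 - q101) * a + (q100 - q001) * b + (c / s * G000 - 2 * (b / s) * G010 + a / s * G110) = 0 /\
  (q011 - q101) * b + (q100 - q001) * c + (c / s * G001 - 2 * (b / s) * G011 + a / s * G111) = 0.
Proof.
(* The denominators are cleared before s^2 is replaced by a c - b^2. *)
move=> s_neq0 two_neq0 s2 s0 s1 q011 q001 q100 q101.
have den : 2 * s ^+ 3 != 0 by rewrite mulf_neq0// expf_neq0.
split; apply: (mulfI den); rewrite mulr0.
  transitivity ((4 * G011 * s ^+ 2 - c * (2 * G000 * c + a * (2 * G011) - 2 * b * (G001 + G010))
    - (2 * (G011 + G110) * s ^+ 2 - b * (2 * G010 * c + a * (2 * G111) - 2 * b * (G011 + G110)))) * a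
    + (4 * G010 * s ^+ 2 - a * (2 * G010 * c + a * (2 * G111) - 2 * b * (G011 + G110))
    - (2 * (G001 + G010) * s ^+ 2 - b * (2 * G000 * c + a * (2 * G011) - 2 * b * (G001 + G010)))) * b
    + 2 * s ^+ 2 * (c * G000 - 2 * b * G010 + a * G110)).
    rewrite /q011 /q001 /q100 /q101 /s0 /s1; field; exact/andP.
  rewrite s2; ring.
transitivity ((4 * G011 * s ^+ 2 - c * (2 * G000 * c + a * (2 * G011) - 2 * b * (G001 + G010))
    - (2 * (G011 + G110) * s ^+ 2 - b * (2 * G010 * c + a * (2 * G111) - 2 * b * (G011 + G110)))) * b
    + (4 * G010 * s ^+ 2 - a * (2 * G010 * c + a * (2 * G111) - 2 * b * (G011 + G110))
    - (2 * (G001 + G010) * s ^+ 2 - b * (2 * G000 * c + a * (2 * G011) - 2 * b * (G001 + G010)))) * c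
    + 2 * s ^+ 2 * (c * G001 - 2 * b * G011 + a * G111)).
  rewrite /q011 /q001 /q100 /q101 /s0 /s1; field; exact/andP.
rewrite s2; ring.
Qed.

(** The plane fields whose divergence is the first variation: y_j is the tangent
    vector d_j phi lowered by g, h the Gram matrix and s the area density, so that
    pfield consists of s times the inverse of h applied to (y_0, y_1). *)
Section plane_fields.
Variable R : realType.
Local Notation V := 'rV[R]_3.
Variables (y : 'I_2 -> R * R -> V) (dy : 'I_2 -> 'I_2 -> R * R -> V).
Variables (h : 'I_2 -> 'I_2 -> R * R -> R) (dh : 'I_2 -> 'I_2 -> 'I_2 -> R * R -> R).
Variable s : R * R -> R.

Definition dsqrt_det (i : 'I_2) (u : R * R) : R :=
  (dh i 0 0 u * h 1 1 u + h 0 0 u * dh i 1 1 u - 2 * h 0 1 u * dh i 0 1 u) / (2 * s u).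
Definition dquot (i j k : 'I_2) (u : R * R) : R :=
  dh i j k u / s u - h j k u * dsqrt_det i u / s u ^+ 2.

Definition pfield (i : 'I_2) (u : R * R) : V :=
  if i == 0 then (h 1 1 u / s u) *: y 0 u - (h 0 1 u / s u) *: y 1 u
  else (h 0 0 u / s u) *: y 1 u - (h 0 1 u / s u) *: y 0 u.

Definition dpfield (i : 'I_2) (u : R * R) : V :=
  if i == 0 then
    (dquot 0 1 1 u *: y 0 u + (h 1 1 u / s u) *: dy 0 0 u) -
    (dquot 0 0 1 u *: y 1 u + (h 0 1 u / s u) *: dy 0 1 u)
  else
    (dquot 1 0 0 u *: y 1 u + (h 0 0 u / s u) *: dy 1 1 u) -
    (dquot 1 0 1 u *: y 0 u + (h 0 1 u / s u) *: dy 1 0 u).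

Variable u : R * R.
Hypothesis s0 : s u != 0.

Lemma is_derive_pfield i :
  (forall i j, is_derive u (axis R i) (y j) (dy i j u)) ->
  (forall i j k, is_derive u (axis R i) (h j k) (dh i j k u)) ->
  (forall i, is_derive u (axis R i) s (dsqrt_det i u)) ->
  is_derive u (axis R i) (pfield i) (dpfield i u).
Proof.
move=> yE hE sE; have qE k j l : is_derive u (axis R k) (fun v => h j l v / s v) (dquot k j l u).
  exact: is_derive_quotient.
have [->|i1] := ord2P i.
  rewrite /dpfield eqxx.
  exact: (is_deriveB (is_derive_scale (qE 0 1 1) (yE 0 0)) (is_derive_scale (qE 0 0 1) (yE 0 1))).
subst i.
exact: (is_deriveB (is_derive_scale (qE 1 0 0) (yE 1 1)) (is_derive_scale (qE 1 0 1) (yE 1 0))).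
Qed.

Section continuity.
Hypotheses (cy : forall j, y j @ nbhs u --> y j u) (cdy : forall i j, dy i j @ nbhs u --> dy i j u).
Hypotheses (ch : forall j k, h j k @ nbhs u --> h j k u).
Hypotheses (cdh : forall i j k, dh i j k @ nbhs u --> dh i j k u) (cs : s @ nbhs u --> s u).

Lemma cvg_dsqrt_det i : dsqrt_det i @ nbhs u --> dsqrt_det i u.
Proof.
apply: cvgM; last first.
  apply: cvgV; first by rewrite mulf_neq0// pnatr_eq0.
  by apply: cvgM; [exact: cvg_cst|exact: cs].
apply: cvgB; last first.
  by apply: cvgM; [apply: cvgM; [exact: cvg_cst|exact: ch]|exact: cdh].
by apply: cvgD; apply: cvgM; [exact: cdh|exact: ch|exact: ch|exact: cdh].
Qed.

Lemma cvg_quot j k : (fun v => h j k v / s v) @ nbhs u --> h j k u / s u.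
Proof. by apply: cvgM; [exact: ch|apply: cvgV; [exact: s0|exact: cs]]. Qed.

Lemma cvg_dquot i j k : dquot i j k @ nbhs u --> dquot i j k u.
Proof.
apply: cvgB; apply: cvgM.
- exact: cdh.
- by apply: cvgV; [exact: s0|exact: cs].
- by apply: cvgM; [exact: ch|exact: cvg_dsqrt_det].
- apply: cvgV; first by rewrite expf_neq0.
  exact: (@continuous_comp _ _ _ s (fun t : R => t ^+ 2) u cs (@exprn_continuous _ _ _)).
Qed.

Lemma pfield_continuous i : {for u, continuous (pfield i)}.
Proof.
apply: cvg_continuous_for; rewrite /pfield; case: ifP => _;
  (apply: cvgB; apply: cvgZ; [exact: cvg_quot|exact: cy|exact: cvg_quot|exact: cy]).
Qed.

Lemma dpfield_continuous i : {for u, continuous (dpfield i)}.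
Proof.
apply: cvg_continuous_for; rewrite /dpfield; case: ifP => _;
  (apply: cvgB; apply: cvgD; apply: cvgZ;
  [exact: cvg_dquot|exact: cy|exact: cvg_quot|exact: cdy
  |exact: cvg_dquot|exact: cy|exact: cvg_quot|exact: cdy]).
Qed.

End continuity.
End plane_fields.

(** First variation at a point, as an identity for 1-jets of vector fields: F is
    the frame, f2 the second derivatives of the chart and cov the covariant ones,
    Dm the derivative of the metric. *)
Section first_variation_at_point.
Variable R : realType.
Local Notation V := 'rV[R]_3.
Variables (g : 'M[R]_3) (Dm : V -> 'M[R]_3) (F : 'M[R]_(2, 3)) (f : 'I_2 -> V).
Variables (f2 cov : 'I_2 -> 'I_2 -> V) (n : V) (H : R).
Hypotheses (gsym : g^T = g) (gpos : forall v : V, v != 0 -> 0 < (v *m g *m v^T) 0 0).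
Hypothesis Dsym : forall v, (Dm v)^T = Dm v.
Hypothesis Ff : forall i, row i F = f i.
Hypotheses (Ffree : row_free F) (nF : F *m n^T = 0) (n1 : enorm n = 1).
Hypothesis f2sym : f2 0 1 = f2 1 0.
Hypothesis covE : forall i j z, dot (cov i j *m g) z = dot (f2 i j *m g) z +
  2^-1 * (dot (f j *m Dm (f i)) z + dot (f i *m Dm (f j)) z - dot (f i *m Dm z) (f j)).
Hypothesis HE : \tr (invmx (F *m g *m F^T) *m
  \matrix_(i < 2, j < 2) - (cov i j *m g *m ((Num.sqrt ((n *m invmx g *m n^T) 0 0))^-1 *: (n *m invmx g))^T) 0 0) = H.

Local Notation h j k := (dot (f j *m g) (f k)).
Local Notation dy i j := (f2 i j *m g + f j *m Dm (f i)).
Local Notation dh i j l := (dot (f2 i j *m g + f j *m Dm (f i)) (f l) + dot (f j *m g) (f2 i l)).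
Local Notation s := (Num.sqrt (\det (F *m g *m F^T))).
Local Notation e := (Num.sqrt (\det (F *m F^T))).
Local Notation k := (conormal_sq g n).
Local Notation G i j l := (dot (cov i j *m g) (f l)).

Lemma h10 : h 1 0 = h 0 1. Proof. exact: dot_sym. Qed.

Lemma gram_det : \det (F *m g *m F^T) = h 0 0 * h 1 1 - h 0 1 * h 0 1.
Proof. by rewrite det2 !gramE !Ff h10. Qed.

Lemma point_s_gt0 : 0 < s. Proof. by rewrite sqrtr_gt0 metric_gram_det_gt0. Qed.

Lemma point_s_sq : s ^+ 2 = h 0 0 * h 1 1 - h 0 1 * h 0 1.
Proof. by rewrite sqr_sqrtr ?gram_det// -gram_det ltW// metric_gram_det_gt0. Qed.

(** The covariant derivative is compatible with the metric. *)
Lemma dhG i j l : dh i j l = G i j l + G i l j.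
Proof.
rewrite !covE dotDl (dot_sym (f j) (f2 i l) gsym).
rewrite (dot_sym (f l) (f j) (Dsym (f i))) (dot_sym (f i) (f l) (Dsym (f j))).
rewrite (dot_sym (f i) (f j) (Dsym (f l))); by field.
Qed.

Lemma cov_sym z : dot (cov 1 0 *m g) z = dot (cov 0 1 *m g) z.
Proof.
rewrite !covE f2sym (dot_sym (f 1) (f 0) (Dsym z)); congr (_ + _ * (_ - _)).
by rewrite addrC.
Qed.

Local Notation a := (h 0 0).
Local Notation b := (h 0 1).
Local Notation c := (h 1 1).
Local Notation ds i := ((dh i 0 0 * c + a * dh i 1 1 - 2 * b * dh i 0 1) / (2 * s)).
Local Notation dq i j l := (dh i j l / s - h j l * ds i / s ^+ 2).

(** The divergence of pfield, applied to z, is Zrow.z plus half the trace of Dm z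
    over the tangent plane: Zrow collects the covariant derivatives and is s times
    the Laplacian of the chart, lowered by g. *)
Definition Zrow : V := (dq 0 1 1 - dq 1 0 1) *: (f 0 *m g) + (dq 1 0 0 - dq 0 0 1) *: (f 1 *m g) +
  ((c / s) *: (cov 0 0 *m g) - (2 * (b / s)) *: (cov 0 1 *m g) + (a / s) *: (cov 1 1 *m g)).

Lemma dotZE z : dot Zrow z = (dq 0 1 1 - dq 1 0 1) * dot (f 0 *m g) z + (dq 1 0 0 - dq 0 0 1) * dot (f 1 *m g) z +
  (c / s * dot (cov 0 0 *m g) z - 2 * (b / s) * dot (cov 0 1 *m g) z + a / s * dot (cov 1 1 *m g) z).
Proof. by rewrite /Zrow !dotDl dotNl !dotZl. Qed.

Lemma Z_tangent l : dot Zrow (f l) = 0.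
Proof.
have s_neq0 : s != 0 by rewrite gt_eqF// point_s_gt0.
have two_neq0 : 2 != 0 :> R by rewrite pnatr_eq0.
have [E0 E1] := tangential_cancellation (G 0 0 0) (G 0 0 1) (G 0 1 0) (G 0 1 1) (G 1 1 0) (G 1 1 1)
  s_neq0 two_neq0 point_s_sq.
have G10 m : G 1 0 m = G 0 1 m by exact: cov_sym.
have E (X Y : R) : X = 0 -> Y = X -> Y = 0 by move=> -> ->.
case: (ord2P l) => ->; rewrite dotZE !dhG !G10 ?h10.
  apply: (E _ _ E0); clear.
  move: (G 0 0 0) (G 0 0 1) (G 0 1 0) (G 0 1 1) (G 1 1 0) (G 1 1 1) (h 0 0) (h 0 1) (h 1 1) s.
  by move=> G000 G001 G010 G011 G110 G111 a b c r; ring.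
apply: (E _ _ E1); clear.
move: (G 0 0 0) (G 0 0 1) (G 0 1 0) (G 0 1 1) (G 1 1 0) (G 1 1 1) (h 0 0) (h 0 1) (h 1 1) s.
by move=> G000 G001 G010 G011 G110 G111 a b c r; ring.
Qed.

Lemma Z_normal : Zrow = dot Zrow n *: n.
Proof.
apply: (normal_decomposition Ffree nF n1); apply/matrixP => i j; rewrite ord1 [RHS]mxE.
have := Z_tangent i; rewrite -Ff dotC /dot => <-; rewrite !mxE.
by apply: eq_bigr => l _; rewrite !mxE.
Qed.

(** Contracting with the raised normal turns Zrow into the trace of the second
    fundamental form; area_ratioE accounts for the normalizing factors. *)
Lemma Z_mean_curvature : dot Zrow n = - (H * e * Num.sqrt (\det g)).
Proof.
have ug := metric_unit gpos; have k0 := conormal_gt0 gsym gpos n1.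
have s0 := point_s_gt0; have sk0 : 0 < Num.sqrt k by rewrite sqrtr_gt0.
have gsq := invmx_sym gsym.
have onk w : dot (w *m g) (n *m invmx g) = dot w n.
  by rewrite trmx_dot gsym (mulmxKV ug).
have fn i : dot (f i) n = 0.
  by rewrite -Ff /dot -row_mul nF row0 mxE.
have nk : dot n (n *m invmx g) = k.
  by rewrite /conormal_sq /dot trmx_mul gsq mulmxA.
have EZ : dot Zrow n * k = (c / s * dot (cov 0 0) n - 2 * (b / s) * dot (cov 0 1) n + a / s * dot (cov 1 1) n).
  rewrite -[in LHS]nk -dotZl -Z_normal dotZE !onk !fn; ring.
have c10 : dot (cov 1 0) n = dot (cov 0 1) n by rewrite -!onk cov_sym.
have d0 := metric_gram_det_gt0 gsym gpos Ffree.
have II i j : (\matrix_(i < 2, j < 2) - (cov i j *m g *m ((Num.sqrt ((n *m invmx g *m n^T) 0 0))^-1 *: (n *m invmx g))^T) 0 0) i j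
    = - ((Num.sqrt k)^-1 * dot (cov i j) n).
  rewrite mxE; transitivity (- dot (cov i j *m g) ((Num.sqrt k)^-1 *: (n *m invmx g))); first by [].
  by rewrite dotZr onk.
have EH : s ^+ 2 * H = - ((Num.sqrt k)^-1 * (c * dot (cov 0 0) n - 2 * b * dot (cov 0 1) n + a * dot (cov 1 1) n)).
  rewrite -HE invmx2 ?gt_eqF// -scalemxAl mxtraceZ mulrA sqr_sqrtr ?ltW// mulfV ?gt_eqF// mul1r.
  have [e1 e2 e3 e4] := adj2E (F *m g *m F^T).
  rewrite mxtrace_mul2 e1 e2 e3 e4 !II !gramE !Ff c10 h10; ring.
have sE : s = e * Num.sqrt k * Num.sqrt (\det g).
  rewrite (area_ratioE gsym gpos Ffree nF n1) /area_ratio sqrtrM; last exact: ltW (metric_det_gt0 gsym gpos Ffree nF n1).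
  ring.
have EH2 : s * H = - (Num.sqrt k * dot Zrow n).
  have k2 : k = Num.sqrt k ^+ 2 by rewrite sqr_sqrtr ?ltW.
  have EX : c * dot (cov 0 0) n - 2 * b * dot (cov 0 1) n + a * dot (cov 1 1) n =
      s * (dot Zrow n * k) by rewrite EZ; field; rewrite gt_eqF.
  apply: (mulfI (lt0r_neq0 s0)); rewrite mulrA -expr2 EH EX.
  transitivity (- ((Num.sqrt k)^-1 * (s * (dot Zrow n * Num.sqrt k ^+ 2)))); first by rewrite -k2.
  by move: (lt0r_neq0 sk0) => t0; field.
apply: (mulfI (lt0r_neq0 sk0)); rewrite -[LHS]opprK -EH2 [in LHS]sE; ring.
Qed.

(** The trace over the tangent plane, written with the inverse of the 2 x 2 Gram
    matrix in the chart. *)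
Lemma tangent_trace (D : 'M[R]_3) : e * (area_ratio g n * \tr (tangent_inverse g n *m D)) =
  c / s * dot (f 0 *m D) (f 0) - b / s * dot (f 1 *m D) (f 0) - b / s * dot (f 0 *m D) (f 1) +
  a / s * dot (f 1 *m D) (f 1).
Proof.
have d0 := metric_gram_det_gt0 gsym gpos Ffree.
have s0 := point_s_gt0.
rewrite mulrA -(area_ratioE gsym gpos Ffree nF n1) (tangent_inverseE gsym gpos Ffree nF n1).
rewrite invmx2 ?gt_eqF// -scalemxAr -!scalemxAl mxtraceZ mxtrace_gram !sum2 !Ff.
have [e1 e2 e3 e4] := adj2E (F *m g *m F^T).
rewrite e1 e2 e3 e4 !gramE !Ff h10.
have -> : (\det (F *m g *m F^T))^-1 = (s ^+ 2)^-1 by rewrite sqr_sqrtr ?ltW.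
by field; rewrite gt_eqF.
Qed.

Lemma point_divergence z :
  dot ((dq 0 1 1 *: (f 0 *m g) + (c / s) *: dy 0 0) - (dq 0 0 1 *: (f 1 *m g) + (b / s) *: dy 0 1)) z +
  dot ((dq 1 0 0 *: (f 1 *m g) + (a / s) *: dy 1 1) - (dq 1 0 1 *: (f 0 *m g) + (b / s) *: dy 1 0)) z =
  e * (2^-1 * area_ratio g n * \tr (tangent_inverse g n *m Dm z) - H * Num.sqrt (\det g) * dot n z).
Proof.
have Zz : dot Zrow z = - (H * e * Num.sqrt (\det g)) * dot n z.
  by rewrite Z_normal dotZl Z_mean_curvature.
have T := tangent_trace (Dm z).
transitivity (dot Zrow z + 2^-1 * (e * (area_ratio g n * \tr (tangent_inverse g n *m Dm z)))); last first.
  rewrite Zz; ring.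
have s0 : s != 0 by rewrite gt_eqF// point_s_gt0.
have key (A B C E : R) :
  dot ((A *: (f 0 *m g) + (c / s) *: dy 0 0) - (B *: (f 1 *m g) + (b / s) *: dy 0 1)) z +
  dot ((C *: (f 1 *m g) + (a / s) *: dy 1 1) - (E *: (f 0 *m g) + (b / s) *: dy 1 0)) z =
  (A - E) * dot (f 0 *m g) z + (C - B) * dot (f 1 *m g) z +
  (c / s * dot (cov 0 0 *m g) z - 2 * (b / s) * dot (cov 0 1 *m g) z + a / s * dot (cov 1 1 *m g) z) +
  2^-1 * (c / s * dot (f 0 *m Dm z) (f 0) - b / s * dot (f 1 *m Dm z) (f 0) -
          b / s * dot (f 0 *m Dm z) (f 1) + a / s * dot (f 1 *m Dm z) (f 1)).
  rewrite !covE !dotBl !dotDl !dotZl !dotDl f2sym (dot_sym (f 1) (f 0) (Dsym z)).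
  move: s s0 (h 0 0) (h 0 1) (h 1 1) => r r0 a' b' c'; by field.
rewrite T dotZE; exact: key.
Qed.

Lemma point_principal (D : 'M[R]_3) :
  e * \tr ((area_ratio g n *: (g *m tangent_inverse g n)) *m D) =
  dot ((c / s) *: (f 0 *m g) - (b / s) *: (f 1 *m g)) (f 0 *m D) +
  dot ((a / s) *: (f 1 *m g) - (b / s) *: (f 0 *m g)) (f 1 *m D).
Proof.
have -> : \tr ((area_ratio g n *: (g *m tangent_inverse g n)) *m D) =
    area_ratio g n * \tr (tangent_inverse g n *m (D *m g)).
  by rewrite -scalemxAl mxtraceZ -mulmxA mxtrace_mulC -mulmxA.
rewrite tangent_trace.
rewrite !dotBl !dotZl; have E i j : dot (f i *m g) (f j *m D) = dot (f j *m (D *m g)) (f i).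
  by rewrite trmx_dot gsym dotC mulmxA.
rewrite !E; ring.
Qed.

End first_variation_at_point.

(** * The first variation is locally exact *)

Lemma chart_mixed (R : realType) (N : set 'rV[R]_3) U phi u : local_param N U phi -> U u ->
  'D_(axis R 0) ('D_(axis R 1) phi) u = 'D_(axis R 1) ('D_(axis R 0) phi) u.
Proof.
move=> lp Uu.
pose f i := 'D_(axis R i) phi.
pose f2 i j := 'D_(axis R i) (f j).
have fE i v : U v -> is_derive v (axis R i) phi (f i v).
  by move=> Uv; apply: derivableP; exact: (chart_derivable lp).
have f2E i j v : U v -> is_derive v (axis R i) (f j) (f2 i j v).
  by move=> Uv; apply: derivableP; exact: (chart_D_derivable lp).
apply/rowP => k.
have d1 i v : U v -> is_derive v (axis R i) (fun w => phi w 0 k) (f i v 0 k).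
  by move=> Uv; exact: is_derive_coord (fE i v Uv).
have d2 i j v : U v -> is_derive v (axis R i) (fun w => f j w 0 k) (f2 i j v 0 k).
  by move=> Uv; exact: is_derive_coord (f2E i j v Uv).
have c2 i j : {for u, continuous (fun w => f2 i j w 0 k)}.
  by apply: cvg_continuous_for; apply: cvg_coord; exact: (chart_DD_continuous lp).
exact: (@mixed_derivatives_commute R _ (fun w => phi w 0 k) (fun w => f 1 w 0 k) (fun w => f 0 w 0 k)
  (fun w => f2 0 1 w 0 k) (fun w => f2 1 0 w 0 k) (axis R 1) (axis R 0) u U (lp_open lp) Uu
  (d1 1) (d1 0) (d2 0 1) (d2 1 0) (c2 0 1) (c2 1 0)).
Qed.

Section first_variation.
Variable R : realType.
Local Notation V := 'rV[R]_3.
Variables (Om : set V) (g : V -> 'M[R]_3) (Dg : 'I_3 -> V -> 'M[R]_3).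
Hypothesis hg : C1_metric Om g Dg.
Variables (N : set V) (nu : V -> V) (H : R).
Hypotheses (NO : N `<=` Om) (nu1 : forall p, N p -> enorm (nu p) = 1).

(** The coefficients, with respect to the Euclidean area, of the first variation
    of the g-area minus H times the enclosed g-volume, as a function of the
    1-jet of the variation field. *)
Definition variation_A (x : V) : 'M[R]_3 :=
  area_ratio (g x) (nu x) *: (g x *m tangent_inverse (g x) (nu x)).
Definition variation_B (x : V) : V :=
  \row_a (2^-1 * area_ratio (g x) (nu x) * \tr (tangent_inverse (g x) (nu x) *m Dg a x)
          - H * Num.sqrt (\det (g x)) * nu x 0 a).

Lemma variation_BE x z : dot (variation_B x) z =
  2^-1 * area_ratio (g x) (nu x) * \tr (tangent_inverse (g x) (nu x) *m Dmetric Dg x z)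
  - H * Num.sqrt (\det (g x)) * dot (nu x) z.
Proof.
rewrite dotE /Dmetric mulmx_sumr raddf_sum/= mulr_sumr dotE mulr_sumr -sumrB.
by apply: eq_bigr => a _; rewrite mxE -scalemxAr mxtraceZ; ring.
Qed.

Section one_chart.
Variables (U : set (R * R)) (phi : R * R -> V).
Hypothesis lp : local_param N U phi.
Hypothesis nuF : forall u, U u -> frame phi u *m (nu (phi u))^T = 0.
Hypothesis HE : forall u, U u -> mean_curvature g nu phi u = H.

Lemma inOm u : U u -> Om (phi u).
Proof. by move=> Uu; apply: NO; exact: (chart_sub lp). Qed.

Section derivatives.
Variables (f : 'I_2 -> R * R -> V) (f2 : 'I_2 -> 'I_2 -> R * R -> V).
Hypothesis fE : forall i u, U u -> is_derive u (axis R i) phi (f i u).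
Hypothesis f2E : forall i j u, U u -> is_derive u (axis R i) (f j) (f2 i j u).
Hypothesis f2sym : forall u, U u -> f2 0 1 u = f2 1 0 u.
Hypothesis cf : forall i u, U u -> f i @ nbhs u --> f i u.
Hypothesis cf2 : forall i j u, U u -> f2 i j @ nbhs u --> f2 i j u.
Hypothesis Ff : forall i u, row i (frame phi u) = f i u.
Hypothesis covE : forall i j u z, U u -> dot (cov_frame g phi u i j *m g (phi u)) z =
  dot (f2 i j u *m g (phi u)) z + 2^-1 * (dot (f j u *m Dmetric Dg (phi u) (f i u)) z +
  dot (f i u *m Dmetric Dg (phi u) (f j u)) z - dot (f i u *m Dmetric Dg (phi u) z) (f j u)).

Let y (j : 'I_2) (u : R * R) : V := f j u *m g (phi u).
Let dy (i j : 'I_2) (u : R * R) : V := f2 i j u *m g (phi u) + f j u *m Dmetric Dg (phi u) (f i u).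
Let h (j k : 'I_2) (u : R * R) : R := dot (y j u) (f k u).
Let dh (i j k : 'I_2) (u : R * R) : R := dot (dy i j u) (f k u) + dot (y j u) (f2 i k u).
Let s (u : R * R) : R := area_density g phi u.

Lemma is_derive_metric i u : U u ->
  is_derive u (axis R i) (g \o phi) (Dmetric Dg (phi u) (f i u)).
Proof.
move=> Uu; apply: is_derive_mx => a b.
have := is_derive_comp_grad (cm_grad hg (inOm Uu) a b) (fE i Uu).
move=> /is_derive_eq; apply; rewrite dotE summxE; apply: eq_bigr => c _.
by rewrite !mxE.
Qed.

Lemma is_derive_y i j u : U u -> is_derive u (axis R i) (y j) (dy i j u).
Proof. by move=> Uu; exact: is_derive_mulmx (f2E i j Uu) (is_derive_metric i Uu). Qed.

Lemma is_derive_h i j k u : U u -> is_derive u (axis R i) (h j k) (dh i j k u).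
Proof. by move=> Uu; exact: is_derive_dot (is_derive_y i j Uu) (f2E i k Uu). Qed.

Lemma h_sym u : U u -> h 1 0 u = h 0 1 u.
Proof. by move=> Uu; apply: dot_sym; exact: (cm_sym hg) (inOm Uu). Qed.

Lemma dh_sym i u : U u -> dh i 1 0 u = dh i 0 1 u.
Proof.
move=> Uu; have gs := cm_sym hg (inOm Uu).
have Ds := Dmetric_sym hg (f i u) (inOm Uu).
rewrite /dh /dy /y [LHS]addrC !dotDl (dot_sym (f2 i 1 u) (f 0 u) gs).
rewrite (dot_sym (f 1 u) (f2 i 0 u) gs) (dot_sym (f 1 u) (f 0 u) Ds).
by rewrite [X in _ + X]addrC addrA.
Qed.

Lemma induced_h u i j : induced_metric g phi u i j = h i j u.
Proof. by rewrite gramE !Ff. Qed.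

Lemma sE u : s u = Num.sqrt (h 0 0 u * h 1 1 u - h 0 1 u * h 1 0 u).
Proof. by rewrite /s /area_density det2 !induced_h. Qed.

Lemma induced_det_gt0 u : U u -> 0 < \det (induced_metric g phi u).
Proof.
move=> Uu; apply: metric_gram_det_gt0; [exact: (cm_sym hg) (inOm Uu)|exact: (cm_pos hg) (inOm Uu)|].
exact: (lp_immersion lp).
Qed.

Lemma s_neq0 u : U u -> s u != 0.
Proof. by move=> Uu; rewrite gt_eqF// sqrtr_gt0; exact: induced_det_gt0. Qed.

Lemma is_derive_s i u : U u -> is_derive u (axis R i) s (dsqrt_det h dh s i u).
Proof.
move=> Uu; rewrite (_ : s = fun u => Num.sqrt (h 0 0 u * h 1 1 u - h 0 1 u * h 1 0 u)); last first.
  by apply/funext => v; rewrite sE.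
have d0 : 0 < h 0 0 u * h 1 1 u - h 0 1 u * h 1 0 u.
  by have := induced_det_gt0 Uu; rewrite det2 !induced_h.
have D := is_deriveB (is_deriveM (is_derive_h i 0 0 Uu) (is_derive_h i 1 1 Uu))
  (is_deriveM (is_derive_h i 0 1 Uu) (is_derive_h i 1 0 Uu)).
have := is_derive_comp_real D (is_derive1_sqrt d0).
move=> /is_derive_eq; apply; rewrite /dsqrt_det -sE (h_sym Uu) (dh_sym i Uu).
move: (s_neq0 Uu); rewrite /GRing.scale/=.
move: (s u) (h 0 0 u) (h 0 1 u) (h 1 1 u) (dh i 0 0 u) (dh i 0 1 u) (dh i 1 1 u) => r a b c a' b' c' r0.
by field.
Qed.

Section continuity.
Variable u : R * R.
Hypothesis Uu : U u.

Lemma cvg_g : (g \o phi) @ nbhs u --> g (phi u).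
Proof. exact: (@continuous_comp _ _ _ phi g u (chart_continuous lp Uu) (metric_continuous hg (inOm Uu))). Qed.

Lemma cvg_Dmetric i : (fun v => Dmetric Dg (phi v) (f i v)) @ nbhs u --> Dmetric Dg (phi u) (f i u).
Proof.
apply: cvg_mx => a b; rewrite summxE; under eq_fun do rewrite summxE.
apply: cvg_sumr => c; rewrite !mxE; under eq_fun do rewrite mxE.
apply: cvgM; first by apply: cvg_coord; exact: cf.
have cDc := @cm_Dcont _ _ _ _ hg _ (inOm Uu) c.
have cD : (fun v => Dg c (phi v)) @ nbhs u --> Dg c (phi u).
  exact: (@continuous_comp _ _ _ phi (Dg c) u (chart_continuous lp Uu) cDc).
apply: cvg_coord; exact: cD.
Qed.

Lemma cvg_y j : y j @ nbhs u --> y j u.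
Proof. by apply: cvg_mulmx; [exact: cf|exact: cvg_g]. Qed.

Lemma cvg_dy i j : dy i j @ nbhs u --> dy i j u.
Proof. by apply: cvgD; apply: cvg_mulmx; [exact: cf2|exact: cvg_g|exact: cf|exact: cvg_Dmetric]. Qed.

Lemma cvg_h j k : h j k @ nbhs u --> h j k u.
Proof. by apply: cvg_dot; [exact: cvg_y|exact: cf]. Qed.

Lemma cvg_dh i j k : dh i j k @ nbhs u --> dh i j k u.
Proof.
by apply: cvgD; apply: cvg_dot; [exact: cvg_dy|exact: cf|exact: cvg_y|exact: cf2].
Qed.

Lemma cvg_s : s @ nbhs u --> s u.
Proof. exact: (area_density_continuous lp Uu (metric_continuous hg (inOm Uu))). Qed.

End continuity.

Lemma variation_exact_from_derivatives : exact_in_chart variation_A variation_B U phi.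
Proof.
exists (pfield y h s), (dpfield y dy h dh s); split.
- move=> i u Uu; apply: is_derive_pfield; first exact: s_neq0.
  + by move=> k j; exact: is_derive_y.
  + by move=> k j l; exact: is_derive_h.
  + by move=> k; exact: is_derive_s.
- move=> i u Uu; apply: pfield_continuous; first exact: s_neq0.
  + by move=> j; exact: cvg_y.
  + by move=> j k; exact: cvg_h.
  + exact: cvg_s.
- move=> i u Uu; apply: dpfield_continuous; first exact: s_neq0.
  + by move=> j; exact: cvg_y.
  + by move=> k j; exact: cvg_dy.
  + by move=> j k; exact: cvg_h.
  + by move=> k j l; exact: cvg_dh.
  + exact: cvg_s.
- move=> u Uu D X.
  have gs := cm_sym hg (inOm Uu); have gp := cm_pos hg (inOm Uu).
  have Ds v := Dmetric_sym hg v (inOm Uu).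
  have Ffree := lp_immersion lp Uu; have n1 := nu1 (chart_sub lp Uu).
  have sE' : s u = Num.sqrt (\det (frame phi u *m g (phi u) *m (frame phi u)^T)) by [].
  have eE' : area_density (@euclidean R) phi u = Num.sqrt (\det (frame phi u *m (frame phi u)^T)).
    by rewrite /area_density /induced_metric /euclidean mulmx1.
  have P1 := point_principal (f := f^~ u) gs gp (Ff^~ u) Ffree (nuF Uu) n1 D.
  have P2 := point_divergence (f := f^~ u) (f2 := fun i j => f2 i j u) gs gp Ds (Ff^~ u) Ffree
    (nuF Uu) n1 (f2sym Uu) (fun i j z => covE i j z Uu) (HE Uu) X.
  have fD i : 'D_(axis R i) phi u = f i u by have [_] := fE i Uu.
  rewrite sum2 !fD eE' mulrDr variation_BE [in LHS]/variation_A P1 -P2 /pfield /dpfield /dquot /dsqrt_det !eqxx.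
  rewrite sE'; exact: addrACA.
Qed.

End derivatives.

(** The regularity C^2 of the chart enters through the symmetry of its second
    derivatives and their continuity, which makes the plane fields C^1. *)
Lemma variation_exact : exact_in_chart variation_A variation_B U phi.
Proof.
pose f i := 'D_(axis R i) phi.
pose f2 i j := 'D_(axis R i) (f j).
have fE i u : U u -> is_derive u (axis R i) phi (f i u).
  by move=> Uu; apply: derivableP; exact: (chart_derivable lp).
have f2E i j u : U u -> is_derive u (axis R i) (f j) (f2 i j u).
  by move=> Uu; apply: derivableP; exact: (chart_D_derivable lp).
have cf2 i j u : U u -> f2 i j @ nbhs u --> f2 i j u.
  by move=> Uu; exact: (chart_DD_continuous lp).
have Ff i u : row i (frame phi u) = f i u by apply/rowP => k; rewrite !mxE.
apply: (@variation_exact_from_derivatives f f2 fE f2E _ _ cf2 Ff).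
- by move=> u Uu; exact: chart_mixed lp Uu.
- by move=> i u Uu; exact: (chart_D_continuous lp).
- move=> i j u z Uu; rewrite /cov_frame mulmxDl dotDl -(christoffelE hg)//; last exact: inOm.
  congr (_ + dot (_ *m _) z); apply/rowP => k; rewrite !mxE; apply: eq_bigr => a _.
  by apply: eq_bigr => b _; rewrite !mxE.
Qed.

End one_chart.
End first_variation.

(** * Constant fields have no flux through a closed surface *)

Section flux.
Variable R : realType.
Local Notation V := 'rV[R]_3.
Implicit Types (x y n v : V).

Lemma chart_within_continuous (T : topologicalType) (N : set V) (U : set (R * R)) phi (f : V -> T) u :
  local_param N U phi -> {within N, continuous f} -> U u -> (f \o phi) @ nbhs u --> f (phi u).
Proof.
move=> lp cf Uu W hW.
have Np := chart_sub lp Uu.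
have h : nbhs (phi u) [set x | N x -> W (f x)].
  exact: ((subspace_continuousP N f).1 cf _ Np W hW).
have h1 : nbhs u (fun w => N (phi w) -> W (f (phi w))) by exact: (chart_continuous lp Uu h).
have h2 : nbhs u U by apply: open_nbhs_nbhs; split => //; exact: lp_open lp.
by apply: filterS2 h1 h2 => w hw Uw; apply: hw; exact: (chart_sub lp Uw).
Qed.

(** The matrix of the cross product: tr (skew n *m DX) is the flux density of
    the curl of X through the unit normal n. *)
Definition skew n : 'M[R]_3 :=
  n 0 0 *: (delta_mx 2%:R 1 - delta_mx 1 2%:R) + n 0 1 *: (delta_mx 0 2%:R - delta_mx 2%:R 0)
  + n 0 2%:R *: (delta_mx 1 0 - delta_mx 0 1).

Definition cross x y : V :=
  (x 0 1 * y 0 2%:R - x 0 2%:R * y 0 1) *: delta_mx 0 0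
  + (x 0 2%:R * y 0 0 - x 0 0 * y 0 2%:R) *: delta_mx 0 1
  + (x 0 0 * y 0 1 - x 0 1 * y 0 0) *: delta_mx 0 2%:R.

Lemma skewZ a n : skew (a *: n) = a *: skew n.
Proof. by rewrite /skew !mxE !scalerDr !scalerA. Qed.

Lemma skew_cross x y : skew (cross x y) = y^T *m x - x^T *m y.
Proof.
apply/matrixP => i j; rewrite /skew /cross; elim/ord3P: i; elim/ord3P: j;
  rewrite !(mxE, big_ord_recl, big_ord0)/=; ring.
Qed.

Lemma skew_dot n v : \tr (skew n *m (skew v)^T) = 2 * dot n v.
Proof. by rewrite dot3 /mxtrace sum3 !mxE !sum3 !mxE/=; ring. Qed.

Lemma mxtrace_wedge x y (D : 'M[R]_3) :
  \tr ((y^T *m x - x^T *m y) *m D) = dot y (x *m D) - dot x (y *m D).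
Proof.
rewrite mulmxBl raddfB/= -!mulmxA !(mxtrace_mulC _ (_ *m D)) /mxtrace !big_ord1.
by rewrite -/(dot _ _) -/(dot _ _) dotC [in X in _ - X]dotC.
Qed.

Lemma cross_dotl x y : dot x (cross x y) = 0.
Proof. by rewrite dot3 /cross !mxE/=; ring. Qed.

Lemma cross_dotr x y : dot y (cross x y) = 0.
Proof. by rewrite dot3 /cross !mxE/=; ring. Qed.

Lemma cross_sq x y : dot (cross x y) (cross x y) = dot x x * dot y y - dot x y * dot y x.
Proof. by rewrite !dot3 /cross !mxE/=; ring. Qed.

Lemma cvg_skew (T : Type) (F : set_system T) {FF : Filter F} (f : T -> V) l :
  f @ F --> l -> (fun t => skew (f t)) @ F --> skew l.
Proof.
move=> h; have c k : (fun t => f t 0 k) @ F --> l 0 k by apply: cvg_coord.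
by apply: cvgD; [apply: cvgD|]; apply: cvgZ; [exact: c|exact: cvg_cst|exact: c|exact: cvg_cst|exact: c|exact: cvg_cst].
Qed.

Lemma cvg_cross (T : Type) (F : set_system T) {FF : Filter F} (f g : T -> V) k l :
  f @ F --> k -> g @ F --> l -> (fun t => cross (f t) (g t)) @ F --> cross k l.
Proof.
move=> hf hg.
have c i : (fun t => f t 0 i) @ F --> k 0 i by apply: cvg_coord.
have d i : (fun t => g t 0 i) @ F --> l 0 i by apply: cvg_coord.
have e i j : (fun t => f t 0 i * g t 0 j) @ F --> k 0 i * l 0 j.
  by apply: cvgM; [exact: c|exact: d].
apply: cvgD; [apply: cvgD|]; (apply: cvgZ; [apply: cvgB; exact: e|exact: cvg_cst]).
Qed.

Lemma det_gram (F : 'M[R]_(2, 3)) :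
  \det (F *m F^T) = dot (cross (row 0 F) (row 1 F)) (cross (row 0 F) (row 1 F)).
Proof. by rewrite -{1}[F]mulmx1 det2 !gramE !mulmx1 cross_sq. Qed.

Lemma frame_cross (F : 'M[R]_(2, 3)) : F *m (cross (row 0 F) (row 1 F))^T = 0.
Proof.
apply/matrixP => i j; rewrite ord1 [in RHS]mxE; set v := cross _ _.
have -> : (F *m v^T) i 0 = dot (row i F) v by rewrite /dot -row_mul [RHS]mxE.
case: (ord2P i) => ->; [exact: cross_dotl|exact: cross_dotr].
Qed.

(** s n = eps f_0 x f_1, where the sign eps is constant where (f_0 x f_1) . n
    does not vanish. *)
Lemma normal_cross (F : 'M[R]_(2, 3)) n e : row_free F -> F *m n^T = 0 -> enorm n = 1 ->
  e ^+ 2 = 1 -> 0 < e * dot (cross (row 0 F) (row 1 F)) n ->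
  Num.sqrt (\det (F *m F^T)) *: n = e *: cross (row 0 F) (row 1 F).
Proof.
move=> Ff Fn n1 e1 pos; set v := cross _ _ in pos *.
have vE : v = dot v n *: n.
  exact: (normal_decomposition Ff Fn n1 (frame_cross F)).
have dE : \det (F *m F^T) = (e * dot v n) ^+ 2.
  rewrite exprMn e1 mul1r det_gram -/v.
  by rewrite {1 2}vE dotZl dotZr -enorm_sq n1 expr1n mulr1 -expr2.
by rewrite dE sqrtr_sqr gtr0_norm// -scalerA -vE.
Qed.

Section closed.
Variables (N : set V) (nu : V -> V).
Hypothesis un : outward_unit_normal N nu.

Section derivatives.
Variables (U : set (R * R)) (phi : R * R -> V) (u0 : R * R).
Hypotheses (lp : local_param N U phi) (Uu0 : U u0).
Variables (f : 'I_2 -> R * R -> V) (f2 : 'I_2 -> 'I_2 -> R * R -> V).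
Hypothesis fE : forall i u, U u -> is_derive u (axis R i) phi (f i u).
Hypothesis f2E : forall i j u, U u -> is_derive u (axis R i) (f j) (f2 i j u).
Hypothesis f2sym : forall u, U u -> f2 0 1 u = f2 1 0 u.
Hypothesis cf : forall i u, U u -> f i @ nbhs u --> f i u.
Hypothesis cf2 : forall i j u, U u -> f2 i j @ nbhs u --> f2 i j u.
Hypothesis Ff : forall i u, row i (frame phi u) = f i u.

(** Up to sign, s n is f_0 x f_1, and f_0 x f_1 . curl X is the divergence of the
    plane field (f_1.X, - f_0.X). The chart is shrunk to where the sign is
    constant. *)
Lemma flux_exact_from_derivatives :
  exists2 U', U' u0 & local_param N U' phi /\ exact_in_chart (skew \o nu) (cst 0) U' phi.
Proof.
pose w u := dot (cross (f 0 u) (f 1 u)) (nu (phi u)).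
have cw u : U u -> w @ nbhs u --> w u.
  move=> Uu; apply: cvg_dot; last exact: (chart_within_continuous lp (un_continuous un) Uu).
  by apply: cvg_cross; exact: cf.
have w0 u : U u -> w u != 0.
  move=> Uu; have n1 := un_unit un (chart_sub lp Uu).
  have Fn := un_normal un lp Uu; have Fr := lp_immersion lp Uu.
  apply/eqP => w0.
  have := euclid_gram_det_gt0 Fr.
  rewrite det_gram !Ff.
  suff -> : cross (f 0 u) (f 1 u) = 0 by rewrite dot0l ltxx.
  have := normal_decomposition Fr Fn n1 (frame_cross (frame phi u)).
  by rewrite !Ff -/(w u) w0 scale0r.
pose e := Num.sg (w u0).
have e1 : e ^+ 2 = 1 by rewrite /e sqr_sg w0.
pose U' := U `&` [set u | 0 < e * w u].
have oU' : open U'.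
  rewrite openE => u [Uu pu]; rewrite /interior.
  apply: filterI; first by apply: open_nbhs_nbhs; split => //; exact: lp_open lp.
  have : (fun u => e * w u) @ nbhs u --> e * w u by apply: cvgM; [exact: cvg_cst|exact: cw].
  by move=> /(_ [set t | 0 < t]); apply; exact: lt_nbhsr.
have lp' : local_param N U' phi by apply: (local_param_sub oU' _ lp) => u [].
exists U'; first by split => //=; rewrite -normrEsg normr_gt0 w0.
split => //.
exists (fun i u => if i == 0 then e *: f 1 u else - e *: f 0 u),
  (fun i u => if i == 0 then e *: f2 0 1 u else - e *: f2 1 0 u); split.
- by move=> i u [Uu _]; case: (ord2P i) => -> /=; apply: is_deriveZ; exact: f2E.
- by move=> i u [Uu _]; case: (ord2P i) => -> /=; apply: cvg_continuous_for; apply: cvgZl_tmp; exact: cf.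
- by move=> i u [Uu _]; case: (ord2P i) => -> /=; apply: cvg_continuous_for; apply: cvgZl_tmp; exact: cf2.
move=> u [Uu pu] D X.
have n1 := un_unit un (chart_sub lp Uu).
have Fn := un_normal un lp Uu; have Fr := lp_immersion lp Uu.
have pu' : 0 < e * dot (cross (row 0 (frame phi u)) (row 1 (frame phi u))) (nu (phi u)) by rewrite !Ff.
have fD i : 'D_(axis R i) phi u = f i u by have [_] := fE i Uu.
have E := normal_cross Fr Fn n1 e1 pu'.
rewrite /area_density /induced_metric /euclidean mulmx1 sum2 /= dot0l addr0.
rewrite -mxtraceZ scalemxAl -skewZ E skewZ skew_cross -scalemxAl mxtraceZ mxtrace_wedge !Ff.
by rewrite f2sym// !dotZl !fD; ring.
Qed.


End derivatives.

Lemma flux_exact U phi u0 : local_param N U phi -> U u0 ->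
  exists2 U', U' u0 & local_param N U' phi /\ exact_in_chart (skew \o nu) (cst 0) U' phi.
Proof.
move=> lp Uu0.
apply: (@flux_exact_from_derivatives U phi u0 lp Uu0 (fun i => 'D_(axis R i) phi)
  (fun i j => 'D_(axis R i) ('D_(axis R j) phi))).
- by move=> i u Uu; apply: derivableP; exact: (chart_derivable lp).
- by move=> i j u Uu; apply: derivableP; exact: (chart_D_derivable lp).
- by move=> u Uu; exact: chart_mixed lp Uu.
- by move=> i u Uu; exact: (chart_D_continuous lp).
- by move=> i j u Uu; exact: (chart_DD_continuous lp).
- by move=> i u; apply/rowP => k; rewrite !mxE.
Qed.

(** A constant field b is a curl, so its flux through a closed surface vanishes. *)
Lemma flux_zero (sigma : {measure set (borel3 R) -> \bar R}) b :
  closed_surface N -> is_area_measure (@euclidean R) N sigma ->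
  \int[sigma]_(x in N) dot (nu x) b = 0.
Proof.
move=> cs hs.
have := @exact_integral R N setT sigma (skew \o nu) (cst 0) _ _ cs hs _ _ (@subsetT _ N)
  (C1_field_linear setT (2^-1 *: (skew b)^T)).
rewrite (_ : jet _ _ _ _ = fun x => dot (nu x) b); last first.
  apply/funext => x; rewrite /jet dot0l addr0 /= -scalemxAr mxtraceZ skew_dot mulrA mulVf ?mul1r//.
apply.
- by move=> x; apply: cvg_skew; exact: (un_continuous un).
- by move=> x; exact: cvg_cst.
- move=> p Np; have [U [phi [lp [u Uu <-]]]] := cs_param cs Np.
  have [U' U'u [lp' ex]] := flux_exact lp Uu.
  by exists U', phi; split => //; exists u.
Qed.

End closed.
End flux.

(** * The metric of an asymptotically flat end *)

Lemma cvg_row (R : realType) (T : Type) (F : set_system T) {FF : Filter F} (n : nat)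
    (f : 'I_n -> T -> R) (l : 'I_n -> R) :
  (forall k, f k @ F --> l k) -> (fun t => \row_k f k t) @ F --> \row_k l k.
Proof.
move=> h; apply: cvg_mx => i j; rewrite mxE.
by rewrite (_ : (fun t => _) = f j) //; apply/funext => t; rewrite mxE.
Qed.

Lemma cvg_row_coord (R : realType) (T : Type) (F : set_system T) {FF : Filter F} (n : nat)
    (f : 'I_n -> T -> R) (l : 'I_n -> R) k :
  (fun t => \row_k f k t) @ F --> \row_k l k -> f k @ F --> l k.
Proof.
move=> h; have -> : f k = (fun t => (\row_k f k t) 0 k) by apply/funext => t; rewrite mxE.
have -> : l k = (\row_k l k) 0 k by rewrite mxE.
exact: cvg_coord.
Qed.

Section exterior_region.
Variable R : realType.
Local Notation V := 'rV[R]_3.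
Local Notation ext := (@exterior R).

Definition inv_enorm (x : V) : R := (enorm x)^-1.
Local Notation t := inv_enorm.

Lemma exterior_gt0 x : ext x -> 0 < enorm x.
Proof. exact: lt_trans. Qed.

Lemma inv_enorm_gt0 x : ext x -> 0 < t x.
Proof. by move=> /exterior_gt0; rewrite invr_gt0. Qed.

Lemma inv_enormK x : ext x -> t x * enorm x = 1.
Proof. by move=> /exterior_gt0 h; rewrite mulVf ?gt_eqF. Qed.

Lemma inv_enorm_sq x : ext x -> t x ^+ 2 * dot x x = 1.
Proof. by move=> h; rewrite -enorm_sq -exprMn inv_enormK// expr1n. Qed.

Lemma C1_enorm : C1_on ext (@enorm R) (fun x => t x *: x).
Proof.
have h0 x : ext x -> 0 < sqdist 0 x.
  by move=> /exterior_gt0 h; rewrite /sqdist subr0 -enorm_sq exprn_gt0.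
have E : @enorm R = fun x => Num.sqrt (sqdist 0 x) by apply/funext => x; rewrite /sqdist subr0.
rewrite {1}E.
apply: (@C1_eq R ext _ (fun x => (2 * Num.sqrt (sqdist 0 x))^-1 *: (2 *: (x - 0)))); last first.
  by move=> x; rewrite subr0 scalerA invfM mulrAC mulVf ?pnatr_eq0// mul1r /t E.
apply: (@C1_comp R ext Num.sqrt (fun s => (2 * Num.sqrt s)^-1)); first exact: C1_sqdist.
- by move=> x /h0 hx; exact: is_derive1_sqrt.
- move=> x /h0 hx; apply: cvg_continuous_for; apply: cvgV.
    by rewrite mulf_neq0 ?pnatr_eq0// gt_eqF ?sqrtr_gt0.
  by apply: cvgM; [exact: cvg_cst|exact: sqrt_continuous].
Qed.

Lemma C1_inv_enorm : C1_on ext t (fun x => - t x ^+ 3 *: x).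
Proof.
apply: (@C1_eq R ext _ (fun x => - enorm x ^- 2 *: (t x *: x))); last first.
  by move=> x; rewrite scalerA /t -exprVn mulNr -exprSr.
by apply: (C1_inv C1_enorm) => x /exterior_gt0 h; rewrite gt_eqF.
Qed.

Lemma exterior_open : open ext.
Proof.
have -> : ext = (sqdist 0) @^-1` [set s : R | 1 < s].
  apply/seteqP; split => x; rewrite /exterior/= /sqdist subr0 -enorm_sq.
    by move=> h; rewrite exprn_egt1.
  by move=> h; rewrite ltNge; apply/negP => h'; move: h; rewrite ltNge exprn_ile1 ?enorm_ge0.
by apply: open_comp => [x _|]; [exact: sqdist_continuous|exact: open_gt].
Qed.

Lemma C1_expn O f F k : C1_on O f F -> @C1_on R O (fun x => f x ^+ k.+1) (fun x => (k.+1%:R * f x ^+ k) *: F x).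
Proof.
move=> hf; elim: k => [|k IH].
  by apply: (C1_eq (G := F)) => [|x]; [exact: hf|rewrite expr0 mulr1 scale1r].
apply: C1_eq; first exact: (C1M hf IH).
move=> x /=; rewrite scalerA -scalerDl; congr (_ *: _).
by rewrite mulrCA -exprS [k.+2%:R]mulrS mulrDl mul1r addrC.
Qed.

Section end_metric.
Variables (m : R) (g : V -> 'M[R]_3).
Hypothesis hg : asymptotically_flat_end m g.

Definition perturbation (i j : 'I_3) (x : V) : R := (g x - schwarzschild m x) i j.

(** The conformal factor of the Schwarzschild metric is the fourth power of it. *)
Definition conf (x : V) : R := 1 + m / 2 * t x.

(** The scalar matrix is the derivative of the Schwarzschild metric. *)
Definition end_Dmetric (a : 'I_3) (x : V) : 'M[R]_3 :=
  \matrix_(i, j) partial a (perturbation i j) x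
  - (2 * m * conf x ^+ 3 * t x ^+ 3 * x 0 a)%:M.

Lemma end_metricE x i j : g x i j = perturbation i j x + conf x ^+ 4 * (i == j)%:R.
Proof.
rewrite /perturbation /schwarzschild /conf /t !mxE.
have -> : m / (2 * enorm x) = m / 2 / enorm x by rewrite invfM mulrA.
by rewrite mulr_natr subrK.
Qed.

Lemma C1_perturbation i j : C1_on ext (perturbation i j) (fun x => \row_a partial a (perturbation i j) x).
Proof.
have [_ hC] := af_C4 hg i j.
have cp a x : ext x -> {for x, continuous (partial a (perturbation i j))}.
  by have [_ [h _]] := hC (delta_mx 0 a); exact: h.
split => x ex.
  apply: (has_grad_partials exterior_open ex) => [y ey a|a]; last exact: cp.
  by have [h _] := hC (delta_mx 0 a); exact: h.
apply: cvg_continuous_for; apply: cvg_row => a; exact: cp.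
Qed.

Lemma C1_conf4 : C1_on ext (fun x => conf x ^+ 4) (fun x => - (2 * m * conf x ^+ 3 * t x ^+ 3) *: x).
Proof.
have h1 : C1_on ext conf (fun x => - (m / 2 * t x ^+ 3) *: x).
  apply: C1_eq; first exact: (C1D (C1_cst ext 1) (C1M (C1_cst ext (m / 2)) C1_inv_enorm)).
  by move=> x /=; rewrite scaler0 addr0 add0r scalerA mulrN.
apply: C1_eq; first exact: (C1_expn 3 h1).
move=> x /=; rewrite scalerA; congr (_ *: _).
by move: (conf x) (t x) => c s; field.
Qed.

(** Near a point of the exterior the perturbation is symmetric, hence so are its
    derivatives. *)
Lemma end_C1_metric : C1_metric ext g end_Dmetric.
Proof.
have hE i j : C1_on ext (fun x => g x i j) (fun x => \row_a end_Dmetric a x i j).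
  rewrite (_ : (fun x => g x i j) = fun x => perturbation i j x + conf x ^+ 4 * (i == j)%:R); last first.
    by apply/funext => x; rewrite end_metricE.
  apply: C1_eq; first exact: (C1D (C1_perturbation i j) (C1M C1_conf4 (C1_cst ext (i == j)%:R))).
  move=> x; apply/rowP => a; rewrite /= !mxE -mulr_natr; ring.
split.
- exact: af_sym hg.
- exact: af_pos hg.
- by move=> x ex i j; exact: (hE i j).1.
- move=> x ex a; apply/matrixP => i j; rewrite !mxE eq_sym; congr (_ - _).
  apply: near_eq_derive; near=> y.
  have ey : ext y by near: y; apply: open_nbhs_nbhs; split; [exact: exterior_open|].
  by rewrite /perturbation !mxE eq_sym -[in LHS](af_sym hg ey) mxE.
- move=> x ex a; apply: cvg_continuous_for; apply: cvg_mx => i j.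
  exact: (@cvg_row_coord R _ (nbhs x) _ 3 (fun a y => end_Dmetric a y i j) (fun a => end_Dmetric a x i j) a ((hE i j).2 x ex)).
Unshelve. all: by end_near. Qed.

End end_metric.
End exterior_region.

(** * Uniform asymptotic expansions *)

Section big_oh.
Variables (R : realType) (I : Type) (D : set I) (t : I -> R).
Hypothesis t01 : forall i, D i -> 0 <= t i <= 1.
Implicit Types (f g h : I -> R) (k l : nat).

(** f = O(t^k) as t tends to 0, uniformly over D. The bound is asked only for t
    below a threshold, so that the class of functions close to 1 is closed under
    inversion. *)
Definition bigO k f : Prop :=
  exists K d, [/\ 0 <= K, 0 < d & forall i, D i -> t i <= d -> `|f i| <= K * t i ^+ k].

Definition approx k f g : Prop := bigO k (fun i => f i - g i).

Lemma bigO_le k f g c : 0 <= c -> bigO k f -> (forall i, D i -> `|g i| <= c * `|f i|) -> bigO k g.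
Proof.
move=> c0 [K [d [K0 d0 h]]] gf; exists (c * K), d; split => //; first exact: mulr_ge0.
by move=> i Di ti; apply: (le_trans (gf i Di)); rewrite -mulrA ler_wpM2l// h.
Qed.

Lemma bigO_eq k f g : bigO k f -> (forall i, D i -> g i = f i) -> bigO k g.
Proof. by move=> hf e; apply: (bigO_le ler01 hf) => i Di; rewrite e// mul1r. Qed.

Lemma bigO_t k : bigO k (fun i => t i ^+ k).
Proof.
exists 1, 1; split => // i Di _.
by have /andP[t0 _] := t01 Di; rewrite mul1r ger0_norm// exprn_ge0.
Qed.

Lemma bigOW k l f : (k <= l)%N -> bigO l f -> bigO k f.
Proof.
move=> kl [K [d [K0 d0 h]]]; exists K, d; split => // i Di ti.
have /andP[t0 t1] := t01 Di.
by apply: (le_trans (h i Di ti)); rewrite ler_wpM2l// ler_wiXn2l.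
Qed.

Lemma bigOD k f g : bigO k f -> bigO k g -> bigO k (fun i => f i + g i).
Proof.
move=> [K [d [K0 d0 h]]] [K' [d' [K'0 d'0 h']]].
exists (K + K'), (Num.min d d'); split; [exact: addr_ge0|by rewrite lt_min d0|].
move=> i Di; rewrite le_min => /andP[td td']; rewrite mulrDl.
by apply: (le_trans (ler_normD _ _)); rewrite lerD// ?h ?h'.
Qed.

Lemma bigON k f : bigO k f -> bigO k (fun i => - f i).
Proof. by move=> hf; apply: (bigO_le ler01 hf) => i _; rewrite normrN mul1r. Qed.

Lemma bigOB k f g : bigO k f -> bigO k g -> bigO k (fun i => f i - g i).
Proof. by move=> hf hg; apply: bigOD hf (bigON hg). Qed.

Lemma bigOM k l f g : bigO k f -> bigO l g -> bigO (k + l) (fun i => f i * g i).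
Proof.
move=> [K [d [K0 d0 h]]] [K' [d' [K'0 d'0 h']]].
exists (K * K'), (Num.min d d'); split; [exact: mulr_ge0|by rewrite lt_min d0|].
move=> i Di; rewrite le_min => /andP[td td']; rewrite normrM exprD mulrACA.
by apply: ler_pM; rewrite ?h ?h'.
Qed.

Lemma bigO_bounded f c : (forall i, D i -> `|f i| <= c) -> bigO 0 f.
Proof.
move=> h; exists `|c|, 1; split => // i Di _.
by rewrite expr0 mulr1 (le_trans (h i Di))// ler_norm.
Qed.

Lemma bigO_cst c : bigO 0 (fun=> c).
Proof. exact: (@bigO_bounded _ `|c|). Qed.

Lemma bigO0 k : bigO k (fun=> 0).
Proof. by apply: (@bigO_le k _ _ 0 _ (bigO_t k)) => // i _; rewrite normr0 mul0r. Qed.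

Lemma bigO_sum k (J : Type) (s : seq J) (F : J -> I -> R) :
  (forall j, bigO k (F j)) -> bigO k (fun i => \sum_(j <- s) F j i).
Proof.
move=> h; elim: s => [|j s IH]; first by apply: bigO_eq (bigO0 k) _ => i _; rewrite big_nil.
by apply: bigO_eq (bigOD (h j) IH) _ => i _; rewrite big_cons.
Qed.

Lemma approx_refl k f : approx k f f.
Proof. by apply: bigO_eq (bigO0 k) _ => i _; rewrite subrr. Qed.

Lemma approx_trans k f g h : approx k f g -> approx k g h -> approx k f h.
Proof. by move=> a b; apply: bigO_eq (bigOD a b) _ => i _; rewrite addrA subrK. Qed.

Lemma approxB k f f' g g' : approx k f f' -> approx k g g' ->
  approx k (fun i => f i - g i) (fun i => f' i - g' i).
Proof. by move=> a b; apply: bigO_eq (bigOB a b) _ => i _; rewrite !opprD !opprK addrACA. Qed.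

(** One factor of size t^l improves the relative error of the other. *)
Lemma approxM k l f f' g g' : approx k f f' -> bigO 0 f' -> bigO l g -> approx (k + l) g g' ->
  approx (k + l) (fun i => f i * g i) (fun i => f' i * g' i).
Proof.
move=> a b' c e; apply: bigO_eq (bigOD (bigOM a c) (bigOM b' e)) _ => i _.
by rewrite mulrBl mulrBr addrA subrK.
Qed.

Lemma approx_bounded k f f' : approx k f f' -> bigO 0 f' -> bigO 0 f.
Proof.
move=> a b; apply: bigO_eq (bigOD (bigOW (leq0n k) a) b) _ => i _; by rewrite subrK.
Qed.

Lemma approx_sum k (J : Type) (s : seq J) (F G : J -> I -> R) :
  (forall j, approx k (F j) (G j)) ->
  approx k (fun i => \sum_(j <- s) F j i) (fun i => \sum_(j <- s) G j i).
Proof. by move=> h; apply: bigO_eq (bigO_sum s h) _ => i _; rewrite sumrB. Qed.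

Lemma approxM0 k f f' g g' : approx k f f' -> bigO 0 f' -> approx k g g' -> bigO 0 g' ->
  approx k (fun i => f i * g i) (fun i => f' i * g' i).
Proof.
move=> a b c e; rewrite -[k in approx k _ _]addn0; apply: approxM => //; last by rewrite addn0.
exact: approx_bounded c e.
Qed.

Lemma approx_prod k (J : Type) (s : seq J) (F G : J -> I -> R) :
  (forall j, approx k (F j) (G j)) -> (forall j, bigO 0 (G j)) ->
  approx k (fun i => \prod_(j <- s) F j i) (fun i => \prod_(j <- s) G j i) /\
  bigO 0 (fun i => \prod_(j <- s) G j i).
Proof.
move=> h b; elim: s => [|j s [IH IHb]].
  split; first by apply: bigO_eq (bigO0 k) _ => i _; rewrite !big_nil subrr.
  by apply: bigO_eq (bigO_cst 1) _ => i _; rewrite big_nil.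
split; last by apply: bigO_eq (bigOM (b j) IHb) _ => i _; rewrite big_cons.
by apply: bigO_eq (approxM0 (h j) (b j) IH IHb) _ => i _; rewrite !big_cons.
Qed.

Lemma approx_det k n (A B : I -> 'M[R]_n) :
  (forall a b, approx k (fun i => A i a b) (fun i => B i a b)) ->
  (forall a b, bigO 0 (fun i => B i a b)) ->
  approx k (fun i => \det (A i)) (fun i => \det (B i)).
Proof.
move=> h b; apply: approx_sum => s; apply: approxM0.
- exact: approx_refl.
- exact: bigO_cst.
- by have [] := approx_prod (index_enum 'I_n) (fun j => h j (perm.fun_of_perm s j)) (fun j => b j (perm.fun_of_perm s j)).
- by have [] := approx_prod (index_enum 'I_n) (fun j => h j (perm.fun_of_perm s j)) (fun j => b j (perm.fun_of_perm s j)).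
Qed.

Lemma bigO_exp f n : bigO 0 f -> bigO 0 (fun i => f i ^+ n).
Proof.
move=> h; elim: n => [|n IH]; first by apply: bigO_eq (bigO_cst 1) _ => i _.
by apply: bigO_eq (bigOM h IH) _ => i _; rewrite exprS.
Qed.

Lemma approx_exp k f f' n : approx k f f' -> bigO 0 f' ->
  approx k (fun i => f i ^+ n) (fun i => f' i ^+ n).
Proof.
move=> h b; elim: n => [|n IH]; first by apply: bigO_eq (bigO0 k) _ => i _; rewrite subrr.
by apply: bigO_eq (approxM0 h b IH (bigO_exp n b)) _ => i _; rewrite !exprS.
Qed.

(** A factor close to 1 is at least 1/2 once t is small. *)
Lemma approx_inv1 f : approx 1 f (fun=> 1) -> approx 1 (fun i => (f i)^-1) (fun=> 1).
Proof.
move=> [K [d [K0 d0 h]]].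
exists (2 * K), (Num.min d (2 * (K + 1))^-1); split; first by rewrite mulr_ge0.
  by rewrite lt_min d0 invr_gt0; apply: mulr_gt0 => //; rewrite ltr_wpDl.
move=> i Di; rewrite le_min => /andP[td tK].
have hi := h i Di td; rewrite expr1 in hi *.
have /andP[t0 _] := t01 Di.
have K1 : 0 < K + 1 by rewrite ltr_wpDl.
have Kt : K * t i <= 1 / 2.
  have : (K + 1) * t i <= 1 / 2.
    have -> : 1 / 2 = (K + 1) * (2 * (K + 1))^-1 by rewrite invfM mulrCA mulfV ?gt_eqF// mulr1 mul1r.
    by rewrite ler_pM2l.
  by rewrite mulrDl; lra.
have f2 : 1 / 2 <= f i by move: hi; rewrite ler_norml => /andP[]; lra.
have f0 : f i != 0 by rewrite gt_eqF//; lra.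
have -> : (f i)^-1 - 1 = (f i)^-1 * (1 - f i) by rewrite mulrBr mulr1 mulVf.
rewrite normrM distrC; apply: (@le_trans _ _ (2 * `|f i - 1|)).
  rewrite ler_wpM2r// ger0_norm ?invr_ge0; last by lra.
  by rewrite -[2]invrK lef_pV2 ?posrE ?invr_gt0//; lra.
by rewrite -mulrA ler_wpM2l.
Qed.

(** The difference is a - c^2 over sqrt a + c, which is at least 1; for a < 0 it is
    - c, and c <= c^2. *)
Lemma sqrt_lipschitz (a c : R) : 1 <= c -> `|Num.sqrt a - c| <= `|a - c ^+ 2|.
Proof.
move=> c1; have [a0|a0] := leP 0 a; last first.
  rewrite ler0_sqrtr ?ltW// sub0r normrN ger0_norm; last by lra.
  rewrite ltr0_norm; nra.
have s0 := sqrtr_ge0 a.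
rewrite -{2}(sqr_sqrtr a0) subr_sqr normrM ler_peMr// ger0_norm; lra.
Qed.

Lemma approx_sqrt k f g : (forall i, D i -> 1 <= g i) -> approx k f (fun i => g i ^+ 2) ->
  approx k (fun i => Num.sqrt (f i)) g.
Proof.
move=> g1 h; apply: (bigO_le ler01 h) => i Di; rewrite mul1r; exact: sqrt_lipschitz (g1 i Di).
Qed.

Definition mx_approx k m n (A B : I -> 'M[R]_(m, n)) : Prop :=
  forall a b, approx k (fun i => A i a b) (fun i => B i a b).
Definition mx_bigO k m n (A : I -> 'M[R]_(m, n)) : Prop :=
  forall a b, bigO k (fun i => A i a b).

Lemma mx_approx_bounded k m n (A B : I -> 'M[R]_(m, n)) : mx_approx k A B -> mx_bigO 0 B -> mx_bigO 0 A.
Proof. by move=> h b a c; exact: approx_bounded (h a c) (b a c). Qed.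

Lemma mx_bigOM k l m n p (A : I -> 'M[R]_(m, n)) (B : I -> 'M[R]_(n, p)) :
  mx_bigO k A -> mx_bigO l B -> mx_bigO (k + l) (fun i => A i *m B i).
Proof.
move=> hA hB a b; apply: (bigO_eq (f := fun i => \sum_c A i a c * B i c b)) => [|i _]; last by rewrite mxE.
by apply: bigO_sum => c; apply: bigOM.
Qed.

Lemma mx_approxM k l m n p (A A' : I -> 'M[R]_(m, n)) (B B' : I -> 'M[R]_(n, p)) :
  mx_approx k A A' -> mx_bigO 0 A' -> mx_bigO l B -> mx_approx (k + l) B B' ->
  mx_approx (k + l) (fun i => A i *m B i) (fun i => A' i *m B' i).
Proof.
move=> a b c e x y.
apply: (bigO_eq (f := fun i => \sum_j A i x j * B i j y - \sum_j A' i x j * B' i j y)) => [|i _]; last by rewrite !mxE.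
by apply: approx_sum => j; apply: approxM.
Qed.

Lemma mx_approxM0 k m n p (A A' : I -> 'M[R]_(m, n)) (B B' : I -> 'M[R]_(n, p)) :
  mx_approx k A A' -> mx_bigO 0 A' -> mx_approx k B B' -> mx_bigO 0 B' ->
  mx_approx k (fun i => A i *m B i) (fun i => A' i *m B' i).
Proof.
move=> a b c e; rewrite -[k in mx_approx k _ _]addn0; apply: mx_approxM => //; last by rewrite addn0.
exact: mx_approx_bounded c e.
Qed.

Lemma mx_approxZ k l m n (f f' : I -> R) (B B' : I -> 'M[R]_(m, n)) :
  approx k f f' -> bigO 0 f' -> mx_bigO l B -> mx_approx (k + l) B B' ->
  mx_approx (k + l) (fun i => f i *: B i) (fun i => f' i *: B' i).
Proof.
move=> a b c e x y.
apply: (bigO_eq (f := fun i => f i * B i x y - f' i * B' i x y)) => [|i _]; last by rewrite !mxE.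
exact: approxM.
Qed.

Lemma mx_approxZ0 k m n (f f' : I -> R) (B B' : I -> 'M[R]_(m, n)) :
  approx k f f' -> bigO 0 f' -> mx_approx k B B' -> mx_bigO 0 B' ->
  mx_approx k (fun i => f i *: B i) (fun i => f' i *: B' i).
Proof.
move=> a b c e; rewrite -[k in mx_approx k _ _]addn0; apply: mx_approxZ => //; last by rewrite addn0.
exact: mx_approx_bounded c e.
Qed.

Lemma mx_approx_eq k m n (A A' B B' : I -> 'M[R]_(m, n)) : mx_approx k A A' ->
  (forall i, D i -> B i = A i) -> (forall i, D i -> B' i = A' i) -> mx_approx k B B'.
Proof. by move=> h e e' a b; apply: bigO_eq (h a b) _ => i Di; rewrite e// e'. Qed.

Lemma approx_eq k f f' g g' : approx k f f' ->
  (forall i, D i -> g i = f i) -> (forall i, D i -> g' i = f' i) -> approx k g g'.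
Proof. by move=> h e e'; apply: bigO_eq h _ => i Di; rewrite e// e'. Qed.

Lemma approx_tr k n (A B : I -> 'M[R]_n) : mx_approx k A B ->
  approx k (fun i => \tr (A i)) (fun i => \tr (B i)).
Proof. by move=> h; apply: approx_sum. Qed.

Lemma approx_bigO k f g : approx k f g -> bigO k g -> bigO k f.
Proof. by move=> h hg; apply: bigO_eq (bigOD h hg) _ => i _; rewrite subrK. Qed.

Lemma bigO_tr k n (A : I -> 'M[R]_n) : mx_bigO k A -> bigO k (fun i => \tr (A i)).
Proof. by move=> h; apply: bigO_sum. Qed.

Lemma bigO_dot k l (x y : I -> 'rV[R]_3) : mx_bigO k x -> mx_bigO l y ->
  bigO (k + l) (fun i => dot (x i) (y i)).
Proof.
move=> hx hy; apply: (bigO_eq (f := fun i => \sum_c x i 0 c * y i 0 c)) => [|i _]; last exact: dotE.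
by apply: bigO_sum => c; apply: bigOM.
Qed.

(** The inverse is the adjugate divided by the determinant. *)
Lemma approx_invmx n (A : I -> 'M[R]_n) : (forall i, D i -> A i \in unitmx) ->
  mx_approx 1 A (fun=> 1%:M) -> mx_approx 1 (fun i => invmx (A i)) (fun=> 1%:M).
Proof.
move=> Au h.
have b1 m : mx_bigO 0 (fun=> 1%:M : 'M[R]_m) by move=> a b; exact: bigO_cst.
have hd := approx_det h (b1 n).
have hd1 : approx 1 (fun i => (\det (A i))^-1) (fun=> 1).
  by apply: approx_inv1; apply: bigO_eq hd _ => i _; rewrite det1.
have hadj : mx_approx 1 (fun i => \adj (A i)) (fun=> \adj (1%:M : 'M[R]_n)).
  move=> a b; apply: (bigO_eq (f := fun i => cofactor (A i) b a - cofactor 1%:M b a)) => [|i _]; last by rewrite !mxE.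
  apply: approxM0; [exact: approx_refl|exact: bigO_cst| |exact: bigO_cst].
  apply: approx_det => c e; last exact: bigO_cst.
  by apply: bigO_eq (h (lift b c) (lift a e)) _ => i _; rewrite !mxE.
move=> a b; apply: (bigO_eq (f := fun i => (\det (A i))^-1 * (\adj (A i)) a b - 1 * (\adj 1%:M) a b)).
  by apply: approxM0; [exact: hd1|exact: bigO_cst|exact: hadj|exact: bigO_cst].
move=> i Di; rewrite {1}/invmx (Au i Di) mxE mul1r; congr (_ - _).
by have := mul_mx_adj (1%:M : 'M[R]_n); rewrite det1 mul1mx => ->.
Qed.

End big_oh.

(** * Expansion of the coefficients of the first variation *)

Section asymptotics.
Variables (R : realType) (m : R) (g : 'rV[R]_3 -> 'M[R]_3).
Hypotheses (hm : 0 < m) (hg : asymptotically_flat_end m g).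
Local Notation V := 'rV[R]_3.
Local Notation ext := (@exterior R).
Local Notation t := (@inv_enorm R).
Local Notation Dg := (end_Dmetric m g).

(** A point together with a unit covector: all the geometric coefficients are
    functions of such a pair. *)
Definition directions : set (V * V) := [set p | ext p.1 /\ enorm p.2 = 1].
Definition scale (p : V * V) : R := t p.1.
Local Notation bO := (bigO directions scale).
Local Notation mO := (mx_bigO directions scale).
Local Notation ap := (approx directions scale).
Local Notation bcst := (bigO_cst directions scale).
Local Notation mxap := (mx_approx directions scale).

(** The coefficients of DX and, apart from the term with H, of X in the first
    variation. *)
Definition principal_coef (p : V * V) : 'M[R]_3 :=
  area_ratio (g p.1) p.2 *: (g p.1 *m tangent_inverse (g p.1) p.2).
Definition drift (p : V * V) : V :=
  \row_a (2^-1 * area_ratio (g p.1) p.2 * \tr (tangent_inverse (g p.1) p.2 *m Dg a p.1)).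
Definition projection (p : V * V) : 'M[R]_3 := 1%:M - p.2^T *m p.2.

Lemma scale01 p : directions p -> 0 <= scale p <= 1.
Proof.
move=> [ex _]; rewrite ltW ?inv_enorm_gt0//=.
by rewrite /scale /inv_enorm invf_le1 ?exterior_gt0// ltW.
Qed.
Local Notation s01 := scale01.

Lemma normal_bounded : mO 0 (fun p => p.2).
Proof.
move=> a b; rewrite ord1; apply: (bigO_bounded _ (c := 1)) => p [_ <-]; exact: coord_le_enorm.
Qed.

Lemma direction_bounded : mO 0 (fun p => scale p *: p.1).
Proof.
move=> a b; rewrite ord1; apply: (bigO_bounded _ (c := 1)) => p [ex _].
rewrite mxE normrM gtr0_norm ?inv_enorm_gt0// -(inv_enormK ex).
by rewrite ler_pM2l ?inv_enorm_gt0//; exact: coord_le_enorm.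
Qed.

Lemma one_bounded n : mO 0 (fun=> 1%:M : 'M[R]_n).
Proof. by move=> a b; exact: (bcst). Qed.

Lemma tr_bounded m' n (A : V * V -> 'M[R]_(m', n)) k : mO k A -> mO k (fun p => (A p)^T).
Proof. by move=> h a b; apply: (bigO_eq (h b a)) => p _; rewrite mxE. Qed.

Lemma tr_approx m' n k (A B : V * V -> 'M[R]_(m', n)) : mxap k A B -> mxap k (fun p => (A p)^T) (fun p => (B p)^T).
Proof. by move=> h a b; apply: (bigO_eq (h b a)) => p _; rewrite !mxE. Qed.

Lemma projection_bounded : mO 0 projection.
Proof.
move=> a b; apply: (bigO_eq (f := fun p => (1%:M : 'M[R]_3) a b - (p.2^T *m p.2) a b)) => [|p _]; last by rewrite !mxE.
apply: bigOB; first exact: one_bounded.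
exact: (mx_bigOM s01 (tr_bounded normal_bounded) normal_bounded).
Qed.

Lemma perturbation_decay i j : bO 2 (fun p => perturbation m g i j p.1).
Proof.
have [C hC] := af_decay hg.
exists `|C|, 1; split => // p [ex _] _.
have := hC i j [::] isT p.1 ex; rewrite /= addn0 => h; apply: (le_trans h).
by rewrite -exprVn ler_wpM2r ?exprn_ge0 ?ler_norm// ltW ?inv_enorm_gt0.
Qed.

Lemma dperturbation_decay a i j : bO 3 (fun p => partial a (perturbation m g i j) p.1).
Proof.
have [C hC] := af_decay hg.
exists `|C|, 1; split => // p [ex _] _.
have := hC i j [:: a] isT p.1 ex; rewrite /= => h; apply: (le_trans h).
by rewrite -exprVn ler_wpM2r ?exprn_ge0 ?ler_norm// ltW ?inv_enorm_gt0.
Qed.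

Lemma scaleO k : bO k (fun p => scale p ^+ k).
Proof. exact: bigO_t s01 k. Qed.

Lemma conf_approx : ap 1 (fun p => conf m p.1) (fun=> 1).
Proof.
apply: (bigO_eq (bigOM (bcst (m / 2)) (scaleO 1))) => p _.
by rewrite /conf /scale expr1 addrC addKr.
Qed.

Lemma conf_exp_approx k : ap 1 (fun p => conf m p.1 ^+ k) (fun=> 1).
Proof.
apply: (approx_eq (approx_exp s01 k conf_approx (bcst 1))) => // p _.
by rewrite expr1n.
Qed.

Lemma conf_bounded k : bO 0 (fun p => conf m p.1 ^+ k).
Proof. exact: (approx_bounded s01 (conf_exp_approx k) (bcst 1)). Qed.

Lemma metric_approx_conf : mxap 2 (fun p => g p.1) (fun p => (conf m p.1 ^+ 4)%:M).
Proof.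
move=> i j; apply: (bigO_eq (perturbation_decay i j)) => p _.
by rewrite (end_metricE m) !mxE mulr_natr addrK.
Qed.

Lemma metric_approx : mxap 1 (fun p => g p.1) (fun=> 1%:M).
Proof.
move=> i j; apply: (approx_trans (g := fun p => (conf m p.1 ^+ 4)%:M i j)).
  exact: (bigOW s01 _ (metric_approx_conf i j)).
apply: (approx_eq (approxM0 s01 (conf_exp_approx 4) (bcst 1) (approx_refl s01 1 (fun=> (i == j)%:R)) (bcst _))) => p _.
  by rewrite mxE mulr_natr.
by rewrite mxE mul1r.
Qed.

Lemma invmx_approx : mxap 1 (fun p => invmx (g p.1)) (fun=> 1%:M).
Proof. apply: (approx_invmx s01) metric_approx => p [ex _]; exact: metric_unit (af_pos hg ex). Qed.

Lemma det_metric_approx : ap 1 (fun p => \det (g p.1)) (fun=> 1).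
Proof.
apply: (approx_eq (approx_det s01 metric_approx (@one_bounded 3))) => // p _; by rewrite det1.
Qed.

Let n_refl : mxap 1 (fun p => p.2) (fun p => p.2).
Proof. by move=> a b; exact: (approx_refl s01). Qed.

Lemma raise_approx : mxap 1 (fun p => p.2 *m invmx (g p.1)) (fun p => p.2).
Proof.
apply: (mx_approx_eq (mx_approxM0 s01 n_refl normal_bounded invmx_approx (@one_bounded 3))) => // p _.
by rewrite mulmx1.
Qed.

Lemma conormal_approx : ap 1 (fun p => conormal_sq (g p.1) p.2) (fun=> 1).
Proof.
apply: (approx_eq (mx_approxM0 s01 raise_approx normal_bounded (tr_approx n_refl) (tr_bounded normal_bounded) 0 0)) => // p [_ n1].
by rewrite n_sq// mxE.
Qed.

Lemma area_ratio_approx : ap 1 (fun p => area_ratio (g p.1) p.2) (fun=> 1).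
Proof.
apply: approx_sqrt => //.
apply: (approx_eq (approxM0 s01 det_metric_approx (bcst 1) conormal_approx (bcst 1))) => // p _; exact: esym (etrans (expr1n _ _) (esym (mulr1 1))).
Qed.

Lemma tangent_inverse_approx : mxap 1 (fun p => tangent_inverse (g p.1) p.2) projection.
Proof.
have h1 : mxap 1 (fun p => invmx (g p.1) *m p.2^T) (fun p => p.2^T).
  apply: (mx_approx_eq (mx_approxM0 s01 invmx_approx (@one_bounded 3) (tr_approx n_refl) (tr_bounded normal_bounded))) => // p _.
  by rewrite mul1mx.
have h2 := mx_approxM0 s01 h1 (tr_bounded normal_bounded) raise_approx normal_bounded.
have b2 := mx_bigOM s01 (tr_bounded normal_bounded) normal_bounded.
have h3 := mx_approxZ0 s01 (approx_inv1 s01 conormal_approx) (bcst 1) h2 b2.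
move=> a b; apply: (approx_eq (approxB (invmx_approx a b) (h3 a b))) => p _; first by rewrite !mxE.
by rewrite /projection scale1r !mxE.
Qed.

Lemma principal_approx : mxap 1 principal_coef projection.
Proof.
have h := mx_approxM0 s01 metric_approx (@one_bounded 3) tangent_inverse_approx projection_bounded.
have b := mx_bigOM s01 (@one_bounded 3) projection_bounded.
apply: (mx_approx_eq (mx_approxZ0 s01 area_ratio_approx (bcst 1) h b)) => // p _.
by rewrite scale1r mul1mx.
Qed.

Lemma projection_tr p : directions p -> \tr (projection p) = 2.
Proof.
move=> [_ n1]; rewrite raddfB/= mxtrace1 mxtrace_mulC n_sq// mxtrace1.
by rewrite -natrB.
Qed.

Let radial a p : R := 2 * m * scale p ^+ 2 * (scale p *: p.1) 0 a.

Let radial_bigO a : bO 2 (radial a).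
Proof.
exact: (bigOM (k := 2) (l := 0) (bigOM (k := 0) (l := 2) (bcst (2 * m)) (scaleO 2)) (direction_bounded 0 a)).
Qed.

Lemma Dmetric_approx a : mxap 3 (fun p => Dg a p.1) (fun p => (- (2 * m * scale p ^+ 3 * p.1 0 a))%:M).
Proof.
move=> i j.
have h : bO 3 (fun p => radial a p * (conf m p.1 ^+ 3 - 1)).
  exact: (bigOM (k := 2) (l := 1) (radial_bigO a) (conf_exp_approx 3)).
apply: (bigO_eq (bigOB (dperturbation_decay a i j) (bigOM (k := 3) (l := 0) h (bcst (i == j)%:R)))) => p _.
rewrite /radial !mxE /scale.
move: (conf m p.1) (t p.1) (p.1 0 a) (partial _ _ _) => c s xa q.
by case: (i == j); rewrite ?mulr1n ?mulr0n; ring.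
Qed.

Lemma Dmetric_bigO a : mO 2 (fun p => Dg a p.1).
Proof.
move=> i j; apply: (approx_bigO (bigOW s01 (leqnSn 2) (Dmetric_approx a i j))).
apply: (bigO_eq (bigON (bigOM (k := 2) (l := 0) (radial_bigO a) (bcst (i == j)%:R)))) => p _.
rewrite /radial !mxE /scale.
move: (t p.1) (p.1 0 a) => s xa.
by case: (i == j); rewrite ?mulr1n ?mulr0n; ring.
Qed.

(** Only the conformal part contributes at order t^2, through the trace 2 of the
    projection onto the tangent plane. *)
Lemma drift_approx : mxap 3 drift (fun p => - (2 * m * scale p ^+ 3) *: p.1).
Proof.
move=> i a; rewrite ord1.
have h1 := mx_approxM s01 (k := 1) (l := 2) tangent_inverse_approx projection_bounded (Dmetric_bigO a) (Dmetric_approx a).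
have h2 := approx_tr s01 h1.
have b2 : bO 2 (fun p => \tr (tangent_inverse (g p.1) p.2 *m Dg a p.1)).
  apply: (bigO_tr s01).
  exact: (mx_bigOM s01 (k := 0) (mx_approx_bounded s01 tangent_inverse_approx projection_bounded) (Dmetric_bigO a)).
have h3 := approxM (k := 1) (l := 2) area_ratio_approx (bcst 1) b2 h2.
apply: (bigO_eq (bigOM (k := 0) (l := 3) (bcst 2^-1) h3)) => p dp.
rewrite mul_mx_scalar mxtraceZ (projection_tr dp) !mxE; by field.
Qed.

Lemma drift_bigO : mO 2 drift.
Proof.
move=> i a; apply: (approx_bigO (bigOW s01 (leqnSn 2) (drift_approx i a))).
apply: (bigO_eq (bigON (radial_bigO a))) => p _.
by rewrite /radial ord1 !mxE; ring.
Qed.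

(** The determinant of the Schwarzschild metric is conf^12, whose square root is a
    polynomial in 1 / r. *)
Lemma sqrt_det_approx : ap 2 (fun p => Num.sqrt (\det (g p.1))) (fun p => 1 + 3 * m * scale p).
Proof.
have h : ap 2 (fun p => \det (g p.1)) (fun p => (conf m p.1 ^+ 6) ^+ 2).
  apply: (approx_eq (approx_det s01 metric_approx_conf _)) => // [i j|p _].
    apply: (bigO_eq (bigOM (k := 0) (l := 0) (conf_bounded 4) (bcst (i == j)%:R))) => p _.
    by rewrite mxE mulr_natr.
  by rewrite det_scalar -!exprM.
have h1 : ap 2 (fun p => Num.sqrt (\det (g p.1))) (fun p => conf m p.1 ^+ 6).
  apply: approx_sqrt h => p [ex _]; rewrite exprn_ege1// /conf lerDl.
  by rewrite mulr_ge0// ?divr_ge0// ltW// inv_enorm_gt0.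
apply: (approx_trans h1).
pose s p := m / 2 * scale p.
have bs k c : bO 0 (fun p => c * s p ^+ k).
  apply: (bigOM (k := 0) (l := 0) (bcst c)); apply: bigO_exp.
  apply: (bigOM (k := 0) (l := 0) (bcst _)).
  by apply: (bigO_eq (bigOW s01 (leq0n 1) (scaleO 1))) => p _; rewrite expr1.
apply: (bigO_eq (f := fun p => (m / 2) ^+ 2 * (15 * s p ^+ 0 + 20 * s p ^+ 1 + 15 * s p ^+ 2 + 6 * s p ^+ 3 + 1 * s p ^+ 4) * scale p ^+ 2)).
  apply: (bigOM (k := 0) (l := 2)); last exact: scaleO.
  by apply: (bigOM (k := 0) (l := 0) (bcst _)); do 4 (apply: bigOD; last exact: bs); exact: bs.
move=> p _; rewrite /s /conf -/(scale p); move: (scale p) => u; by field.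
Qed.

End asymptotics.

(** * The three test fields *)

Section fields.
Variable R : realType.
Local Notation V := 'rV[R]_3.
Local Notation ext := (@exterior R).
Local Notation t := (@inv_enorm R).
Implicit Types (x n b : V).

Lemma C1_field_eq (Om : set V) X X' DX DX' : C1_field Om X DX -> (forall x, X x = X' x) ->
  (forall x, DX x = DX' x) -> C1_field Om X' DX'.
Proof. by move=> h /funext <- /funext <-. Qed.

(** The field x / |x|^q. *)
Definition radial_field (q : nat) x : V := t x ^+ q *: x.
Definition Dradial_field (q : nat) x : 'M[R]_3 :=
  (t x ^+ q)%:M - (q%:R * t x ^+ q.+2) *: (x^T *m x).

Lemma C1_radial_field k : C1_field ext (radial_field k.+1) (Dradial_field k.+1).
Proof.
apply: C1_field_eq; first exact: (C1_field_scale (C1_expn k (@C1_inv_enorm R)) (C1_field_linear ext 1%:M)).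
  by move=> x /=; rewrite mulmx1.
move=> x /=; rewrite mulmx1 scalemx1 scalerA linearZ/= -scalemxAl; congr (_ + _).
by rewrite -[RHS]scaleNr mulrN -mulrA -exprD addn3.
Qed.

(** The factor leaves 1 + m / r from the growth 1 + 3 m / r of the volume
    element, and its gradient 2 m x / r^3 cancels the trace of the derivative of the
    metric along b. *)
Definition corrected_constant (m : R) b x : V := (1 - 2 * m * t x) *: b.
Definition Dcorrected_constant (m : R) b x : 'M[R]_3 := (2 * m * t x ^+ 3) *: (x^T *m b).

Lemma C1_corrected_constant m b : C1_field ext (corrected_constant m b) (Dcorrected_constant m b).
Proof.
have h : C1_on ext (fun x => 1 + - (2 * m) * t x) (fun x => (2 * m * t x ^+ 3) *: x).
  apply: C1_eq; first exact: (C1D (C1_cst ext 1) (C1M (C1_cst ext (- (2 * m))) (@C1_inv_enorm R))).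
  by move=> x /=; rewrite scaler0 addr0 add0r scalerA mulrNN.
apply: C1_field_eq; first exact: (C1_field_scale h (C1_field_cst ext b)).
  by move=> x /=; rewrite mulNr.
by move=> x /=; rewrite scaler0 add0r linearZ/= -scalemxAl.
Qed.

Lemma mul_outer n x b : n *m (x^T *m b) = dot n x *: b.
Proof. by rewrite mulmxA [n *m _]mx11_scalar mul_scalar_mx. Qed.

Lemma outer_scale (a : R) x b : (a *: x)^T *m (a *: b) = a ^+ 2 *: (x^T *m b).
Proof.
have -> : (a *: x)^T = a *: x^T by apply/matrixP => i j; rewrite !mxE.
by rewrite -scalemxAl -scalemxAr scalerA.
Qed.

Lemma mxtrace_outer x b : \tr (x^T *m b) = dot b x.
Proof. by rewrite mxtrace_mulC /mxtrace big_ord1. Qed.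

Lemma mxtrace_projection n (M : 'M[R]_3) : \tr ((1%:M - n^T *m n) *m M) = \tr M - dot (n *m M) n.
Proof. by rewrite mulmxBl mul1mx raddfB/= -mulmxA mxtrace_outer. Qed.

End fields.

Section field_estimates.
Variables (R : realType) (m : R) (g : 'rV[R]_3 -> 'M[R]_3).
Hypotheses (hm : 0 < m) (hg : asymptotically_flat_end m g).
Local Notation V := 'rV[R]_3.
Local Notation bO := (bigO (@directions R) (@scale R)).
Local Notation mO := (mx_bigO (@directions R) (@scale R)).
Local Notation ap := (approx (@directions R) (@scale R)).
Local Notation bcst := (bigO_cst (@directions R) (@scale R)).
Local Notation s01 := (@scale01 R).

(** The part of the first variation integrand along X that does not involve H. *)
Definition variation_density (X : V -> V) (DX : V -> 'M[R]_3) (p : V * V) : R :=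
  \tr (principal_coef g p *m DX p.1) + dot (drift m g p) (X p.1).

Lemma outer_bounded : mO 0 (fun p => (scale p *: p.1)^T *m (scale p *: p.1)).
Proof. exact: (mx_bigOM s01 (tr_bounded (@direction_bounded R)) (@direction_bounded R)). Qed.

Lemma Dradial_field_bigO q : mO q (fun p => Dradial_field q p.1).
Proof.
move=> i j.
have h := bigOB (@one_bounded R 3 i j) (bigOM (k := 0) (l := 0) (bcst q%:R) (outer_bounded i j)).
apply: (bigO_eq (bigOM (k := 0) (l := q) h (@scaleO R q))) => p _.
rewrite /Dradial_field outer_scale !mxE.
rewrite -/(scale p) !exprS; move: (scale p ^+ q) (scale p) => a s.
by case: (i == j); rewrite ?mulr1n ?mulr0n; ring.
Qed.

Lemma radial_field_bigO k : mO k (fun p => radial_field k.+1 p.1).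
Proof.
move=> i j; apply: (bigO_eq (bigOM (k := 0) (l := k) (@direction_bounded R i j) (@scaleO R k))) => p _.
by rewrite /radial_field !mxE -/(scale p) exprS; ring.
Qed.

Lemma projection_Dradial k (p : V * V) : directions p -> \tr (projection p *m Dradial_field k.+1 p.1) =
  (1 - k%:R) * scale p ^+ k.+1 + k.+1%:R * scale p ^+ k.+3 * dot p.2 p.1 ^+ 2.
Proof.
move=> [ex n1]; rewrite mxtrace_projection /Dradial_field -/(scale p).
have e : scale p ^+ k.+3 * dot p.1 p.1 = scale p ^+ k.+1.
  by rewrite -[RHS]mulr1 -(inv_enorm_sq ex) mulrA -exprD addn2.
rewrite raddfB/= mxtrace_scalar mxtraceZ mxtrace_outer -mulrA e.
rewrite mulmxBr mul_mx_scalar -scalemxAr mul_outer dotBl !dotZl (dotC p.1 p.2).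
rewrite -(enorm_sq p.2) n1 expr1n -(mulr_natr (_ ^+ _) 3).
move: (scale p ^+ k.+1) (scale p ^+ k.+3) (dot _ _) => a c z.
by rewrite [k.+1%:R]mulrS; ring.
Qed.

(** The main term is the trace of the Jacobian over the plane orthogonal to n. *)
Lemma radial_variation k : ap k.+2 (variation_density (radial_field k.+1) (Dradial_field k.+1))
  (fun p => (1 - k%:R) * scale p ^+ k.+1 + k.+1%:R * scale p ^+ k.+3 * dot p.2 p.1 ^+ 2).
Proof.
have h1 : bO k.+2 (fun p => \tr (principal_coef g p *m Dradial_field k.+1 p.1)
    - \tr (projection p *m Dradial_field k.+1 p.1)).
  apply: (approx_tr s01); apply: (mx_approxM s01 (k := 1) (l := k.+1)).
  - exact: principal_approx hg.
  - exact: projection_bounded.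
  - exact: Dradial_field_bigO.
  - by move=> a c; exact: (approx_refl s01).
have h2 := bigO_dot s01 (k := 2) (l := k) (drift_bigO hg) (radial_field_bigO k).
apply: (bigO_eq (bigOD h1 h2)) => p [ex n1].
rewrite -(projection_Dradial k (conj ex n1)) /variation_density; exact: addrAC.
Qed.

Lemma projection_Dcorrected b (p : V * V) : \tr (projection p *m Dcorrected_constant m b p.1) =
  2 * m * scale p ^+ 3 * (dot p.1 b - dot p.2 p.1 * dot p.2 b).
Proof.
rewrite mxtrace_projection /Dcorrected_constant -/(scale p).
by rewrite mxtraceZ mxtrace_outer -scalemxAr mul_outer !dotZl (dotC b p.1) (dotC b p.2) mulrBr.
Qed.

(** The terms 2 m (x.b) / r^3 from the Jacobian and from the drift cancel. *)
Lemma constant_variation b : bO 3 (fun p =>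
  variation_density (corrected_constant m b) (Dcorrected_constant m b) p
  + 2 * m * scale p ^+ 3 * (dot p.2 p.1 * dot p.2 b)).
Proof.
have bb : mO 0 (fun=> b) by move=> i j; exact: bcst.
have hD : mO 2 (fun p => Dcorrected_constant m b p.1).
  move=> i j.
  have h := bigOM (k := 2) (l := 0) (bigOM (k := 0) (l := 2) (bcst (2 * m)) (@scaleO R 2))
    (mx_bigOM s01 (tr_bounded (@direction_bounded R)) bb i j).
  apply: (bigO_eq h) => p _.
  rewrite /Dcorrected_constant linearZ/= -scalemxAl !mxE -/(scale p); ring.
have h1 : bO 3 (fun p => \tr (principal_coef g p *m Dcorrected_constant m b p.1)
    - \tr (projection p *m Dcorrected_constant m b p.1)).
  apply: (approx_tr s01); apply: (mx_approxM s01 (k := 1) (l := 2)).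
  - exact: principal_approx hg.
  - exact: projection_bounded.
  - exact: hD.
  - by move=> a c; exact: (approx_refl s01).
have h2 : bO 3 (fun p => dot (drift m g p - - (2 * m * scale p ^+ 3) *: p.1) b).
  apply: (bigO_dot s01 (k := 3) (l := 0) _ bb) => i j.
  by apply: (bigO_eq (drift_approx hg i j)) => p _; rewrite !mxE.
have h3 : bO 3 (fun p => - (2 * m * scale p) * dot (drift m g p) b).
  apply: (bigOM (k := 1) (l := 2)); last exact: (bigO_dot s01 (k := 2) (l := 0) (drift_bigO hg) bb).
  apply: (bigO_eq (bigOM (k := 0) (l := 1) (bcst (- (2 * m))) (@scaleO R 1))) => p _.
  by rewrite expr1 mulNr.
apply: (bigO_eq (bigOD h1 (bigOD h2 h3))) => p [ex n1].
rewrite projection_Dcorrected /variation_density /corrected_constant dotZr dotBl dotZl -/(scale p).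
move: (\tr _) (scale p) (dot p.1 b) (dot p.2 p.1) (dot p.2 b) (dot (drift _ _ _) b) => a s u v w z; ring.
Qed.

Lemma volume_bounded : bO 0 (fun p => Num.sqrt (\det (g p.1))).
Proof.
apply: (approx_bounded s01 (sqrt_det_approx hm hg)).
apply: bigOD; first exact: bcst.
apply: (bigOM (k := 0) (l := 0) (bcst _)).
by apply: (bigO_eq (bigOW s01 (leq0n 1) (@scaleO R 1))) => p _; rewrite expr1.
Qed.

Lemma constant_volume b : bO 2 (fun p => Num.sqrt (\det (g p.1)) * (1 - 2 * m * scale p) * dot p.2 b
  - (1 + m * scale p) * dot p.2 b).
Proof.
have bb : mO 0 (fun=> b) by move=> i j; exact: bcst.
have hb : bO 0 (fun p => dot p.2 b) by exact: (bigO_dot s01 (k := 0) (l := 0) (@normal_bounded R) bb).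
have hs : bO 0 (fun p => 1 - 2 * m * scale p).
  apply: bigOB; first exact: bcst.
  apply: (bigOM (k := 0) (l := 0) (bcst _)).
  by apply: (bigO_eq (bigOW s01 (leq0n 1) (@scaleO R 1))) => p _; rewrite expr1.
have h1 := bigOM (k := 2) (l := 0) (bigOM (k := 2) (l := 0) (sqrt_det_approx hm hg) hs) hb.
have h2 := bigOM (k := 2) (l := 0) (bigOM (k := 0) (l := 2) (bcst (- (6 * m ^+ 2))) (@scaleO R 2)) hb.
apply: (bigO_eq (bigOD h1 h2)) => p _.
move: (Num.sqrt _) (scale p) (dot _ _) => a s u; ring.
Qed.

Lemma area_ratio_lower : exists2 d : R, 0 < d & forall p, directions p -> scale p <= d ->
  1 / 2 <= area_ratio (g p.1) p.2.
Proof.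
have [K [d [K0 d0 h]]] := area_ratio_approx hg.
have K1 : 0 < K + 1 by rewrite ltr_wpDl.
exists (Num.min d (2 * (K + 1))^-1); first by rewrite lt_min d0 invr_gt0 mulr_gt0.
move=> p dp; rewrite le_min => /andP[td tK].
have := h p dp td; rewrite expr1 ler_norml => /andP[h1 _].
have /andP[s0 _] := s01 dp.
have : (K + 1) * scale p <= 1 / 2.
  have -> : 1 / 2 = (K + 1) * (2 * (K + 1))^-1 by rewrite invfM mulrCA mulfV ?gt_eqF// mulr1 mul1r.
  by rewrite ler_pM2l.
by rewrite mulrDl; lra.
Qed.

End field_estimates.

(** * Continuity of the coefficients, and the pointwise inequality *)

Section coefficient_continuity.
Variable R : realType.
Local Notation V := 'rV[R]_3.

(** The inverse is the adjugate over the determinant, a rational function. *)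
Lemma cvg_invmx (T : Type) (F : set_system T) {FF : Filter F} (n : nat) (A : T -> 'M[R]_n) (a : 'M[R]_n) :
  A @ F --> a -> a \in unitmx -> (fun s => invmx (A s)) @ F --> invmx a.
Proof.
move=> hA ua; have da : \det a != 0 by rewrite -unitfE -unitmxE.
have hd : (fun s => \det (A s)) @ F --> \det a by exact: cvg_det.
have hadj : (fun s => \adj (A s)) @ F --> \adj a.
  apply: cvg_mx => i j; rewrite mxE; under eq_fun do rewrite mxE.
  apply: cvgM; first exact: cvg_cst.
  apply: cvg_det; apply: cvg_mx => k l; rewrite !mxE; under eq_fun do rewrite !mxE.
  exact: cvg_coord.
have h : (fun s => (\det (A s))^-1 *: \adj (A s)) @ F --> invmx a.
  by rewrite /invmx ua; apply: cvgZ => //; exact: cvgV.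
apply: cvg_trans h; apply: near_eq_cvg.
have : \forall s \near F, \det (A s) != 0 by exact: (cvgr_neq0 _ hd da).
by apply: filterS => s ds; rewrite /invmx unitmxE unitfE ds.
Qed.

Section at_point.
Variables (T : Type) (F : set_system T).
Context {FF : Filter F}.
Variables (G : T -> 'M[R]_3) (G0 : 'M[R]_3) (n : T -> V) (n0 : V).
Hypotheses (hG : G @ F --> G0) (hn : n @ F --> n0).
Hypotheses (gs : G0^T = G0) (gp : forall v : V, v != 0 -> 0 < (v *m G0 *m v^T) 0 0) (n1 : enorm n0 = 1).

Let ug := metric_unit gp.

Lemma cvg_conormal : (fun s => conormal_sq (G s) (n s)) @ F --> conormal_sq G0 n0.
Proof.
apply: cvg_coord; apply: cvg_mulmx; last exact: cvg_trmx.
by apply: cvg_mulmx; [exact: hn|exact: cvg_invmx].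
Qed.

Lemma cvg_sqrt (f : T -> R) l : f @ F --> l -> (fun s => Num.sqrt (f s)) @ F --> Num.sqrt l.
Proof. by move=> h; apply: (cvg_comp f Num.sqrt h); exact: sqrt_continuous. Qed.

Lemma cvg_area_ratio : (fun s => area_ratio (G s) (n s)) @ F --> area_ratio G0 n0.
Proof. by apply: cvg_sqrt; apply: cvgM; [exact: cvg_det|exact: cvg_conormal]. Qed.

Lemma cvg_tangent_inverse : (fun s => tangent_inverse (G s) (n s)) @ F --> tangent_inverse G0 n0.
Proof.
have hi : (fun s => invmx (G s)) @ F --> invmx G0 by exact: cvg_invmx.
have k0 : conormal_sq G0 n0 != 0 by rewrite gt_eqF// conormal_gt0.
have hk : (fun s => (conormal_sq (G s) (n s))^-1) @ F --> (conormal_sq G0 n0)^-1.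
  by apply: cvgV => //; exact: cvg_conormal.
apply: cvgB; first exact: hi.
apply: cvgZ; first exact: hk.
by apply: cvg_mulmx; apply: cvg_mulmx; [exact: hi|exact: cvg_trmx|exact: hn|exact: hi].
Qed.

End at_point.

Section on_surface.
Variables (Om : set V) (g : V -> 'M[R]_3) (Dg : 'I_3 -> V -> 'M[R]_3).
Hypothesis hg : C1_metric Om g Dg.
Variables (N : set V) (nu : V -> V) (H : R).
Hypotheses (NO : N `<=` Om) (nu1 : forall p, N p -> enorm (nu p) = 1).
Hypothesis cnu : {within N, continuous nu}.

Lemma within_metric x : N x -> g @ within N (nbhs x) --> g x.
Proof. by move=> Nx; exact: (cvg_within_filter N (metric_continuous hg (NO Nx))). Qed.
Lemma within_Dmetric a x : N x -> Dg a @ within N (nbhs x) --> Dg a x.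
Proof.
by move=> Nx; have h := @cm_Dcont _ _ _ _ hg _ (NO Nx) a; exact: (cvg_within_filter N h). Qed.
Lemma within_normal x : N x -> nu @ within N (nbhs x) --> nu x.
Proof. by move=> Nx; exact: ((subspace_continuousP N nu).1 cnu x Nx). Qed.

Lemma variation_A_continuous : {within N, continuous (variation_A g nu)}.
Proof.
apply/subspace_continuousP => x Nx.
have gs := cm_sym hg (NO Nx); have gp := cm_pos hg (NO Nx).
apply: cvgZ; first exact: (cvg_area_ratio (within_metric Nx) (within_normal Nx) gp).
by apply: cvg_mulmx; [exact: within_metric|exact: (cvg_tangent_inverse (within_metric Nx) (within_normal Nx) gs gp (nu1 Nx))].
Qed.

Lemma variation_B_continuous : {within N, continuous (variation_B g Dg nu H)}.
Proof.
apply/subspace_continuousP => x Nx.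
have gs := cm_sym hg (NO Nx); have gp := cm_pos hg (NO Nx).
apply: cvg_row => a; apply: cvgB; apply: cvgM.
- by apply: cvgM; [exact: cvg_cst|exact: (cvg_area_ratio (within_metric Nx) (within_normal Nx) gp)].
- apply: cvg_sumr => i; apply: cvg_coord.
  by apply: cvg_mulmx; [exact: (cvg_tangent_inverse (within_metric Nx) (within_normal Nx) gs gp (nu1 Nx))|exact: within_Dmetric].
- apply: cvgM; first exact: cvg_cst.
  by apply: cvg_sqrt; apply: cvg_det; exact: within_metric.
- by apply: cvg_coord; exact: within_normal.
Qed.

End on_surface.
End coefficient_continuity.

(** The weights of the test fields: s stands for 1 / r, tau for 1 / r0, D1, D2, D3
    for the parts of the integrands j1, j2, j3 that do not involve H. With
    2 z^2 the main term of D2, the combination 4 tau j2 - j3 is at least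
    s^3 + 5 tau z^2 up to errors: s^3 absorbs the errors of all expansions and z^2
    those linear in H. *)
Lemma variation_inequality (R : realType) (m K s tau H nx nb v D1 D2 D3 j1 j2 j3 : R) :
  1 <= K -> 0 < s -> s <= tau -> 10 * K * tau <= 1 -> `|v| <= K ->
  `|D1 + 2 * m * s ^+ 3 * (nx * nb)| <= K * s ^+ 3 ->
  `|v * (1 - 2 * m * s) * nb - (1 + m * s) * nb| <= K * s ^+ 2 ->
  `|D2 - 2 * s ^+ 4 * nx ^+ 2| <= K * s ^+ 3 ->
  `|D3 - (- s ^+ 3 + 3 * s ^+ 5 * nx ^+ 2)| <= K * s ^+ 4 ->
  j1 = D1 - H * v * ((1 - 2 * m * s) * nb) ->
  j2 = D2 - H * v * (s ^+ 2 * nx) ->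
  j3 = D3 - H * v * (s ^+ 3 * nx) ->
  m * (H * s * nb) + 2 * m * (s ^+ 3 * (nx * nb)) <=
  - j1 - H * nb + 3 * K * (4 * tau * j2 - j3) + 7 * K ^+ 3 * tau * H ^+ 2.
Proof.
move=> K1 s0 st Kt vK; rewrite !ler_norml => /andP[_ E1] /andP[F1 F2] /andP[E2 _] /andP[_ E3] -> -> ->.
have t0 : 0 < tau by exact: lt_le_trans st.
pose z := s ^+ 2 * nx.
have s3 : 0 < s ^+ 3 by exact: exprn_gt0.
have s2 : 0 < s ^+ 2 by exact: exprn_gt0.
have K0 : 0 < K by lra.
have hHv : `|H * v| <= K * `|H| by rewrite normrM mulrC ler_wpM2r.
(* Young's inequality, for the factor c = 4 tau - s of H v z in 4 tau j2 - j3. *)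
have y1 (c w : R) : `|c| <= 5 * tau -> c * (H * v * w) <= 5 * tau * w ^+ 2 + 2 * K ^+ 2 * tau * H ^+ 2.
  move=> hc; apply: (le_trans (ler_norm _)); rewrite normrM normrM.
  apply: (@le_trans _ _ (5 * tau * (K * `|H| * `|w|))).
    by apply: ler_pM => //; rewrite ler_wpM2r.
  have := mulr_ge0 (ltW t0) (sqr_ge0 (2 * `|w| - K * `|H|)).
  rewrite -(real_normK (num_real w)) -(real_normK (num_real H)).
  have := mulr_ge0 (ltW t0) (sqr_ge0 (K * `|H|)).
  have := mulr_ge0 (ltW t0) (sqr_ge0 `|w|).
  move: (`|w|) (`|H|) => zz hh; lra.
have step1 : 2^-1 * s ^+ 3 <= 4 * tau * (D2 - H * v * z) - (D3 - H * v * (s * z)) + 2 * K ^+ 2 * tau * H ^+ 2.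
  have c1 : `|4 * tau - s| <= 5 * tau by rewrite ler_norml; apply/andP; split; lra.
  have := y1 _ z c1.
  have e2 : 4 * tau * (2 * z ^+ 2 - K * s ^+ 3) <= 4 * tau * D2.
    rewrite ler_pM2l ?mulr_gt0//; move: E2; rewrite /z; lra.
  have e3 : D3 <= - s ^+ 3 + 3 * s * z ^+ 2 + K * s ^+ 4 by move: E3; rewrite /z; lra.
  have e4 : 3 * s * z ^+ 2 <= 3 * tau * z ^+ 2 by rewrite ler_wpM2r ?sqr_ge0// ler_pM2l.
  have e5 : K * s ^+ 4 <= K * tau * s ^+ 3.
    by rewrite exprS mulrA; apply: ler_wpM2r; [exact: ltW|rewrite ler_pM2l].
  have e6 : 5 * K * tau * s ^+ 3 <= 2^-1 * s ^+ 3 by apply: ler_wpM2r; [exact: ltW|lra].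
  move: (H * v) (s ^+ 3) (z ^+ 2) e2 e3 e4 e5 e6 => w q zz; lra.
(* From s (|H| - s)^2 >= 0. *)
have Hs : 2 * (`|H| * s ^+ 2) <= tau * H ^+ 2 + s ^+ 3.
  have h := mulr_ge0 (ltW s0) (sqr_ge0 (`|H| - s)).
  have h2 : s * H ^+ 2 <= tau * H ^+ 2 by rewrite ler_wpM2r ?sqr_ge0.
  move: h h2; rewrite -(real_normK (num_real H)); move: (`|H|) => hh; lra.
have step2 : - (H * (v * (1 - 2 * m * s) * nb - (1 + m * s) * nb)) <= K * (`|H| * s ^+ 2).
  apply: (le_trans (ler_norm _)); rewrite normrN normrM mulrCA ler_wpM2l//.
  by rewrite ler_norml F1 F2.
have K3 : K <= K ^+ 3 by rewrite exprS ler_peMr ?exprn_ege1//; exact: ltW.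
have K3' : tau * H ^+ 2 * K <= tau * H ^+ 2 * K ^+ 3.
  by rewrite ler_wpM2l// mulr_ge0 ?sqr_ge0// ltW.
have step3 : 3 * K * (2^-1 * s ^+ 3) <= 3 * K * (4 * tau * (D2 - H * v * z) - (D3 - H * v * (s * z)) + 2 * K ^+ 2 * tau * H ^+ 2).
  by rewrite ler_pM2l// mulr_gt0.
have Hs' : K * (2 * (`|H| * s ^+ 2)) <= K * (tau * H ^+ 2 + s ^+ 3) by rewrite ler_pM2l.
move: step3 Hs'; rewrite /z (_ : s * (s ^+ 2 * nx) = s ^+ 3 * nx); last by ring.
have pos : 0 <= tau * H ^+ 2 * K ^+ 3 by apply: mulr_ge0; [apply: mulr_ge0; [exact: ltW|exact: sqr_ge0]|apply: exprn_ge0; exact: ltW].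
move: step2 K3' E1; move: (`|H| * s ^+ 2) => hs; lra.
Qed.

(** * Integration over the surface *)

Section conclusion.
Variables (R : realType) (m : R) (g : 'rV[R]_3 -> 'M[R]_3).
Hypotheses (hm : 0 < m) (hg : asymptotically_flat_end m g).
Local Notation V := 'rV[R]_3.
Local Notation ext := (@exterior R).
Local Notation t := (@inv_enorm R).
Local Notation Dg := (end_Dmetric m g).

(** The constants of all asymptotic expansions, merged into one. *)
Lemma uniform_expansions b : exists K d : R, [/\ 1 <= K, 0 < d, 10 * K * d <= 1 &
  forall x n, ext x -> enorm n = 1 -> t x <= d ->
  [/\ `|Num.sqrt (\det (g x))| <= K,
      `|variation_density m g (corrected_constant m b) (Dcorrected_constant m b) (x, n)
        + 2 * m * t x ^+ 3 * (dot n x * dot n b)| <= K * t x ^+ 3,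
      `|Num.sqrt (\det (g x)) * (1 - 2 * m * t x) * dot n b - (1 + m * t x) * dot n b| <= K * t x ^+ 2,
      `|variation_density m g (radial_field 2) (Dradial_field 2) (x, n) - 2 * t x ^+ 4 * dot n x ^+ 2|
        <= K * t x ^+ 3 &
      `|variation_density m g (radial_field 3) (Dradial_field 3) (x, n)
        - (- t x ^+ 3 + 3 * t x ^+ 5 * dot n x ^+ 2)| <= K * t x ^+ 4] /\
  1 / 2 <= area_ratio (g x) n].
Proof.
have [K1 [d1 [K10 d10 h1]]] := volume_bounded hm hg.
have [K2 [d2 [K20 d20 h2]]] := constant_variation hg b.
have [K3 [d3 [K30 d30 h3]]] := constant_volume hm hg b.
have [K4 [d4 [K40 d40 h4]]] := radial_variation hg 1.
have [K5 [d5 [K50 d50 h5]]] := radial_variation hg 2.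
have [d6 d60 h6] := area_ratio_lower hg.
pose K := 1 + K1 + K2 + K3 + K4 + K5.
have K0 : 0 < K by rewrite /K; lra.
pose d := Num.min (10 * K)^-1 (Num.min d1 (Num.min d2 (Num.min d3 (Num.min d4 (Num.min d5 d6))))).
exists K, d; split.
- by rewrite /K; lra.
- by rewrite /d !lt_min d10 d20 d30 d40 d50 d60 invr_gt0 mulr_gt0.
- apply: (@le_trans _ _ (10 * K * (10 * K)^-1)).
    by apply: ler_wpM2l; [rewrite mulr_ge0// ltW|rewrite /d ge_min lexx].
  by rewrite mulfV// gt_eqF// mulr_gt0.
move=> x n ex n1; rewrite /d !le_min => /and5P[_ td1 td2 td3 /and3P[td4 td5 td6]].
have dx : directions (x, n) by [].
have s0 k : 0 <= t x ^+ k by rewrite exprn_ge0// ltW// inv_enorm_gt0.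
split; last exact: h6 dx td6.
split.
- by have := h1 _ dx td1; rewrite expr0 mulr1 /= => h; apply: (le_trans h); rewrite /K; lra.
- apply: (le_trans (h2 _ dx td2)); apply: (ler_wpM2r (s0 3)); rewrite /K; lra.
- apply: (le_trans (h3 _ dx td3)); apply: (ler_wpM2r (s0 2)); rewrite /K; lra.
- have := h4 _ dx td4; rewrite /= subrr mul0r add0r => h; apply: (le_trans h).
  apply: (ler_wpM2r (s0 3)); rewrite /K; lra.
- have := h5 _ dx td5; rewrite /= (_ : 1 - 2%:R = -1 :> R); last by ring.
  rewrite mulN1r => h; apply: (le_trans h); apply: (ler_wpM2r (s0 4)); rewrite /K; lra.
Qed.

Section surface.
Variables (N : set V) (nu : V -> V) (H : R) (sigma : {measure set (borel3 R) -> \bar R}).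
Hypotheses (csN : closed_surface N) (NO : N `<=` ext) (un : outward_unit_normal N nu).
Hypothesis cmc : has_constant_mean_curvature g N nu H.
Hypothesis hs : is_area_measure (@euclidean R) N sigma.

Let hC := end_C1_metric hg.
Let nu1 p : N p -> enorm (nu p) = 1. Proof. by move=> Np; exact: (un_unit un Np). Qed.
Let A := variation_A g nu.
Let B := variation_B g Dg nu H.

Lemma variation_continuous : {within N, continuous A} /\ {within N, continuous B}.
Proof.
split.
  exact: (variation_A_continuous hC NO nu1 (un_continuous un)).
exact: (@variation_B_continuous R ext g Dg hC N nu H NO nu1 (un_continuous un)).
Qed.

Lemma variation_jetE X DX x : jet A B X DX x =
  variation_density m g X DX (x, nu x) - H * Num.sqrt (\det (g x)) * dot (nu x) (X x).
Proof.
rewrite /jet /variation_density -addrA; congr (_ + _).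
rewrite !dotE mulr_sumr -sumrB; apply: eq_bigr => a _; rewrite !mxE; ring.
Qed.

(** First variation formula: along X the g-area varies H times as fast as the
    enclosed g-volume. *)
Lemma first_variation X DX : C1_field ext X DX -> \int[sigma]_(x in N) jet A B X DX x = 0.
Proof.
move=> hX; have [cA cB] := variation_continuous.
apply: (exact_integral csN hs cA cB NO hX) => p Np.
have [U [phi [lp pU]]] := cs_param csN Np.
exists U, phi; split => //; apply: (variation_exact hC NO nu1 lp).
- by move=> u Uu; exact: (un_normal un lp Uu).
- by move=> u Uu; exact: (cmc lp Uu).
Qed.

Let cN := cs_compact csN.
Let mN : measurable (N : set (borel3 R)).
Proof. by apply: closed_measurable_borel3; apply: compact_closed cN; exact: norm_hausdorff. Qed.
Let sfin : (sigma N < +oo)%E. Proof. exact: area_lty csN hs (@euclidean_continuous R N). Qed.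
Let gcont x : N x -> {for x, continuous g}. Proof. by move=> /NO ex; exact: (metric_continuous hC ex). Qed.

Section comparison.
Variable mu : {measure set (borel3 R) -> \bar R}.
Hypothesis hmu : is_area_measure g N mu.

(** By area_ratioE the two densities differ by the factor area_ratio. *)
Lemma area_comparison : (forall x, N x -> 1 / 2 <= area_ratio (g x) (nu x)) -> (sigma N <= 2%:E * mu N)%E.
Proof.
move=> h; apply: (area_le csN hs hmu (@euclidean_continuous R N) gcont) => // U phi u lp Uu.
have Np := chart_sub lp Uu; have ex := NO Np.
rewrite /area_density /induced_metric /euclidean mulmx1.
rewrite (area_ratioE (af_sym hg ex) (af_pos hg ex) (lp_immersion lp Uu) (un_normal un lp Uu) (nu1 Np)).
have := h _ Np; have := sqrtr_ge0 (\det (frame phi u *m (frame phi u)^T)).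
by move: (Num.sqrt _) (area_ratio _ _) => e r e0 hr; nra.
Qed.

Lemma total_curvature_bound Lambda : (forall x, N x -> 1 / 2 <= area_ratio (g x) (nu x)) ->
  (\int[mu]_(x in N) (H ^+ 2)%:E <= Lambda%:E)%E ->
  \int[sigma]_(x in N) (H ^+ 2) <= 2 * Lambda.
Proof.
move=> /area_comparison hc.
rewrite (integral_cst mu mN) Rintegral_cst//.
have mfin : (mu N < +oo)%E by exact: area_lty csN hmu gcont.
have fmu : mu N \is a fin_num by rewrite ge0_fin_numE ?measure_ge0.
have fsi : sigma N \is a fin_num by rewrite ge0_fin_numE ?measure_ge0.
move: hc; rewrite -(fineK fmu) -(fineK fsi) -!EFinM !lee_fin => ca h.
have := ler_wpM2l (sqr_ge0 H) ca; lra.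
Qed.

End comparison.

Lemma integrand_integrable f : {within N, continuous f} ->
  sigma.-integrable (N : set (borel3 R)) (EFin \o f).
Proof. exact: within_continuous_integrable cN sfin. Qed.

Lemma within_continuousD (f h : V -> R) : {within N, continuous f} -> {within N, continuous h} ->
  {within N, continuous (fun x => f x + h x)}.
Proof. by move=> cf ch x; apply: cvgD; [exact: cf|exact: ch]. Qed.

Lemma within_continuousM (f h : V -> R) : {within N, continuous f} -> {within N, continuous h} ->
  {within N, continuous (fun x => f x * h x)}.
Proof. by move=> cf ch x; apply: cvgM; [exact: cf|exact: ch]. Qed.

Lemma within_continuousZ c (f : V -> R) : {within N, continuous f} ->
  {within N, continuous (fun x => c * f x)}.
Proof. by move=> cf x; apply: cvgM; [exact: cvg_cst|exact: cf]. Qed.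

Lemma within_continuousC (c : R) : {within N, continuous (fun=> c)}.
Proof. by move=> x; exact: cvg_cst. Qed.

Lemma surface_integralD (f h : V -> R) : {within N, continuous f} -> {within N, continuous h} ->
  \int[sigma]_(x in N) (f x + h x) = \int[sigma]_(x in N) f x + \int[sigma]_(x in N) h x.
Proof. by move=> cf ch; apply: RintegralD => //; exact: integrand_integrable. Qed.

Lemma surface_integralZ c (f : V -> R) : {within N, continuous f} ->
  \int[sigma]_(x in N) (c * f x) = c * \int[sigma]_(x in N) f x.
Proof. by move=> cf; apply: RintegralZl => //; exact: integrand_integrable. Qed.

(** On integration the test fields contribute nothing by the first variation
    formula, and H n.b nothing because the flux of b vanishes. *)
Lemma force_bound b K tau :
  (forall x, N x -> m * (H * t x * dot (nu x) b) + 2 * m * (t x ^+ 3 * (dot (nu x) x * dot (nu x) b)) <=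
    - jet A B (corrected_constant m b) (Dcorrected_constant m b) x - H * dot (nu x) b
    + 3 * K * (4 * tau * jet A B (radial_field 2) (Dradial_field 2) x
               - jet A B (radial_field 3) (Dradial_field 3) x) + 7 * K ^+ 3 * tau * H ^+ 2) ->
  m * (\int[sigma]_(x in N) (H * t x * dot (nu x) b)) +
  2 * m * (\int[sigma]_(x in N) (t x ^+ 3 * (dot (nu x) x * dot (nu x) b)))
  <= 7 * K ^+ 3 * tau * (\int[sigma]_(x in N) (H ^+ 2)).
Proof.
move=> ineq.
have [cA cB] := variation_continuous.
have cJ X DX : C1_field ext X DX -> {within N, continuous (jet A B X DX)}.
  by move=> hX; exact: (jet_continuous NO cA cB hX).
have h1 := C1_corrected_constant m b.
have h2 : C1_field ext (radial_field 2) (Dradial_field 2) := @C1_radial_field R 1.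
have h3 : C1_field ext (radial_field 3) (Dradial_field 3) := @C1_radial_field R 2.
have cnu := un_continuous un.
have ct : {within N, continuous t}.
  apply: within_continuous_sub NO _ => x ex; exact: has_grad_continuous ((@C1_inv_enorm R).1 x ex).
have cid : {within N, continuous (fun x : V => x)}.
  by apply: within_continuous_sub NO _ => x _; exact: cvg_id.
have cnb : {within N, continuous (fun x => dot (nu x) b)}.
  by move=> x; apply: cvg_dot; [exact: cnu|exact: cvg_cst].
have cnx : {within N, continuous (fun x => dot (nu x) x)}.
  by move=> x; apply: cvg_dot; [exact: cnu|exact: cid].
have ct3 : {within N, continuous (fun x => t x ^+ 3)}.
  by have := within_continuousM ct (within_continuousM ct ct).
have cl : {within N, continuous (fun x => H * t x * dot (nu x) b)}.
  by apply: within_continuousM => //; exact: within_continuousZ.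
have cr : {within N, continuous (fun x => t x ^+ 3 * (dot (nu x) x * dot (nu x) b))}.
  by apply: within_continuousM => //; exact: within_continuousM.
have [[c1 c2] c3] := (cJ _ _ h1, cJ _ _ h2, cJ _ _ h3).
have [[v1 v2] v3] := (first_variation h1, first_variation h2, first_variation h3).
have v4 := flux_zero un b csN hs.
move: (jet A B (corrected_constant m b) _) (jet A B (radial_field 2) _) (jet A B (radial_field 3) _)
  c1 c2 c3 v1 v2 v3 ineq => j1 j2 j3 c1 c2 c3 v1 v2 v3 ineq.
pose e1 x := -1 * j1 x + - H * dot (nu x) b.
pose e2 x := 4 * tau * j2 x + -1 * j3 x.
pose e3 x := e1 x + (3 * K * e2 x + 7 * K ^+ 3 * tau * H ^+ 2).
have ce1 : {within N, continuous e1}.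
  by apply: within_continuousD; exact: within_continuousZ.
have ce2 : {within N, continuous e2}.
  by apply: within_continuousD; exact: within_continuousZ.
have ce4 : {within N, continuous (fun x => 3 * K * e2 x + 7 * K ^+ 3 * tau * H ^+ 2)}.
  by apply: within_continuousD; [exact: within_continuousZ|exact: within_continuousC].
have ce3 : {within N, continuous e3} by exact: within_continuousD.
have I1 : \int[sigma]_(x in N) e1 x = 0.
  rewrite (surface_integralD (within_continuousZ (c := -1) c1) (within_continuousZ (c := - H) cnb)).
  by rewrite (surface_integralZ _ c1) (surface_integralZ _ cnb) v1 v4 !mulr0 addr0.
have I2 : \int[sigma]_(x in N) e2 x = 0.
  rewrite (surface_integralD (within_continuousZ (c := 4 * tau) c2) (within_continuousZ (c := -1) c3)).
  by rewrite (surface_integralZ _ c2) (surface_integralZ _ c3) v2 v3 !mulr0 addr0.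
have E3 : \int[sigma]_(x in N) e3 x = 7 * K ^+ 3 * tau * (\int[sigma]_(x in N) (H ^+ 2)).
  rewrite (surface_integralD ce1 ce4) I1 add0r.
  rewrite (surface_integralD (within_continuousZ (c := 3 * K) ce2) (@within_continuousC _)).
  by rewrite (surface_integralZ _ ce2) I2 mulr0 add0r (surface_integralZ _ (@within_continuousC _)).
rewrite -E3 -!surface_integralZ// -surface_integralD//; try exact: within_continuousZ.
apply: le_Rintegral => //.
- by apply: integrand_integrable; apply: within_continuousD; exact: within_continuousZ.
- exact: integrand_integrable.
- by move=> x Nx; apply: (le_trans (ineq x Nx)); rewrite /e3 /e1 /e2; lra.
Qed.

End surface.
End conclusion.

Theorem lemma5p1 (R : realType) (m : R) (g : 'rV[R]_3 -> 'M[R]_3)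
    (hm : 0 < m) (hg : asymptotically_flat_end m g)
    (Lambda : R) (b : 'rV[R]_3) :
  exists sigma0 C : R, 0 < C /\
    forall (N : set 'rV[R]_3) (nu : 'rV[R]_3 -> 'rV[R]_3) (H : R)
      (mu sigma : {measure set (borel3 R) -> \bar R}),
    closed_surface N ->
    N `<=` @exterior R ->
    outward_unit_normal N nu ->
    has_constant_mean_curvature g N nu H ->
    is_area_measure g N mu ->
    is_area_measure (@euclidean R) N sigma ->
    (\int[mu]_(x in N) (H ^+ 2)%:E <= Lambda%:E)%E ->
    sigma0 <= inner_radius N ->
    (8 * pi)^-1 * (\int[sigma]_(x in N) (H / enorm x * dot (nu x) b)) +
    (4 * pi)^-1 *
      (\int[sigma]_(x in N) (dot (nu x) x * dot (nu x) b / enorm x ^+ 3))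
    <= C * m^-1 * (inner_radius N)^-1.
Proof.
have [K [d [K1 d0 Kd hK]]] := uniform_expansions hm hg b.
have p0 : 0 < pi :> R by exact: pi_gt0.
have K30 : 0 < K ^+ 3 by rewrite exprn_gt0//; lra.
exists d^-1, ((8 * pi)^-1 * (14 * K ^+ 3 * (`|Lambda| + 1))); split.
  have L0 : 0 < `|Lambda| + 1 by rewrite ltr_wpDl.
  by apply: mulr_gt0; [rewrite invr_gt0 mulr_gt0|apply: mulr_gt0 => //; exact: mulr_gt0].
move=> N nu H mu sigma csN NO un cmc hmu hs hL r0.
have r0pos : 0 < inner_radius N by apply: lt_le_trans r0; rewrite invr_gt0.
pose tau := (inner_radius N)^-1.
have t0 : 0 < tau by rewrite invr_gt0.
have td : tau <= d by rewrite /tau -[d]invrK lef_pV2 ?posrE ?invr_gt0.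
have st x : N x -> inv_enorm x <= tau.
  move=> Nx; rewrite /inv_enorm /tau lef_pV2 ?posrE// ?exterior_gt0 //; last exact: NO.
  apply: ge_inf; last by exists x.
  by exists 0 => _ [y _ <-]; exact: enorm_ge0.
have expand x : N x -> _ := fun Nx => hK x (nu x) (NO x Nx) (un_unit un Nx) (le_trans (st x Nx) td).
have Kt : 10 * K * tau <= 1 by apply: le_trans Kd; apply: ler_wpM2l => //; lra.
have ineq := @force_bound _ _ _ hg _ _ _ _ csN NO un cmc hs b K tau.
have S := total_curvature_bound hg csN NO un hs hmu (fun x Nx => (expand x Nx).2) hL.
have F : m * (\int[sigma]_(x in N) (H * inv_enorm x * dot (nu x) b)) +
    2 * m * (\int[sigma]_(x in N) (inv_enorm x ^+ 3 * (dot (nu x) x * dot (nu x) b)))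
    <= 14 * K ^+ 3 * (`|Lambda| + 1) * tau.
  apply: (le_trans (ineq _)) => [x Nx|].
    have [[h1 h2 h3 h4 h5] _] := expand x Nx.
    apply: (variation_inequality (s := inv_enorm x) K1 _ (st x Nx) Kt h1 h2 h3 h4 h5).
    - by apply: inv_enorm_gt0; exact: NO.
    - by rewrite variation_jetE /corrected_constant dotZr.
    - by rewrite variation_jetE /radial_field dotZr.
    - by rewrite variation_jetE /radial_field dotZr.
  have := ler_norm Lambda.
  move: S; set I := Rintegral _ _ _ => S hl.
  have h : K ^+ 3 * tau * I <= K ^+ 3 * tau * (2 * (`|Lambda| + 1)).
    by apply: ler_wpM2l; [rewrite mulr_ge0// ltW|lra].
  move: h; move: (K ^+ 3) => k; lra.
have -> : (fun x => dot (nu x) x * dot (nu x) b / enorm x ^+ 3) =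
    (fun x => inv_enorm x ^+ 3 * (dot (nu x) x * dot (nu x) b)).
  by apply/funext => x; rewrite /inv_enorm exprVn mulrC.
move: F; rewrite -/tau.
set I1 := Rintegral _ _ _; set I2 := Rintegral _ _ _ => F.
have -> : (8 * pi)^-1 * I1 + (4 * pi)^-1 * I2 = (8 * pi)^-1 * m^-1 * (m * I1 + 2 * m * I2).
  have m0 : m != 0 by rewrite gt_eqF.
  have q0 : pi != 0 :> R by rewrite gt_eqF.
  by move: pi q0 => q q0; field; rewrite m0 q0.
rewrite [leRHS](_ : _ = (8 * pi)^-1 * m^-1 * (14 * K ^+ 3 * (`|Lambda| + 1) * tau)); last by ring.
apply: ler_wpM2l F; apply: ltW; apply: mulr_gt0; by rewrite invr_gt0 ?mulr_gt0.
Qed.
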